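(* Let $\mathfrak g=\mathfrak{sl}(n+1,\mathbb C)$ with $n\ge2$, or $\mathfrak g=\mathfrak{so}(n,\mathbb C)$ with $n\ge6$. Let $\mathcal R$ be the algebra of polynomial functions on the minimal nilpotent coadjoint orbit $\mathcal O_{\min}$, let $\star$ be its unique $G$-equivariant graded star product, and let $\Lambda^x$ be the operators on $\mathcal R$ with $\mu_x\star f=\mu_xf+\frac12\{\mu_x,f\}t+\Lambda^x(f)t^2$. For $x\in\mathfrak g$, $x\ne0$, $\Lambda^x$ fails to be a differential operator on $\mathcal O_{\min}$. In fact, neither $E'$ nor $E'+1$ left divides $D^x$ (i.e. there is no algebraic differential operator $A$ on $\mathcal O_{\min}$ with $D^x=E'A$ or with $D^x=(E'+1)A$).
   Context: $G=SL_{n+1}(\mathbb C)$ or $Spin_n(\mathbb C)$ respectively. $\mathcal S=S(\mathfrak g)$ is the algebra of polynomial functions on $\mathfrak g^*$ with its natural Poisson bracket. $\mathcal O_{\min}\subset\mathfrak g^*\simeq\mathfrak g$ (identification by the Killing form) is the orbit of highest root vectors, $I$ its ideal, and $\mathcal R=\mathcal S/I=\bigoplus_d\mathcal R^d$ the quotient graded Poisson algebra, which is also the algebra of regular functions on $\mathcal O_{\min}$. For $x\in\mathfrak g$, $\mu_x\in\mathcal R^1$ is the image of $x$. A graded star product on $\mathcal R$ is an associative $\mathbb C[t]$-linear product $\star$ on $\mathcal R[t]$ such that, writing $f\star g=\sum_{p\ge0}C_p(f,g)t^p$ for $f,g\in\mathcal R$: (i) $C_0(f,g)=fg$; (ii)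 $C_1(f,g)-C_1(g,f)=\{f,g\}$; (iii) $C_p(f,g)=(-1)^pC_p(g,f)$; (iv) $C_p(f,g)\in\mathcal R^{k+l-p}$ if $f\in\mathcal R^k$, $g\in\mathcal R^l$. It is $G$-equivariant if $\mu_x\star f-f\star\mu_x=t\{\mu_x,f\}$ for all $x\in\mathfrak g$, $f\in\mathcal R$. There is exactly one $G$-equivariant graded star product on $\mathcal R$, and for it $\mu_x\star f$ has no terms beyond $t^2$. Define $m$ by $\dim_{\mathbb C}\mathcal O_{\min}=2m+2$, and put $\varepsilon=0$ for $\mathfrak{sl}(n+1,\mathbb C)$, $\varepsilon=1$ for $\mathfrak{so}(n,\mathbb C)$. Let $X,h,Y\in\mathfrak g$ satisfy $X\in\mathcal O_{\min}$, $[X,Y]=h$, $[h,X]=2X$, $[h,Y]=-2Y$. Let $\mathcal D_{4;-1}(\mathcal O_{\min})$ be the space of algebraic differential operators $D$ on $\mathcal O_{\min}$ of order at most $4$ with $D(\mathcal R^p)\subseteq\mathcal R^{p-1}$. From earlier work: there is a non-zero $G$-equivariant linear map $\mathfrak g\to\mathcal D_{4;-1}(\mathcal O_{\min})$, $x\mapsto D^x$, unique up to scaling, with $D^x$ of order exactly $4$ for $x\ne0$; it is normalized by $D^Y(\mu_X^p)=\gamma_p\mu_X^{p-1}$ with $\gamma_p=p(p+\frac{m-1}{2})(p+\varepsilon)(p-\varepsilon+\frac m2)$. $E$ is the Euler vector field on $\mathcal O_{\min}$ (acting on $\mathcal R^d$ by $d$) and $E'=E+\frac{m+1}{2}$. 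*)

(* Defs.v *)
From HB Require Import structures.
From mathcomp Require Import all_boot all_order all_algebra.
From mathcomp Require Import generic_quotient ring_quotient.
From mathcomp Require Import boolp reals.
From mathcomp Require Import complex ring.
From mathcomp Require Import mpoly.

Set Implicit Arguments.
Unset Strict Implicit.
Unset Printing Implicit Defensive.

Import GRing.Theory.
Local Open Scope ring_scope.
Local Open Scope quotient_scope.

(* [Sl n] is sl(n+1), [So n] is so(n). *)
Variant simple_algebra : Type :=
  | Sl (n : nat) of (2 <= n)%N
  | So (n : nat) of (6 <= n)%N.

Definition matrix_size (L : simple_algebra) : nat :=
  match L with Sl n _ => n.+1 | So n _ => n end.

Definition is_sl (L : simple_algebra) : bool :=
  match L with Sl _ _ => true | So _ _ => false end.

Definition epsilon (L : simple_algebra) : nat := if is_sl L then 0 else 1.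

Section MatrixLieAlgebra.
Variables (R : realType) (L : simple_algebra).

Notation C := (complex R).
Notation N := (matrix_size L).

Definition bracket (x y : 'M[C]_N) : 'M[C]_N := x *m y - y *m x.

(* so(n) and SO(n) are taken with respect to the symmetric form with
   antidiagonal Gram matrix; then the upper triangular matrices in so(n) form a
   Borel subalgebra, as they do in sl(n+1). *)
Definition antidiag : 'M[C]_N := \matrix_(i, j) (j == rev_ord i)%:R.

Definition so_defect (x : 'M[C]_N) : 'M[C]_N :=
  x^T *m antidiag + antidiag *m x.

Definition lieg : {vspace 'M[C]_N} :=
  if is_sl L then lker (linfun (fun x : 'M[C]_N => \tr x : C^o))
  else lker (linfun so_defect).

Lemma memv_lieg (x : 'M[C]_N) :
  (x \in lieg) = if is_sl L then \tr x == 0 else so_defect x == 0.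
Proof.
have trL : linear (fun x : 'M[C]_N => \tr x : C^o).
  by move=> a u v; rewrite linearP.
have soL : linear so_defect.
  move=> a u v; rewrite /so_defect linearP /= mulmxDl mulmxDr.
  by rewrite -scalemxAl -scalemxAr scalerDr addrACA.
pose trl : {linear 'M[C]_N -> C^o} :=
  HB.pack (fun x : 'M[C]_N => \tr x : C^o)
    (GRing.isLinear.Build _ _ _ _ _ trL).
pose sol : {linear 'M[C]_N -> 'M[C]_N} :=
  HB.pack so_defect (GRing.isLinear.Build _ _ _ _ _ soL).
have tE : linfun (fun x : 'M[C]_N => \tr x : C^o) x = \tr x.
  exact: (lfunE trl).
have sE : linfun so_defect x = so_defect x by exact: (lfunE sol).
by rewrite /lieg; case: (is_sl L); rewrite memv_ker ?tE ?sE.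
Qed.

(* The group acting on g.  Spin_n acts on so(n) through its image SO_n. *)
Definition in_group (k : 'M[C]_N) : Prop :=
  \det k = 1 /\ (~~ is_sl L -> k^T *m antidiag *m k = antidiag).

Definition Ad (k x : 'M[C]_N) : 'M[C]_N := k *m x *m invmx k.

(* Highest weight vectors of the adjoint representation with respect to the
   Borel subalgebra of upper triangular matrices. *)
Definition highest_root_vector (x : 'M[C]_N) : Prop :=
  [/\ x \in lieg, x != 0 &
      forall b, b \in lieg -> is_trig_mx b^T -> exists c, bracket b x = c *: x].

Definition Omin (z : 'M[C]_N) : Prop :=
  exists k x, [/\ in_group k, highest_root_vector x & z = Ad k x].

(* Dimension of T_z(G.z) = [g, z]. *)
Definition orbit_dim (z : 'M[C]_N) : nat :=
  \dim <<[seq bracket x z | x <- vbasis lieg]>>%VS.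

Notation d := (\dim lieg).

Definition gbasis (i : 'I_d) : 'M[C]_N := (vbasis lieg)`_i.

Definition killing (x y : 'M[C]_N) : C :=
  \sum_(i < d) coord (vbasis lieg) i (bracket x (bracket y (gbasis i))).

(* S(g): the variable 'X_i is the basis vector [gbasis i], regarded as a linear
   function on g^*. *)
Definition Sg := {mpoly C[d]}.

Definition muS (x : 'M[C]_N) : Sg :=
  \sum_(i < d) coord (vbasis lieg) i x *: 'X_i.

Definition poissonS (F H : Sg) : Sg :=
  \sum_(i < d) \sum_(j < d)
    F^`M(i) * H^`M(j) * muS (bracket (gbasis i) (gbasis j)).

(* Value of F at the point of g^* that the Killing form identifies with z. *)
Definition evalS (F : Sg) (z : 'M[C]_N) : C :=
  F.@[fun i => killing (gbasis i) z].

Definition Imin : pred Sg := fun F => `[< forall z, Omin z -> evalS F z = 0 >].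

Lemma highest_root_vector_ex : exists x, highest_root_vector x.
Proof.
have N0 : (0 < N)%N by case: (L) => n //= hn; apply: leq_trans hn.
have N1 : (1 < N)%N by case: (L) => n hn /=; [apply: leqW | apply: leq_trans hn].
pose i0 := Ordinal N0; pose i1 := Ordinal N1.
have ne01 : i0 != i1 by [].
have mulDl (A : 'M[C]_N) (i j u v : 'I_N) :
    (A *m delta_mx i j) u v = A u i * (v == j)%:R.
  rewrite mxE (bigD1 i) //= big1 => [|k ki]; rewrite ?mxE ?eqxx ?addr0 //.
  by rewrite (negPf ki) mulr0.
have mulDr (A : 'M[C]_N) (i j u v : 'I_N) :
    (delta_mx i j *m A) u v = (u == i)%:R * A j v.
  rewrite mxE (bigD1 j) //= big1 => [|k kj]; rewrite ?mxE ?eqxx ?andbT ?addr0 //.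
  by rewrite (negPf kj) andbF mul0r.
have subE (A B : 'M[C]_N) (u v : 'I_N) : (A - B) u v = A u v - B u v.
  by rewrite !mxE.
have trigE (b : 'M[C]_N) (u v : 'I_N) : is_trig_mx b^T -> (v < u)%N -> b u v = 0.
  by move=> /is_trig_mxP /(_ v u) + lt; rewrite mxE; apply.
case slL : (is_sl L).
  exists (delta_mx i0 (rev_ord i0)).
  have r0 : rev_ord i0 != i0.
    by rewrite -val_eqE /= -lt0n subn_gt0.
  split.
  - rewrite memv_lieg slL /mxtrace big1 // => i _; rewrite mxE.
    by case: eqP => //= ->; rewrite eq_sym (negPf r0).
  - apply/eqP => /matrixP /(_ i0 (rev_ord i0)); rewrite !mxE !eqxx => /eqP.
    by rewrite oner_eq0.
  move=> b _ bt; exists (b i0 i0 - b (rev_ord i0) (rev_ord i0)).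
  apply/matrixP => u v; rewrite /bracket subE mulDl mulDr [RHS]mxE [delta_mx _ _ _ _]mxE.
  have -> : b u i0 = (u == i0)%:R * b i0 i0.
    case: eqP => [->|/eqP ui]; rewrite ?mul1r // mul0r trigE //=.
    by rewrite lt0n; apply: contraNneq ui => u0; apply/eqP/val_inj.
  have -> : b (rev_ord i0) v = (v == rev_ord i0)%:R * b (rev_ord i0) (rev_ord i0).
    case: eqP => [->|/eqP ui]; rewrite ?mul1r // mul0r trigE //=.
    have := ltn_ord v; rewrite -{2}(prednK N0) ltnS leq_eqVlt subn1.
    case/orP => // /eqP vN; move: ui; rewrite -val_eqE /= vN subn1 eqxx //.
  by case: (u == i0); case: (v == _); rewrite /=; ring.
(* E_{0,n-2} - E_{1,n-1} *)
exists (delta_mx i0 (rev_ord i1) - delta_mx i1 (rev_ord i0)).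
have JE (A : 'M[C]_N) (u v : 'I_N) : (antidiag *m A) u v = A (rev_ord u) v.
  rewrite mxE (bigD1 (rev_ord u)) //= big1 => [|k kj]; rewrite ?mxE ?eqxx ?mul1r ?addr0 //.
  by rewrite (negPf kj) mul0r.
have EJ (A : 'M[C]_N) (u v : 'I_N) : (A *m antidiag) u v = A u (rev_ord v).
  rewrite mxE (bigD1 (rev_ord v)) //= big1 => [|k kj]; rewrite ?mxE ?rev_ordK ?eqxx ?mulr1 ?addr0 //.
  by rewrite eq_sym (can2_eq rev_ordK rev_ordK) (negPf kj) mulr0.
have soE (b : 'M[C]_N) : (b \in lieg) -> forall u v, b u v = - b (rev_ord v) (rev_ord u).
  rewrite memv_lieg slL => /eqP /matrixP + u v.
  move=> /(_ (rev_ord u) v); rewrite mxE EJ JE !mxE rev_ordK => /eqP.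
  by rewrite addrC addr_eq0 => /eqP.
split.
- rewrite memv_lieg slL; apply/eqP/matrixP => u v; rewrite mxE EJ JE !mxE.
  rewrite !(can2_eq rev_ordK rev_ordK).
  by case: (u == rev_ord i0); case: (u == rev_ord i1);
    case: (v == rev_ord i0); case: (v == rev_ord i1); rewrite /=; ring.
- apply/eqP => /matrixP /(_ i0 (rev_ord i1)); rewrite !mxE !eqxx /= subr0 => /eqP.
  by rewrite oner_eq0.
move=> b bL bt; exists (b i0 i0 + b i1 i1).
have c0 u : b u i0 = (u == i0)%:R * b i0 i0.
  case: eqP => [->|/eqP ui]; rewrite ?mul1r // mul0r trigE //=.
  by rewrite lt0n; apply: contraNneq ui => u0; apply/eqP/val_inj.
have c1 u : b u i1 = (u == i0)%:R * b i0 i1 + (u == i1)%:R * b i1 i1.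
  case: (eqVneq u i0) => [->|u0]; first by rewrite (negPf ne01) mul1r mul0r addr0.
  case: (eqVneq u i1) => [->|u1]; first by rewrite mul1r mul0r add0r.
  rewrite !mul0r addr0 trigE //; move: u0 u1; rewrite -!val_eqE /=.
  by case: (nat_of_ord u) => [|[]].
have d0 v : b (rev_ord i0) v = - ((v == rev_ord i0)%:R * b i0 i0).
  by rewrite soE // rev_ordK (c0 (rev_ord v)) (can2_eq rev_ordK rev_ordK).
have d1 v : b (rev_ord i1) v
   = - ((v == rev_ord i0)%:R * b i0 i1 + (v == rev_ord i1)%:R * b i1 i1).
  by rewrite soE // rev_ordK (c1 (rev_ord v)) !(can2_eq rev_ordK rev_ordK).
apply/matrixP => u v.
rewrite /bracket mulmxBr mulmxBl.
rewrite !subE !mulDl !mulDr [RHS]mxE subE [delta_mx _ _ _ _]mxE [delta_mx i1 _ _ _]mxE (c0 u) (c1 u) d0 d1.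
case: (u == i0); case: (u == i1); case: (v == rev_ord i0); case: (v == rev_ord i1);
  rewrite /=; ring.
Qed.

Lemma Imin_idealr_closed : idealr_closed Imin.
Proof.
split.
- apply/asboolP => z _; exact: meval0.
- apply/asboolP; have [x hx] := highest_root_vector_ex.
  move=> /(_ (Ad 1%:M x)); rewrite /evalS meval1 => h.
  have /eqP : (1 : C) = 0.
    apply: h; exists 1%:M, x; split=> //; split; first exact: det1.
    by move=> _; rewrite trmx1 mul1mx mulmx1.
  by rewrite oner_eq0.
- move=> a u v /asboolP hu /asboolP hv; apply/asboolP => z hz.
  by rewrite /evalS mevalD mevalM [meval _ u]hu // [meval _ v]hv // mulr0 addr0.
Qed.

HB.instance Definition _ := isIdealr.Build Sg Imin Imin_idealr_closed.

Definition RO := {ideal_quot (Imin : idealr Sg)}.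

HB.instance Definition _ := GRing.ComNzRing.on RO.
HB.instance Definition _ := EqQuotient.on RO.

Definition piRO (F : Sg) : RO := \pi_RO F.

Definition scaleRO (c : C) (f : RO) : RO := piRO c%:MP * f.

Lemma scaleROA a b f : scaleRO a (scaleRO b f) = scaleRO (a * b) f.
Proof. by rewrite /scaleRO mulrA /piRO -rmorphM -mpolyCM. Qed.

Lemma scale1RO : left_id 1 scaleRO.
Proof. by move=> f; rewrite /scaleRO /piRO mpolyC1 rmorph1 mul1r. Qed.

Lemma scaleRODr : right_distributive scaleRO +%R.
Proof. by move=> a f g; rewrite /scaleRO mulrDr. Qed.

Lemma scaleRODl f : {morph scaleRO^~ f : a b / a + b}.
Proof. by move=> a b; rewrite /scaleRO /piRO mpolyCD rmorphD mulrDl. Qed.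

HB.instance Definition _ :=
  GRing.Zmodule_isLmodule.Build C RO scaleROA scale1RO scaleRODr scaleRODl.

Lemma scaleROAl a (f g : RO) : a *: (f * g) = (a *: f) * g.
Proof. exact: mulrA. Qed.

HB.instance Definition _ := GRing.Lmodule_isLalgebra.Build C RO scaleROAl.

Lemma scaleROAr a (f g : RO) : a *: (f * g) = f * (a *: g).
Proof. exact: mulrCA. Qed.

HB.instance Definition _ := GRing.Lalgebra_isAlgebra.Build C RO scaleROAr.

Definition mu (x : 'M[C]_N) : RO := piRO (muS x).

(* R^k; it is zero for k < 0. *)
Definition in_degree (k : int) (f : RO) : Prop :=
  match k with
  | Posz p => exists2 F : Sg, F \is p.-homog & f = piRO F
  | Negz _ => f = 0
  end.

(* I is a Poisson ideal, is homogeneous and is stable under G, so the following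
   operations, defined by lifting to S(g), do not depend on the lifts. *)
Definition poisson (f g : RO) : RO := piRO (poissonS (repr f) (repr g)).

Definition euler (f : RO) : RO :=
  piRO (\sum_(i < d) 'X_i * (repr f)^`M(i)).

Definition act (k : 'M[C]_N) (f : RO) : RO :=
  piRO (repr f \mPo [tuple muS (Ad k (gbasis i)) | i < d]).

Definition euler' (m : nat) (f : RO) : RO :=
  euler f + ((m%:R + 1) / 2 : C) *: f.

Definition star_coef (star : {poly RO} -> {poly RO} -> {poly RO})
  (p : nat) (f g : RO) : RO := (star f%:P g%:P)`_p.

(* {poly RO} is R[t]; a polynomial in C[t] acts on it through [in_alg RO]. *)
Record graded_star_product (star : {poly RO} -> {poly RO} -> {poly RO}) : Prop :=
  GradedStarProduct {
  star_linearl : forall (c : {poly C}) (u v w : {poly RO}),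
    star (map_poly (in_alg RO) c * u + v) w
    = map_poly (in_alg RO) c * star u w + star v w;
  star_linearr : forall (c : {poly C}) (u v w : {poly RO}),
    star u (map_poly (in_alg RO) c * v + w)
    = map_poly (in_alg RO) c * star u v + star u w;
  star_assoc : associative star;
  star_coef0 : forall f g, star_coef star 0 f g = f * g;
  star_coef1 : forall f g,
    star_coef star 1 f g - star_coef star 1 g f = poisson f g;
  star_parity : forall p f g,
    star_coef star p f g = (-1) ^+ p * star_coef star p g f;
  star_graded : forall (p k l : nat) f g,
    in_degree k f -> in_degree l g ->
    in_degree (k%:Z + l%:Z - p%:Z) (star_coef star p f g)
}.

Definition star_equivariant (star : {poly RO} -> {poly RO} -> {poly RO}) : Prop :=
  forall (x : 'M[C]_N) (f : RO), x \in lieg ->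
    star (mu x)%:P f%:P - star f%:P (mu x)%:P = 'X * (poisson (mu x) f)%:P.

Definition star_lambda (star : {poly RO} -> {poly RO} -> {poly RO})
  (Lambda : 'M[C]_N -> RO -> RO) : Prop :=
  forall (x : 'M[C]_N) (f : RO), x \in lieg ->
    star (mu x)%:P f%:P
    = (mu x * f)%:P + ((2^-1 : C) *: poisson (mu x) f)%:P * 'X
      + (Lambda x f)%:P * 'X^2.

End MatrixLieAlgebra.

(* Algebraic differential operators (Grothendieck).  O_min is smooth and
   quasi-affine with algebra of regular functions R, so the algebraic
   differential operators on O_min are those of the algebra R. *)
Section DifferentialOperators.
Variables (K : comNzRingType) (A : comAlgType K).

Fixpoint order_le (k : nat) (D : A -> A) : Prop :=
  match k with
  | 0 => forall a f, D (a * f) = a * D f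
  | k'.+1 => forall a, order_le k' (fun f => D (a * f) - a * D f)
  end.

Definition diffop_le (k : nat) (D : A -> A) : Prop := linear D /\ order_le k D.

Definition diffop (D : A -> A) : Prop := exists k, diffop_le k D.

Definition left_divides (P D : A -> A) : Prop :=
  exists2 B, diffop B & D =1 P \o B.

End DifferentialOperators.

Section D4.
Variables (R : realType) (L : simple_algebra).

Notation C := (complex R).
Notation N := (matrix_size L).

Notation RO := (RO R L).

Definition in_D4m1 (D : RO -> RO) : Prop :=
  diffop_le 4 D /\
  forall (p : nat) f, in_degree p f -> in_degree (p%:Z - 1) (D f).

Definition sl2_triple (X h Y : 'M[C]_N) : Prop :=
  [/\ bracket X Y = h, bracket h X = X *+ 2 & bracket h Y = - (Y *+ 2)].

Definition gamma (m p : nat) : C :=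
  let e := (epsilon L)%:R in
  p%:R * (p%:R + (m%:R - 1) / 2) * (p%:R + e) * (p%:R - e + m%:R / 2).

(* For p = 0 the normalization reads D^Y(1) = 0, since [gamma m 0 = 0]. *)
Record normalized_D4 (m : nat) (X Y : 'M[C]_N) (D : 'M[C]_N -> RO -> RO) : Prop :=
  NormalizedD4 {
  D4_mem : forall x, x \in lieg R L -> in_D4m1 (D x);
  D4_linear : forall (c : C) x y f, x \in lieg R L -> y \in lieg R L ->
    D (c *: x + y) f = c *: D x f + D y f;
  D4_equivariant : forall k x f, in_group k -> x \in lieg R L ->
    D (Ad k x) (act k f) = act k (D x f);
  D4_normalized : forall p, D Y (mu X ^+ p) = gamma m p *: mu X ^+ p.-1
}.

End D4.

(* Main.v *)
Require Import Defs.
From mathcomp Require Import all_boot all_order all_algebra.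
From mathcomp Require Import reals complex.
From HB Require Import structures.
From mathcomp Require Import generic_quotient ring_quotient boolp ring zify mpoly.

Set Implicit Arguments.
Unset Strict Implicit.
Unset Printing Implicit Defensive.

Import GRing.Theory Num.Theory.
Local Open Scope ring_scope.

(*PART CoreSl*)
Section Derivation.
Variables (A : comNzRingType) (d : A -> A).
Hypothesis dD : forall f g, d (f + g) = d f + d g.
Hypothesis dM : forall f g, d (f * g) = d f * g + f * d g.

Lemma der1 : d 1 = 0.
Proof.
have := dM 1 1; rewrite !mulr1 mul1r => /eqP.
by rewrite -subr_eq0 opprD addNKr oppr_eq0 => /eqP.
Qed.

Lemma derX f n : d (f ^+ n) = f ^+ n.-1 * d f *+ n.
Proof.
elim: n => [|n IH]; first by rewrite expr0 der1 mulr0n.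
rewrite exprS dM IH /=; case: n {IH} => [|n]; first by rewrite expr0 mulr1 mulr0n mulr0 addr0 mul1r.
by rewrite /= exprS !mulrSr; ring.
Qed.

Lemma dernat (n : nat) : d n%:R = 0.
Proof.
have d0 : d 0 = 0 by apply: (addrI (d 0)); rewrite -dD !addr0.
by elim: n => [|n IH] //; rewrite mulrSr dD IH der1 addr0.
Qed.

Lemma derMn f n : d (f *+ n) = d f *+ n.
Proof. by rewrite -(mulr_natl f) -(mulr_natl (d f)) dM dernat mul0r add0r. Qed.
Lemma derN f : d (- f) = - d f.
Proof.
have d0 : d 0 = 0 by apply: (addrI (d 0)); rewrite -dD !addr0.
by apply/eqP; rewrite -addr_eq0 -dD addNr d0.
Qed.
End Derivation.

Section SlCore.
Variables (F A : comNzRingType) (N : nat) (o l : 'I_N).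
Variable zeta : 'I_N -> 'I_N -> A.
Variable dd : 'I_N -> 'I_N -> A -> A.
Variable K : 'I_N -> 'I_N -> {additive A -> F}.
Hypothesis ol : o != l.
Hypothesis minor : forall i j k m, zeta i j * zeta k m = zeta i m * zeta k j.
Hypothesis trace0 : \sum_k zeta k k = 0.
Hypothesis ddD : forall i j f g, dd i j (f + g) = dd i j f + dd i j g.
Hypothesis ddM : forall i j f g, dd i j (f * g) = dd i j f * g + f * dd i j g.
Hypothesis dd_zeta : forall i j u v, i != j ->
  dd i j (zeta u v) =
    (if v == j then zeta u i else 0) - (if u == i then zeta j v else 0).
Hypothesis K_dd : forall i j u v f, i != j -> i != o -> j != l ->
  K u v (dd i j f) =
    (if u == i then K j v f else 0) - (if v == j then K u i f else 0).

Notation mid k := ((k != o) && (k != l)).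
Local Notation xi := (zeta l o).
Local Notation r := (N.-2).

Lemma sl_card_mid : #|[pred k : 'I_N | mid k]| = r.
Proof.
have := cardC (pred2 o l); rewrite card2 ol /= card_ord => H.
have -> : #|[pred k : 'I_N | mid k]| = #|[predC pred2 o l]|.
  by apply: eq_card => k; rewrite !inE negb_or.
have aux a b : (2 + a = b -> a = b.-2)%N by move=> <-.
exact: aux.
Qed.

Lemma sl_sum_mid (V : zmodType) (c : V) : \sum_(k | mid k) c = c *+ r.
Proof. by rewrite sumr_const sl_card_mid. Qed.

Lemma sl_trace_mid : \sum_(k | mid k) zeta k k = - (zeta l l + zeta o o).
Proof.
move: trace0; rewrite (bigD1 o) //= (bigD1 l) 1?eq_sym //= => /eqP.
by rewrite addrA addrC addr_eq0 [in X in _ == X]addrC => /eqP.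
Qed.

Let lo : (l == o) = false. Proof. by rewrite eq_sym (negPf ol). Qed.
Let ol' : (o == l) = false. Proof. by rewrite (negPf ol). Qed.

Lemma sl_ddX i j f n : dd i j (f ^+ n) = f ^+ n.-1 * dd i j f *+ n.
Proof. exact: derX (@ddM i j) f n. Qed.

Lemma sl_xi_pred p : xi ^+ p.-1 * xi *+ p = xi ^+ p *+ p.
Proof. by case: p => // p; rewrite exprSr. Qed.

Section Mid.
Variables (k : 'I_N) (mk : mid k) (p : nat).
Let ko : (k == o) = false. Proof. by case/andP: mk => /negPf. Qed.
Let kl : (k == l) = false. Proof. by case/andP: mk => _ /negPf. Qed.
Let ok : (o == k) = false. Proof. by rewrite eq_sym. Qed.
Let lk : (l == k) = false. Proof. by rewrite eq_sym. Qed.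

Definition simpb := (eqxx, ol', lo, ko, kl, ok, lk).

Lemma dd_ko_xi : dd k o (xi ^+ p.+1) = xi ^+ p * zeta l k *+ p.+1.
Proof. by rewrite sl_ddX /= dd_zeta ?ko // !simpb ?subr0 ?sub0r /=; congr (_ *+ _); ring. Qed.

Lemma dd_lk_zlk :
  dd l k (xi ^+ p * zeta l k) = xi ^+ p * (zeta l l - zeta k k *+ p.+1).
Proof.
rewrite ddM sl_ddX !dd_zeta ?lk // !simpb ?subr0 ?sub0r /=.
have -> : xi ^+ p.-1 * (- zeta k o) *+ p * zeta l k
        = - (xi ^+ p.-1 * xi *+ p) * zeta k k.
  have := minor k o l k; move: (xi ^+ _) => w H.
  have -> : w * (- zeta k o) *+ p * zeta l k
      = - w *+ p * (zeta k o * zeta l k) by ring.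
  by rewrite H; ring.
by rewrite sl_xi_pred mulrS; ring.
Qed.

Lemma dd_lk_zll :
  dd l k (xi ^+ p * zeta l l) = - (xi ^+ p * zeta k l *+ p.+1).
Proof.
rewrite ddM sl_ddX !dd_zeta ?lk // !simpb ?subr0 ?sub0r /=.
have -> : xi ^+ p.-1 * (- zeta k o) *+ p * zeta l l
        = - (xi ^+ p.-1 * xi *+ p) * zeta k l.
  have := minor k o l l; move: (xi ^+ _) => w H.
  have -> : w * (- zeta k o) *+ p * zeta l l
      = - w *+ p * (zeta k o * zeta l l) by ring.
  by rewrite H; ring.
by rewrite sl_xi_pred mulrS; ring.
Qed.

Lemma dd_ko_zll :
  dd k o (xi ^+ p * zeta l l) = xi ^+ p.-1 * (zeta l l * zeta l k) *+ p.
Proof.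
rewrite ddM sl_ddX !dd_zeta ?ko // !simpb ?subr0 ?sub0r /=.
by move: (xi ^+ _) (xi ^+ _) => w w'; ring.
Qed.

(* q = p.-1 *)
Lemma dd_lk_zllzlk :
  dd l k (xi ^+ p * (zeta l l * zeta l k))
  = xi ^+ p * (zeta l l ^+ 2) - xi ^+ p * (zeta l l * zeta k k) *+ p.+2.
Proof.
rewrite !ddM sl_ddX !dd_zeta ?lk // !simpb ?subr0 ?sub0r /=.
have -> : xi ^+ p.-1 * (- zeta k o) *+ p * (zeta l l * zeta l k)
        = - (xi ^+ p.-1 * xi *+ p) * (zeta l l * zeta k k).
  have := minor k o l k; move: (xi ^+ _) => w H.
  have -> : w * (- zeta k o) *+ p * (zeta l l * zeta l k)
      = - w *+ p * zeta l l * (zeta k o * zeta l k) by ring.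
  by rewrite H; ring.
rewrite sl_xi_pred.
have := minor k l l k; move: (xi ^+ _) => w H.
have -> : w * (- zeta k l * zeta l k +
   zeta l l * (zeta l l - zeta k k))
  = w * (- (zeta k l * zeta l k) + zeta l l ^+ 2 - zeta l l * zeta k k) by ring.
by rewrite H; ring.
Qed.
End Mid.

Lemma dd_lo_xi p : dd l o (xi ^+ p.+1) = xi ^+ p * (zeta l l - zeta o o) *+ p.+1.
Proof. by rewrite sl_ddX dd_zeta ?lo // !simpb ?subr0 ?sub0r /=; congr (_ *+ _); ring. Qed.

Lemma dd_lo_zll p : dd l o (xi ^+ p.+1 * zeta l l)
  = xi ^+ p * zeta l l ^+ 2 *+ p.+1 - xi ^+ p.+1 * zeta o l *+ p.+2.
Proof.
rewrite ddM sl_ddX !dd_zeta ?lo // !eqxx sub0r /=.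
have -> : xi ^+ p * (zeta l l - zeta o o) *+ p.+1 * zeta l l
  = (xi ^+ p * zeta l l ^+ 2 - xi ^+ p * (zeta l l * zeta o o)) *+ p.+1
  by move: (xi ^+ p) => w; ring.
by rewrite (minor l l o o) (exprSr xi p); move: (xi ^+ p) => w; ring.
Qed.

Lemma zll_lower p :
  xi ^+ p * zeta l l *+ (p.+1 * (2 * p.+1 + r)) =
  \sum_(k | mid k) dd l k (dd k o (xi ^+ p.+1)) + dd l o (xi ^+ p.+1) *+ p.+1.
Proof.
rewrite (eq_bigr (fun k => xi ^+ p * (zeta l l - zeta k k *+ p.+1) *+ p.+1)); last first.
  by move=> k mk; rewrite dd_ko_xi // (derMn (@ddD _ _) (@ddM _ _)) dd_lk_zlk.
rewrite dd_lo_xi sumrMnl -mulr_sumr sumrB sl_sum_mid sumrMnl sl_trace_mid.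
by move: (N.-2) (xi ^+ p) => c w; ring.
Qed.

Lemma eta_lower p :
  xi ^+ p.+1 * zeta o l *+ (p.+2 * (2 * p.+1 + r + 1)) =
  \sum_(k | mid k) dd l k (dd k o (xi ^+ p.+1 * zeta l l))
  - dd l o (xi ^+ p.+1 * zeta l l) *+ (p.+1 + r + 1).
Proof.
rewrite (eq_bigr (fun k => (xi ^+ p * (zeta l l ^+ 2)
     - xi ^+ p * (zeta l l * zeta k k) *+ p.+2) *+ p.+1)); last first.
  by move=> k mk; rewrite dd_ko_zll // (derMn (@ddD _ _) (@ddM _ _)) dd_lk_zllzlk.
rewrite dd_lo_zll sumrMnl sumrB sl_sum_mid sumrMnl -mulr_sumr -mulr_sumr sl_trace_mid.
have := minor l l o o => H.
have -> : xi ^+ p * (zeta l l * - (zeta l l + zeta o o)) =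
  - xi ^+ p * zeta l l ^+ 2 - xi ^+ p * (zeta l l * zeta o o) by ring.
rewrite H (exprSr xi p).
by move: (N.-2) (xi ^+ p) => c w; ring.
Qed.

Lemma sl_midE k : mid k -> ((k == o) = false) * ((k == l) = false)
  * ((o == k) = false) * ((l == k) = false).
Proof.
by case/andP=> /negPf ko /negPf kl; rewrite (eq_sym o) (eq_sym l) ko kl.
Qed.

Notation beta p := (K o l (xi ^+ p)).

Let Ksum u v (f : 'I_N -> A) :
  K u v (\sum_(k | mid k) f k) = \sum_(k | mid k) K u v (f k).
Proof. exact: raddf_sum. Qed.

Lemma K_ll_zll p : K l l (xi ^+ p * zeta l l) * (p.+1 * (2 * p.+1 + r))%:R
  = beta p.+1 * (r + p.+1)%:R.
Proof.
rewrite mulr_natr -raddfMn zll_lower raddfD raddfMn /= Ksum.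
rewrite (eq_bigr (fun=> beta p.+1)); last first.
  move=> k /sl_midE mk; rewrite !K_dd ?(eqxx, ol', lo, mk) //.
  by ring.
rewrite sl_sum_mid K_dd ?(eqxx, ol', lo) // natrD mulrDr !mulr_natr.
by ring.
Qed.

Lemma K_oo_zll p : K o o (xi ^+ p * zeta l l) * (p.+1 * (2 * p.+1 + r))%:R
  = - beta p.+1 * p.+1%:R.
Proof.
rewrite mulr_natr -raddfMn zll_lower raddfD raddfMn /= Ksum.
rewrite big1 => [|k /sl_midE mk]; last first.
  by rewrite K_dd ?(eqxx, ol', lo, mk) // subr0.
by rewrite K_dd ?(eqxx, ol', lo) //; ring.
Qed.

Lemma K_kk_zll k p : mid k -> K k k (xi ^+ p * zeta l l) * (p.+1 * (2 * p.+1 + r))%:R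
  = - beta p.+1.
Proof.
move=> mk; have mk' := sl_midE mk.
rewrite mulr_natr -raddfMn zll_lower raddfD raddfMn /= Ksum (bigD1 k) //=.
rewrite big1 => [|j /andP[/sl_midE mj jk]]; last first.
  by rewrite K_dd ?(eqxx, ol', lo, mj, mk') // (eq_sym k j) (negPf jk) subr0.
by rewrite !K_dd ?(eqxx, ol', lo, mk') //; ring.
Qed.

Lemma K_eta_sl p :
  K l o (xi ^+ p.+1 * zeta o l)
    * (p.+2 * (2 * p.+1 + r + 1) * (p.+2 * (2 * p.+2 + r)))%:R
  = beta p.+2 * (2 * p.+1 ^ 2 + (2 * r + 4) * p.+1 + (r + 1) * (r + 2))%:R.
Proof.
rewrite natrM mulrA (mulr_natr (K l o _)) -raddfMn eta_lower raddfB raddfMn /= Ksum.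
rewrite (eq_bigr (fun k => K o o (xi ^+ p.+1 * zeta l l) - K k k (xi ^+ p.+1 * zeta l l))); last first.
  by move=> k /sl_midE mk; rewrite !K_dd ?(eqxx, ol', lo, mk) //; ring.
rewrite K_dd ?(eqxx, ol', lo) // mulrBl mulr_suml.
rewrite (eq_bigr (fun k => - beta p.+2 * p.+2%:R + beta p.+2)); last first.
  by move=> k mk; rewrite mulrBl K_oo_zll K_kk_zll // opprK.
rewrite sl_sum_mid.
have -> : (K o o (xi ^+ p.+1 * zeta l l) - K l l (xi ^+ p.+1 * zeta l l)) *+ (p.+1 + N.-2 + 1) * (p.+2 * (2 * p.+2 + N.-2))%:R
 = - (K l l (xi ^+ p.+1 * zeta l l) * (p.+2 * (2 * p.+2 + N.-2))%:R
     - K o o (xi ^+ p.+1 * zeta l l) * (p.+2 * (2 * p.+2 + N.-2))%:R) *+ (p.+1 + N.-2 + 1) by ring.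
rewrite K_ll_zll K_oo_zll.
by move: (K o l _) (N.-2) => b c; ring.
Qed.

Lemma K_minor k p : mid k ->
  (K k l (xi ^+ p * zeta l k) + K l k (xi ^+ p * zeta k l)
   - K l l (xi ^+ p * zeta k k) - K k k (xi ^+ p * zeta l l))
    * (p.+1 ^ 2 * (2 * p.+1 + r))%:R
  = beta p.+1 * ((p + 2) * (2 * p.+1 + r + 1))%:R.
Proof.
move=> mk; have mk' := sl_midE mk.
have H1 : K k l (xi ^+ p * zeta l k) * p.+1%:R = beta p.+1.
  rewrite mulr_natr -raddfMn -dd_ko_xi // K_dd ?(eqxx, ol', lo, mk') //.
  by ring.
have H2 : K l k (xi ^+ p * zeta k l) * p.+1%:R
   = K l l (xi ^+ p * zeta l l) - K k k (xi ^+ p * zeta l l).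
  rewrite mulr_natr -raddfMn.
  have -> : xi ^+ p * zeta k l *+ p.+1 = - dd l k (xi ^+ p * zeta l l).
    by rewrite dd_lk_zll // opprK.
  rewrite raddfN /= K_dd ?(eqxx, ol', lo, mk') //.
  by ring.
have H3 : K l l (xi ^+ p * zeta k k) * p.+1%:R
   = K l l (xi ^+ p * zeta l l) - K k l (xi ^+ p * zeta l k).
  have : K l l (dd l k (xi ^+ p * zeta l k)) = K k l (xi ^+ p * zeta l k).
    rewrite K_dd ?(eqxx, ol', lo, mk') //.
    by ring.
  rewrite dd_lk_zlk // mulrBr raddfB /= (mulrnAr (xi ^+ p)) raddfMn /= => <-.
  by ring.
have H4 := K_ll_zll p; have H5 := K_kk_zll p mk.
set c1 := K k l _ in H1 H3 *; set c2 := K l k _ in H2 *.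
set c3 := K l l (xi ^+ p * zeta k k) in H3 *.
set c4 := K k k _ in H2 H5 *; set c5 := K l l _ in H2 H3 H4.
set b := K o l _ in H1 H4 H5 *.
set s := p.+1%:R in H1 H2 H3 H4 H5; set d := (2 * p.+1 + r)%N.
have -> : (c1 + c2 - c3 - c4) * (p.+1 ^ 2 * d)%:R
  = (c1 * s + c2 * s - c3 * s) * (p.+1 * d)%:R - c4 * (p.+1 * d)%:R * s
  by rewrite /s; move: d => d'; ring.
rewrite H1 H2 H3 H5.
have -> : (b + (c5 - c4) - (c5 - c1)) * (p.+1 * d)%:R
  = b * (p.+1 * d)%:R - c4 * (p.+1 * d)%:R + c1 * s * d%:R by rewrite /s; move: d => d'; ring.
by rewrite H5 H1 /s /d; move: (N.-2) => c; ring.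
Qed.
End SlCore.

(*PART CoreSo*)
Section SoCore.
Variables (F A : comNzRingType) (N : nat) (a b : 'I_N).
Variable chi : 'I_N -> 'I_N -> A.
Variable dd : 'I_N -> 'I_N -> A -> A.
Variable K : 'I_N -> 'I_N -> {additive A -> F}.
Local Notation "i ^!" := (rev_ord i) (at level 1, format "i ^!").
Hypothesis distinct : uniq [:: a; b; a^!; b^!].
Hypothesis twoA : forall f : A, f + f = 0 -> f = 0.
Hypothesis twoF : forall c : F, c + c = 0 -> c = 0.
Hypothesis chi_anti : forall i j, chi i j = - chi j i.
Hypothesis plucker : forall i j k m,
  chi i j * chi k m - chi i k * chi j m + chi i m * chi j k = 0.
Hypothesis isotropic : forall i j, \sum_k chi i k * chi j k^! = 0.
Hypothesis ddD : forall i j f g, dd i j (f + g) = dd i j f + dd i j g.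
Hypothesis ddM : forall i j f g, dd i j (f * g) = dd i j f * g + f * dd i j g.
Hypothesis dd_chi : forall i j u v, i != j -> j != i^! ->
  dd i j (chi u v) =
    (if u == i then chi j v else 0) - (if u == j^! then chi i^! v else 0)
  + ((if v == i then chi u j else 0) - (if v == j^! then chi u i^! else 0)).
Hypothesis K_anti : forall i j f, K i j f = - K j i f.
(* lowering operators *)
Definition lowering i j := [|| (i, j) == (a, b^!) |
  ((i == a) || (i == b)) && (j \notin [:: a; b; a^!; b^!])].
Hypothesis K_dd : forall i j u v f, lowering i j ->
  K u v (dd i j f) = -
   ((if u == i then K j v f else 0) - (if u == j^! then K i^! v f else 0)
  + ((if v == i then K u j f else 0) - (if v == j^! then K u i^! f else 0))).

Notation mid k := (k \notin [:: a; b; a^!; b^!]).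
Local Notation xi := (chi a b).
Local Notation r := (N - 4)%N.

Definition distE : ((a == b) = false) * ((b == a) = false)
  * ((a == a^!) = false) * ((a^! == a) = false)
  * ((a == b^!) = false) * ((b^! == a) = false)
  * ((b == b^!) = false) * ((b^! == b) = false)
  * ((b == a^!) = false) * ((a^! == b) = false)
  * ((a^! == b^!) = false) * ((b^! == a^!) = false).
Proof.
move: distinct; rewrite /= !inE !negb_or !andbT.
case/andP=> /and3P[/negPf e1 /negPf e2 /negPf e3] /andP[/andP[/negPf e4 /negPf e5] /negPf e6].
by rewrite e1 e2 e3 e4 e5 e6 (eq_sym b a) (eq_sym a^! a) (eq_sym b^! a) (eq_sym a^! b)
  (eq_sym b^! b) (eq_sym b^! a^!) e1 e2 e3 e4 e5 e6.
Qed.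

Lemma so_midE k : mid k ->
  ((k == a) = false) * ((a == k) = false) * ((k == b) = false) * ((b == k) = false)
  * ((k == a^!) = false) * ((a^! == k) = false) * ((k == b^!) = false)
  * ((b^! == k) = false)
  * ((k^! == a) = false) * ((a == k^!) = false) * ((k^! == b) = false)
  * ((b == k^!) = false)
  * ((k^! == a^!) = false) * ((a^! == k^!) = false) * ((k^! == b^!) = false)
  * ((b^! == k^!) = false).
Proof.
rewrite !inE !negb_or => /and4P[/negPf e1 /negPf e2 /negPf e3 /negPf e4].
rewrite !(eq_sym a) !(eq_sym b) !(eq_sym a^!) !(eq_sym b^!).
rewrite !(inj_eq rev_ord_inj) !(can2_eq rev_ordK rev_ordK).
by rewrite e1 e2 e3 e4.
Qed.

Lemma mid_rev k : mid k^! = mid k.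
Proof.
rewrite !inE !(can2_eq rev_ordK rev_ordK) !rev_ordK; congr negb.
by rewrite orbA orbC -orbA.
Qed.

Lemma sum_mid_rev (V : nmodType) (f : 'I_N -> V) :
  \sum_(k | mid k) f k^! = \sum_(k | mid k) f k.
Proof.
rewrite [RHS](reindex_inj rev_ord_inj) /=.
by apply: eq_bigl => k; rewrite mid_rev.
Qed.

Lemma so_sum_mid (V : zmodType) (c : V) : \sum_(k | mid k) c = c *+ r.
Proof.
rewrite sumr_const; congr (_ *+ _).
have := cardC (mem [:: a; b; a^!; b^!]); rewrite card_ord (card_uniqP distinct) /=.
by move=> H; rewrite -[X in (X - 4)%N]H addKn; apply: eq_card => k; rewrite !inE.
Qed.

Lemma split_mid (V : zmodType) (f : 'I_N -> V) :
  \sum_k f k = f a + f b + f a^! + f b^! + \sum_(k | mid k) f k.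
Proof.
rewrite (bigID (mem [:: a; b; a^!; b^!])) /=; congr (_ + _).
by rewrite -big_uniq //= !big_cons big_nil addr0 !addrA.
Qed.

Lemma chi_diag i : chi i i = 0.
Proof. by apply: twoA; rewrite {2}chi_anti subrr. Qed.

Lemma sum_mid_chi : \sum_(k | mid k) chi k k^! = 0.
Proof.
apply: twoA; rewrite -{2}sum_mid_rev -big_split big1 //= => k _.
by rewrite rev_ordK chi_anti addNr.
Qed.

Lemma isotropic_mid i j : \sum_(k | mid k) chi i k * chi j k^! =
  - (chi i a * chi j a^! + chi i b * chi j b^!
     + chi i a^! * chi j a + chi i b^! * chi j b).
Proof.
have := isotropic i j; rewrite split_mid !rev_ordK => /eqP.
by rewrite addrC addr_eq0 => /eqP.
Qed.

Lemma plucker_quadric : \sum_(k | mid k) chi a k * chi a^! k^!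
   - chi a a^! * (chi a a^! - chi b b^!) - (chi a b^! * chi b a^!) *+ 2 = 0.
Proof.
rewrite isotropic_mid !chi_diag (chi_anti a^! a) (chi_anti a^! b).
apply/eqP; rewrite -oppr_eq0; apply/eqP; rewrite -[RHS](plucker a b a^! b^!); ring.
Qed.

Lemma so_ddX i j f n : dd i j (f ^+ n) = f ^+ n.-1 * dd i j f *+ n.
Proof. exact: derX (@ddM i j) f n. Qed.

Lemma ddMn i j f n : dd i j (f *+ n) = dd i j f *+ n.
Proof. exact: (derMn (@ddD _ _) (@ddM _ _)). Qed.

Lemma ddN i j f : dd i j (- f) = - dd i j f.
Proof. exact: (derN (@ddD _ _)). Qed.

Lemma so_xi_pred p : xi ^+ p.-1 * xi *+ p = xi ^+ p *+ p.
Proof. by case: p => // p; rewrite exprSr. Qed.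

Section Mid.
Variables (k : 'I_N) (mk : mid k).
Let mE := so_midE mk.

Lemma dd_bk_xi p : dd b k (xi ^+ p.+1) = xi ^+ p * chi a k *+ p.+1.
Proof.
by rewrite so_ddX /= dd_chi ?(mE, distE, rev_ordK, eqxx) //= ?(oppr0, add0r, addr0).
Qed.

Lemma dd_ak_xi p : dd a k (xi ^+ p.+1) = - (xi ^+ p * chi b k *+ p.+1).
Proof.
by rewrite so_ddX /= dd_chi ?(mE, distE, rev_ordK, eqxx) //= ?(oppr0, add0r, addr0) (chi_anti k b) mulrN mulNrn.
Qed.

Lemma dd_bk_bk' p : dd b k (xi ^+ p * chi b k^!) =
  xi ^+ p.-1 * (chi a k * chi b k^!) *+ p + xi ^+ p * (chi k k^! - chi b b^!).
Proof.
rewrite ddM so_ddX !dd_chi ?(mE, distE, rev_ordK, eqxx) //= ?(oppr0, add0r, addr0).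
by move: (xi ^+ p) (xi ^+ p.-1) => w w'; ring.
Qed.

Lemma dd_ak_ak' p : dd a k (xi ^+ p * chi a k^!) =
  - (xi ^+ p.-1 * (chi b k * chi a k^!)) *+ p + xi ^+ p * (chi k k^! - chi a a^!).
Proof.
rewrite ddM so_ddX !dd_chi ?(mE, distE, rev_ordK, eqxx) //= ?(oppr0, add0r, addr0) (chi_anti k b).
by move: (xi ^+ p) (xi ^+ p.-1) => w w'; ring.
Qed.

Lemma dd_bk_ak' p : dd b k (xi ^+ p * chi a k^!) =
  xi ^+ p.-1 * (chi a k * chi a k^!) *+ p - xi ^+ p * chi a b^!.
Proof.
rewrite ddM so_ddX !dd_chi ?(mE, distE, rev_ordK, eqxx) //= ?(oppr0, add0r, addr0).
by move: (xi ^+ p) (xi ^+ p.-1) => w w'; ring.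
Qed.

Lemma dd_ak_bk' p : dd a k (xi ^+ p * chi b k^!) =
  - (xi ^+ p.-1 * (chi b k * chi b k^!)) *+ p - xi ^+ p * chi b a^!.
Proof.
rewrite ddM so_ddX !dd_chi ?(mE, distE, rev_ordK, eqxx) //= ?(oppr0, add0r, addr0) (chi_anti k b).
by move: (xi ^+ p) (xi ^+ p.-1) => w w'; ring.
Qed.

Lemma chi_b'k p : xi ^+ p * chi b^! k *+ p.+2 =
  - (dd b k (xi ^+ p * chi b b^!) + dd a k (xi ^+ p * chi a b^!)).
Proof.
rewrite !ddM !so_ddX !dd_chi ?(mE, distE, rev_ordK, eqxx) //= ?(oppr0, add0r, addr0).
have H := plucker a b b^! k.
have H' : chi a k * chi b b^! = chi a b^! * chi b k - xi * chi b^! k.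
  by apply/eqP; rewrite -subr_eq0 -H; apply/eqP; ring.
have -> : xi ^+ p.-1 * chi a k *+ p * chi b b^! + xi ^+ p * chi k b^! +
   (xi ^+ p.-1 * chi k b *+ p * chi a b^! + xi ^+ p * chi k b^!)
  = xi ^+ p.-1 * (chi a k * chi b b^! + chi k b * chi a b^!) *+ p + xi ^+ p * chi k b^! *+ 2 by ring.
rewrite H' (chi_anti k b) (chi_anti k b^!).
have -> : chi a b^! * chi b k - xi * chi b^! k + - chi b k * chi a b^! = - xi * chi b^! k by ring.
have -> : xi ^+ p.-1 * (- xi * chi b^! k) *+ p = - (xi ^+ p.-1 * xi *+ p) * chi b^! k by ring.
by rewrite so_xi_pred -addn2; ring.
Qed.

Lemma chi_a'k p : xi ^+ p * chi a^! k *+ p.+2 =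
  - (dd a k (xi ^+ p * chi a a^!) + dd b k (xi ^+ p * chi b a^!)).
Proof.
rewrite !ddM !so_ddX !dd_chi ?(mE, distE, rev_ordK, eqxx) //= ?(oppr0, add0r, addr0).
have H := plucker a b a^! k.
have H' : chi b k * chi a a^! = chi a k * chi b a^! + xi * chi a^! k.
  by apply/eqP; rewrite -subr_eq0 -oppr_eq0 -H; apply/eqP; ring.
have -> : xi ^+ p.-1 * chi k b *+ p * chi a a^! + xi ^+ p * chi k a^! +
   (xi ^+ p.-1 * chi a k *+ p * chi b a^! + xi ^+ p * chi k a^!)
  = xi ^+ p.-1 * (chi k b * chi a a^! + chi a k * chi b a^!) *+ p + xi ^+ p * chi k a^! *+ 2 by ring.
rewrite (chi_anti k b) mulNr H' (chi_anti k a^!).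
have -> : xi ^+ p.-1 * (- (chi a k * chi b a^! + xi * chi a^! k) + chi a k * chi b a^!) *+ p = - (xi ^+ p.-1 * xi *+ p) * chi a^! k by ring.
by rewrite so_xi_pred -addn2; ring.
Qed.

Lemma dd_ak'_b'k p : dd a k^! (xi ^+ p * chi b^! k) =
  - (xi ^+ p.-1 * (chi b k^! * chi b^! k)) *+ p + xi ^+ p * chi a^! b^!.
Proof.
rewrite ddM so_ddX !dd_chi ?(mE, distE, rev_ordK, eqxx) //= ?(oppr0, add0r, addr0) (chi_anti k^! b) (chi_anti b^! a^!).
by move: (xi ^+ p) (xi ^+ p.-1) => w w'; ring.
Qed.
End Mid.

Lemma dd_ab'_xi p : dd a b^! (xi ^+ p.+1) = - (xi ^+ p * (chi a a^! + chi b b^!) *+ p.+1).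
Proof.
rewrite so_ddX /= dd_chi ?(distE, rev_ordK, eqxx) //= ?(oppr0, add0r, addr0) (chi_anti b^! b).
by ring.
Qed.

Lemma dd_ab'_bb' p : dd a b^! (xi ^+ p * chi b b^!) =
  - (xi ^+ p.-1 * ((chi a a^! + chi b b^!) * chi b b^!)) *+ p - xi ^+ p * chi a^! b^!.
Proof.
rewrite ddM so_ddX !dd_chi ?(distE, rev_ordK, eqxx) //= ?(oppr0, add0r, addr0) (chi_anti b^! b).
by move: (xi ^+ p) (xi ^+ p.-1) => w w'; ring.
Qed.


Lemma sum_mid_lin (w v : A) (f g : 'I_N -> A) (c : A) p :
  \sum_(k | mid k) (w * f k *+ p + v * (g k - c))
  = w * (\sum_(k | mid k) f k) *+ p + v * (\sum_(k | mid k) g k - c *+ r).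
Proof. by rewrite big_split /= sumrMnl -!mulr_sumr sumrB so_sum_mid. Qed.

Lemma chi_bb' p : xi ^+ p * chi b b^! *+ (p.+1 * (2 * p + r)) =
  - dd a b^! (xi ^+ p.+1) *+ p + \sum_(k | mid k) dd b k (dd a k^! (xi ^+ p.+1)).
Proof.
rewrite dd_ab'_xi (eq_bigr (fun k => - (xi ^+ p.-1 * (chi a k * chi b k^!) *+ p
   + xi ^+ p * (chi k k^! - chi b b^!)) *+ p.+1)); last first.
  by move=> k mk; rewrite dd_ak_xi ?mid_rev // ddN ddMn dd_bk_bk' // mulNrn.
rewrite sumrMnl sumrN sum_mid_lin sum_mid_chi isotropic_mid !chi_diag (chi_anti b a).
have -> : xi ^+ p.-1 * - (0 * chi b a^! + xi * chi b b^! + chi a a^! * - xi + chi a b^! * 0) *+ p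
 = (xi ^+ p.-1 * xi *+ p) * (chi a a^! - chi b b^!) by move: (xi ^+ _) => w; ring.
by rewrite so_xi_pred; move: (xi ^+ p) (N - 4)%N => w c; ring.
Qed.

Lemma chi_aa' p : xi ^+ p * chi a a^! *+ (p.+1 * (2 * p + r)) =
  - dd a b^! (xi ^+ p.+1) *+ p - \sum_(k | mid k) dd a k (dd b k^! (xi ^+ p.+1)).
Proof.
rewrite dd_ab'_xi (eq_bigr (fun k => (- xi ^+ p.-1 * (chi b k * chi a k^!) *+ p
   + xi ^+ p * (chi k k^! - chi a a^!)) *+ p.+1)); last first.
  by move=> k mk; rewrite dd_bk_xi ?mid_rev // ddMn dd_ak_ak' // mulNr.
rewrite sumrMnl sum_mid_lin sum_mid_chi isotropic_mid !chi_diag (chi_anti b a).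
have -> : - xi ^+ p.-1 * - (- xi * chi a a^! + 0 * chi a b^! + chi b a^! * 0 + chi b b^! * xi) *+ p
 = (xi ^+ p.-1 * xi *+ p) * (chi b b^! - chi a a^!) by move: (xi ^+ _) => w; ring.
by rewrite so_xi_pred; move: (xi ^+ p) (N - 4)%N => w c; ring.
Qed.

Lemma chi_ab' p : xi ^+ p * chi a b^! *+ (p.+1 * (2 * p + r)) =
  - \sum_(k | mid k) dd b k (dd b k^! (xi ^+ p.+1)).
Proof.
rewrite (eq_bigr (fun k => (xi ^+ p.-1 * (chi a k * chi a k^!) *+ p
   + xi ^+ p * (0 - chi a b^!)) *+ p.+1)); last first.
  by move=> k mk; rewrite dd_bk_xi ?mid_rev // ddMn dd_bk_ak' // sub0r mulrN.
rewrite sumrMnl sum_mid_lin big1_eq isotropic_mid !chi_diag.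
have -> : xi ^+ p.-1 * - (0 * chi a a^! + xi * chi a b^! + chi a a^! * 0 + chi a b^! * xi) *+ p
 = - (xi ^+ p.-1 * xi *+ p) * (chi a b^! *+ 2) by move: (xi ^+ _) => w; ring.
by rewrite so_xi_pred; move: (xi ^+ p) (N - 4)%N => w c; ring.
Qed.

Lemma chi_ba' p : xi ^+ p * chi b a^! *+ (p.+1 * (2 * p + r)) =
  \sum_(k | mid k) dd a k (dd a k^! (xi ^+ p.+1)).
Proof.
rewrite (eq_bigr (fun k => (xi ^+ p.-1 * (chi b k * chi b k^!) *+ p
   + xi ^+ p * (0 - - chi b a^!)) *+ p.+1)); last first.
  move=> k mk; rewrite dd_ak_xi ?mid_rev // ddN ddMn dd_ak_bk' //.
  by rewrite -mulNrn; congr (_ *+ _); move: (xi ^+ _) (xi ^+ _) => w w'; ring.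
rewrite sumrMnl sum_mid_lin big1_eq isotropic_mid !chi_diag (chi_anti b a).
have -> : xi ^+ p.-1 * - (- xi * chi b a^! + 0 * chi b b^! + chi b a^! * - xi + chi b b^! * 0) *+ p
 = (xi ^+ p.-1 * xi *+ p) * (chi b a^! *+ 2) by move: (xi ^+ _) => w; ring.
by rewrite so_xi_pred; move: (xi ^+ p) (N - 4)%N => w c; ring.
Qed.

Lemma chi_a'b' p : xi ^+ p * chi a^! b^! *+ (2 * p + r + 1) =
  \sum_(k | mid k) dd a k^! (xi ^+ p * chi b^! k) - dd a b^! (xi ^+ p * chi b b^!).
Proof.
rewrite dd_ab'_bb' (eq_bigr (fun k => (- xi ^+ p.-1 * (chi b k^! * chi b^! k) *+ p
   + xi ^+ p * (0 - - chi a^! b^!)))); last first.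
  by move=> k mk; rewrite dd_ak'_b'k // sub0r opprK mulNr.
rewrite sum_mid_lin big1_eq.
have -> : \sum_(k | mid k) chi b k^! * chi b^! k = chi b^! a * chi a^! b
    + chi b^! b * chi b^! b - xi * chi a^! b^!.
  rewrite (eq_bigr (fun k => chi b^! k * chi b k^!)); last by move=> k _; rewrite mulrC.
  rewrite isotropic_mid !chi_diag (chi_anti b a) (chi_anti b a^!) (chi_anti b b^!) (chi_anti b^! a^!).
  ring.
rewrite (chi_anti b^! a) (chi_anti b^! b) (chi_anti a^! b).
have -> : - chi a b^! * - chi b a^! = chi a a^! * chi b b^! - xi * chi a^! b^!.
  by apply/eqP; rewrite -subr_eq0 -(plucker a b a^! b^!); apply/eqP; ring.
have -> : - xi ^+ p.-1 * (chi a a^! * chi b b^! - xi * chi a^! b^! + - chi b b^! * - chi b b^! - xi * chi a^! b^!) *+ p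
  = (xi ^+ p.-1 * xi *+ p) * chi a^! b^! *+ 2 - xi ^+ p.-1 * ((chi a a^! + chi b b^!) * chi b b^!) *+ p
  by move: (xi ^+ _) => w; ring.
by rewrite so_xi_pred; move: (xi ^+ p) (xi ^+ p.-1) (N - 4)%N => w w' c; ring.
Qed.

Notation beta p := (K a^! b^! (xi ^+ p)).
Notation den p := (p.+1 * (2 * p + r))%N.

Let Ksum u v (f : 'I_N -> A) :
  K u v (\sum_(k | mid k) f k) = \sum_(k | mid k) K u v (f k).
Proof. exact: raddf_sum. Qed.

Lemma low_a k : mid k -> lowering a k.
Proof. by move=> mk; rewrite /lowering mk eqxx /= orbT. Qed.
Lemma low_b k : mid k -> lowering b k.
Proof. by move=> mk; rewrite /lowering mk eqxx !orbT. Qed.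
Lemma low_ab' : lowering a b^!.
Proof. by rewrite /lowering (eqxx (a, b^!)). Qed.

Lemma K_bb'_bb' p : K b b^! (xi ^+ p * chi b b^!) * (den p)%:R = - beta p.+1 *+ (p + r).
Proof.
rewrite mulr_natr -raddfMn chi_bb' raddfD raddfMn raddfN /= Ksum.
rewrite (eq_bigr (fun=> - beta p.+1)); last first.
  move=> k mk; have mk' : mid k^! by rewrite mid_rev.
  rewrite K_dd ?low_b // ?(so_midE mk, distE, rev_ordK, eqxx) /= ?(oppr0, add0r, addr0, opprK).
  by rewrite K_dd ?low_a // ?(so_midE mk, distE, rev_ordK, eqxx) /= ?(oppr0, add0r, addr0, opprK).
by rewrite so_sum_mid K_dd ?low_ab' // ?(distE, rev_ordK, eqxx) /= ?(oppr0, add0r, addr0, opprK) mulrnDr.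
Qed.

Lemma K_aa'_bb' p : K a a^! (xi ^+ p * chi b b^!) * (den p)%:R = - beta p.+1 *+ p.
Proof.
rewrite mulr_natr -raddfMn chi_bb' raddfD raddfMn raddfN /= Ksum big1 => [|k mk]; last first.
  by rewrite K_dd ?low_b // ?(so_midE mk, distE, rev_ordK, eqxx) /= ?(oppr0, add0r, addr0, opprK).
by rewrite K_dd ?low_ab' // ?(distE, rev_ordK, eqxx) /= ?(oppr0, add0r, addr0, opprK) (K_anti b^!).
Qed.

Lemma K_ba'_ab' p : K b a^! (xi ^+ p * chi a b^!) * (den p)%:R = - beta p.+1 *+ r.
Proof.
rewrite mulr_natr -raddfMn chi_ab' raddfN /= Ksum.
rewrite (eq_bigr (fun=> beta p.+1)) ?so_sum_mid ?mulNrn //.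
  move=> k mk; have mk' : mid k^! by rewrite mid_rev.
  rewrite K_dd ?low_b // ?(so_midE mk, distE, rev_ordK, eqxx) /= ?(oppr0, add0r, addr0, opprK).
  by rewrite K_dd ?low_b // ?(so_midE mk, distE, rev_ordK, eqxx) /= ?(oppr0, add0r, addr0, opprK) (K_anti b^!) ?opprK.
Qed.

Lemma K_aa'_aa' p : K a a^! (xi ^+ p * chi a a^!) * (den p)%:R = - beta p.+1 *+ (p + r).
Proof.
rewrite mulr_natr -raddfMn chi_aa' raddfB raddfMn raddfN /= Ksum.
rewrite (eq_bigr (fun=> beta p.+1)); last first.
  move=> k mk; have mk' : mid k^! by rewrite mid_rev.
  rewrite K_dd ?low_a // ?(so_midE mk, distE, rev_ordK, eqxx) /= ?(oppr0, add0r, addr0, opprK).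
  by rewrite K_dd ?low_b // ?(so_midE mk, distE, rev_ordK, eqxx) /= ?(oppr0, add0r, addr0, opprK) (K_anti b^!) ?opprK.
by rewrite so_sum_mid K_dd ?low_ab' // ?(distE, rev_ordK, eqxx) /= ?(oppr0, add0r, addr0, opprK) (K_anti b^!) mulrnDr !mulNrn.
Qed.

Lemma K_bb'_aa' p : K b b^! (xi ^+ p * chi a a^!) * (den p)%:R = - beta p.+1 *+ p.
Proof.
rewrite mulr_natr -raddfMn chi_aa' raddfB raddfMn raddfN /= Ksum big1 => [|k mk]; last first.
  by rewrite K_dd ?low_a // ?(so_midE mk, distE, rev_ordK, eqxx) /= ?(oppr0, add0r, addr0, opprK).
by rewrite K_dd ?low_ab' // ?(distE, rev_ordK, eqxx) /= ?(oppr0, add0r, addr0, opprK).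
Qed.

Lemma K_ab'_ba' p : K a b^! (xi ^+ p * chi b a^!) * (den p)%:R = - beta p.+1 *+ r.
Proof.
rewrite mulr_natr -raddfMn chi_ba' Ksum.
rewrite (eq_bigr (fun=> - beta p.+1)) ?so_sum_mid //.
  move=> k mk; have mk' : mid k^! by rewrite mid_rev.
  rewrite K_dd ?low_a // ?(so_midE mk, distE, rev_ordK, eqxx) /= ?(oppr0, add0r, addr0, opprK).
  by rewrite K_dd ?low_a // ?(so_midE mk, distE, rev_ordK, eqxx) /= ?(oppr0, add0r, addr0, opprK).
Qed.


Lemma sum_mid_K f : \sum_(k | mid k) K k^! k f = 0.
Proof.
apply: twoF; rewrite -{2}sum_mid_rev -big_split big1 //= => k _.
by rewrite rev_ordK K_anti addNr.
Qed.

Lemma K_eta_so p :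
  K a b (xi ^+ p * chi a^! b^!) * ((2 * p + r + 1) * (p.+2 * den p))%:R
  = beta p.+1 * (2 * (p ^ 2 + (r + 2) * p + r * (r + 1)))%:R.
Proof.
rewrite natrM mulrA (mulr_natr (K a b _)) -raddfMn chi_a'b' raddfB /= Ksum.
rewrite [X in _ - X]K_dd ?low_ab' // ?(distE, rev_ordK, eqxx) /= ?(oppr0, add0r, addr0, opprK).
rewrite (eq_bigr (fun k => - K k^! b (xi ^+ p * chi b^! k))); last first.
  by move=> k mk; rewrite K_dd ?low_a ?mid_rev // ?(so_midE mk, distE, rev_ordK, eqxx) /= ?(oppr0, add0r, addr0, opprK).
have H : (\sum_(k | mid k) - K k^! b (xi ^+ p * chi b^! k)) * p.+2%:R
    = - \sum_(k | mid k) (K b b^! (xi ^+ p * chi b b^!) + K b a^! (xi ^+ p * chi a b^!)).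
  have -> : \sum_(k | mid k) (K b b^! (xi ^+ p * chi b b^!) + K b a^! (xi ^+ p * chi a b^!))
    = \sum_(k | mid k) (K k^! k (xi ^+ p * chi b b^!) +
        (K b b^! (xi ^+ p * chi b b^!) + K b a^! (xi ^+ p * chi a b^!))).
    by rewrite [RHS]big_split /= sum_mid_K add0r.
  rewrite sumrN mulNr mulr_suml; congr (- _); apply: eq_bigr => k mk.
  rewrite mulr_natr -raddfMn chi_b'k // raddfN raddfD /=.
  rewrite !K_dd ?low_a ?low_b // ?(so_midE mk, distE, rev_ordK, eqxx) /= ?(oppr0, add0r, addr0, opprK).
  by rewrite (K_anti b^! b) (K_anti a^! b); ring.
rewrite so_sum_mid in H.
have H1 := K_bb'_bb' p; have H2 := K_ba'_ab' p; have H3 := K_aa'_bb' p.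
rewrite (K_anti b^! b).
set c1 := K b b^! _ in H H1 *; set c2 := K b a^! _ in H H2; set c3 := K a a^! _ in H3 *.
set S := \sum_(k | _) _ in H *; set d := den p in H1 H2 H3 *; set b1 := beta p.+1 in H1 H2 H3 *.
have -> : (S + (- c1 - c3)) * (p.+2 * d)%:R = S * p.+2%:R * d%:R - (c1 * d%:R + c3 * d%:R) * p.+2%:R by ring.
rewrite H.
have -> : - ((c1 + c2) *+ r) * d%:R = - (c1 * d%:R + c2 * d%:R) *+ r by ring.
rewrite H1 H2 H3; move: (N - 4)%N => c; ring.
Qed.

Lemma K_quadric p :
  (\sum_(l | mid l) (K a l (xi ^+ p * chi a^! l^!) + K a^! l^! (xi ^+ p * chi a l))
   - (K a a^! (xi ^+ p * (chi a a^! - chi b b^!)) + K a a^! (xi ^+ p * chi a a^!)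
      - K b b^! (xi ^+ p * chi a a^!))
   - (K a b^! (xi ^+ p * chi b a^!) + K b a^! (xi ^+ p * chi a b^!)) *+ 2)
  * (p.+2 * den p)%:R = beta p.+1 * (r * (2 * p + r + 3) * (p + 4))%:R.
Proof.
have H : (\sum_(l | mid l) (K a l (xi ^+ p * chi a^! l^!))) * p.+2%:R
   = - (K a a^! (xi ^+ p * chi a a^!) + K a b^! (xi ^+ p * chi b a^!)) *+ r.
  have -> : - (K a a^! (xi ^+ p * chi a a^!) + K a b^! (xi ^+ p * chi b a^!)) *+ r
    = \sum_(k | mid k) (K k^! k (xi ^+ p * chi a a^!)
        - (K a a^! (xi ^+ p * chi a a^!) + K a b^! (xi ^+ p * chi b a^!))).
    by rewrite big_split /= sum_mid_K so_sum_mid add0r.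
  rewrite mulr_suml; apply: eq_bigr => k mk; have mk' : mid k^! by rewrite mid_rev.
  rewrite mulr_natr -raddfMn chi_a'k // raddfN raddfD /=.
  rewrite !K_dd ?low_a ?low_b // ?(so_midE mk, distE, rev_ordK, eqxx) /= ?(oppr0, add0r, addr0, opprK).
  by ring.
have H0 : (\sum_(l | mid l) (K a^! l^! (xi ^+ p * chi a l))) * p.+1%:R = beta p.+1 *+ r.
  rewrite mulr_suml -so_sum_mid; apply: eq_bigr => k mk.
  rewrite mulr_natr -raddfMn -dd_bk_xi //.
  by rewrite !K_dd ?low_a ?low_b // ?(so_midE mk, distE, rev_ordK, eqxx) /= ?(oppr0, add0r, addr0, opprK).
have H1 := K_aa'_aa' p; have H2 := K_ab'_ba' p; have H3 := K_bb'_aa' p.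
have H4 := K_aa'_bb' p; have H5 := K_ba'_ab' p.
have -> : K a a^! (xi ^+ p * (chi a a^! - chi b b^!))
  = K a a^! (xi ^+ p * chi a a^!) - K a a^! (xi ^+ p * chi b b^!).
  by rewrite mulrBr raddfB.
rewrite big_split /=.
set c1 := K a a^! (xi ^+ p * chi a a^!) in H H1 *; set c2 := K a b^! _ in H H2 *.
set c3 := K b b^! _ in H3 *; set c4 := K a a^! _ in H4 *; set c5 := K b a^! _ in H5 *.
set S := \sum_(k | _) _ in H *; set S' := \sum_(k | _) _ in H0 *; set d := den p in H1 H2 H3 H4 H5 *; set b1 := beta p.+1 in H0 H1 H2 H3 H4 H5 *.
have -> : (S + S' - (c1 - c4 + c1 - c3) - (c2 + c5) *+ 2) * (p.+2 * d)%:R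
  = S * p.+2%:R * d%:R + S' * p.+1%:R * (p.+2 * (2 * p + r))%:R
   - (c1 * d%:R - c4 * d%:R + c1 * d%:R - c3 * d%:R) * p.+2%:R
   - (c2 * d%:R + c5 * d%:R) *+ 2 * p.+2%:R by rewrite /d; move: (N - 4)%N => c; ring.
rewrite H H0.
have -> : - (c1 + c2) *+ r * d%:R = - (c1 * d%:R + c2 * d%:R) *+ r by ring.
rewrite H1 H2 H3 H4 H5; move: (N - 4)%N => c; ring.
Qed.
End SoCore.

(*PART Lie*)
Section MatrixUnits.
Variables (F : comNzRingType) (N : nat).
Implicit Types A B : 'M[F]_N.

Lemma mul_delta_entry A B (i j u v : 'I_N) :
  (A *m delta_mx i j *m B) u v = A u i * B j v.
Proof.
rewrite mxE (bigD1 j) //= big1 => [|k kj]; last first.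
  rewrite mxE big1 ?mul0r // => l _.
  by rewrite mxE (negPf kj) andbF mulr0.
rewrite addr0 mxE (bigD1 i) //= big1 => [|k ki]; last first.
  by rewrite mxE (negPf ki) mulr0.
by rewrite addr0 mxE !eqxx mulr1.
Qed.

Lemma mulmx_delta A (i j u v : 'I_N) :
  (A *m delta_mx i j) u v = if v == j then A u i else 0.
Proof.
rewrite -[A *m _]mulmx1 mul_delta_entry mxE eq_sym.
by case: eqP; rewrite ?mulr1 ?mulr0.
Qed.

Lemma delta_mulmx A (i j u v : 'I_N) :
  (delta_mx i j *m A) u v = if u == i then A j v else 0.
Proof.
rewrite -[delta_mx i j]mul1mx mul_delta_entry mxE.
by case: eqP; rewrite ?mul1r ?mul0r.
Qed.

Lemma mxtrace_delta_mulmx A (i j : 'I_N) : \tr (delta_mx i j *m A) = A j i.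
Proof.
rewrite /mxtrace (bigD1 i) //= big1 => [|k ki]; rewrite delta_mulmx ?eqxx ?addr0 //.
by rewrite (negPf ki).
Qed.

Definition antitr A : 'M[F]_N := \matrix_(i, j) A (rev_ord j) (rev_ord i).

Lemma antitrK : involutive antitr.
Proof. by move=> A; apply/matrixP => i j; rewrite !mxE !rev_ordK. Qed.

Lemma antitr_linear : linear antitr.
Proof. by move=> c A B; apply/matrixP => i j; rewrite !mxE. Qed.
HB.instance Definition _ := GRing.isLinear.Build _ _ _ _ antitr antitr_linear.

Lemma antitrM A B : antitr (A *m B) = antitr B *m antitr A.
Proof.
apply/matrixP => i j; rewrite !mxE (reindex_inj rev_ord_inj) /=.
by apply: eq_bigr => k _; rewrite !mxE mulrC.
Qed.

Lemma antitr1 : antitr 1%:M = 1%:M.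
Proof. by apply/matrixP => i j; rewrite !mxE (inj_eq rev_ord_inj) eq_sym. Qed.

Lemma antitr_delta i j : antitr (delta_mx i j) = delta_mx (rev_ord j) (rev_ord i).
Proof.
by apply/matrixP => u v; rewrite !mxE !(can2_eq rev_ordK rev_ordK) andbC.
Qed.

Lemma mxtrace_antitr A : \tr (antitr A) = \tr A.
Proof.
rewrite /mxtrace [RHS](reindex_inj rev_ord_inj) /=.
by apply: eq_bigr => i _; rewrite mxE.
Qed.

Lemma trace_sandwich A B :
  \sum_i \sum_j (A *m delta_mx i j *m B) i j = \tr A * \tr B.
Proof.
rewrite /mxtrace mulr_suml; apply: eq_bigr => i _; rewrite mulr_sumr.
by apply: eq_bigr => j _; rewrite mul_delta_entry.
Qed.

Lemma trace_antisandwich A B :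
  \sum_i \sum_j (A *m antitr (delta_mx i j) *m B) i j = \tr (A *m antitr B).
Proof.
rewrite /mxtrace; apply: eq_bigr => i _; rewrite mxE [LHS](reindex_inj rev_ord_inj) /=.
by apply: eq_bigr => j _; rewrite antitr_delta mul_delta_entry rev_ordK mxE.
Qed.
End MatrixUnits.

Section TraceOnSubspace.
Variables (F : fieldType) (N : nat) (U : {vspace 'M[F]_N}).
Variables f pr : {linear 'M[F]_N -> 'M[F]_N}.

Lemma trace_subspace :
  (forall x, x \in U -> f x \in U) -> (forall x, pr x \in U) ->
  (forall x, x \in U -> pr x = x) ->
  \sum_(i < \dim U) coord (vbasis U) i (f (vbasis U)`_i)
  = \sum_i \sum_j (f (pr (delta_mx i j))) i j.
Proof.
move=> fU prU prK; have b_in (i : 'I_(\dim U)) : (vbasis U)`_(nat_of_ord i) \in U.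
  by apply: vbasis_mem; rewrite mem_nth ?size_tuple ?ltn_ord.
transitivity (\sum_i \sum_j \sum_(k < \dim U)
   coord (vbasis U) k (pr (delta_mx i j)) * (f (vbasis U)`_k) i j); last first.
  apply: eq_bigr => i _; apply: eq_bigr => j _.
  rewrite {2}(coord_vbasis (prU (delta_mx i j))) linear_sum summxE.
  by apply: eq_bigr => k _; rewrite linearZ mxE.
rewrite [RHS](eq_bigr (fun i => \sum_(k < \dim U) \sum_j
  coord (vbasis U) k (pr (delta_mx i j)) * (f (vbasis U)`_k) i j)); last first.
  by move=> i _; rewrite exchange_big.
rewrite exchange_big /=; apply: eq_bigr => k _.
have := matrix_sum_delta (f (vbasis U)`_k).
move/(congr1 (fun z => coord (vbasis U) k (pr z))); rewrite prK; last by apply: fU.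
move=> ->; rewrite !linear_sum; apply: eq_bigr => i _.
rewrite !linear_sum; apply: eq_bigr => j _.
by rewrite !linearZ mulrC.
Qed.
End TraceOnSubspace.

Section Lie.
Variables (R : realType) (L : simple_algebra).
Local Notation C := (complex R).
Local Notation N := (matrix_size L).
Local Notation M := 'M[C]_N.
Local Notation lieg := (lieg R L).
Implicit Types x y z Z : M.

Lemma antidiag_mul A : antidiag R L *m A^T *m antidiag R L = antitr A.
Proof.
apply/matrixP => u v; rewrite mxE (bigD1 (rev_ord v)) //= big1 => [|k kj]; last first.
  by rewrite [antidiag _ _ _ _]mxE eq_sym (can2_eq rev_ordK rev_ordK) (negPf kj) mulr0.
rewrite [antidiag _ _ _ _]mxE rev_ordK eqxx mulr1 addr0 mxE (bigD1 (rev_ord u)) //= big1 => [|k kj]; last first.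
  by rewrite mxE (negPf kj) mul0r.
by rewrite !mxE eqxx mul1r addr0.
Qed.

Lemma antidiagK : antidiag R L *m antidiag R L = 1%:M.
Proof. by have := antidiag_mul 1%:M; rewrite trmx1 mulmx1 antitr1. Qed.

Lemma in_lieg x :
  (x \in lieg) = if is_sl L then \tr x == 0 else antitr x == - x.
Proof.
rewrite memv_lieg; case: (is_sl L) => //.
rewrite /so_defect addr_eq0; apply/eqP/eqP => H.
  by rewrite -antidiag_mul -mulmxA H mulmxN mulmxA antidiagK mul1mx.
have := congr1 (fun z => antidiag R L *m z) H.
by rewrite -antidiag_mul !mulmxA antidiagK mul1mx mulmxN => ->.
Qed.

Lemma bracket_linear x : linear (bracket x).
Proof.
by move=> c y z; rewrite /bracket mulmxDr mulmxDl -scalemxAr -scalemxAl scalerBr opprD addrACA.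
Qed.
HB.instance Definition _ x := GRing.isLinear.Build _ _ _ _ (bracket x) (bracket_linear x).

Lemma bracket_linearl y : linear (fun x => bracket x y).
Proof.
by move=> c x z; rewrite /bracket mulmxDr mulmxDl -scalemxAr -scalemxAl scalerBr opprD addrACA.
Qed.

Lemma bracketDr x y z : bracket x (y + z) = bracket x y + bracket x z.
Proof. exact: raddfD. Qed.
Lemma bracketBr x y z : bracket x (y - z) = bracket x y - bracket x z.
Proof. exact: raddfB. Qed.
Lemma bracketZr c x y : bracket x (c *: y) = c *: bracket x y.
Proof. exact: linearZ. Qed.

Lemma bracket_scalar x c : bracket x c%:M = 0.
Proof. by rewrite /bracket (scalar_mxC _ x) subrr. Qed.

Lemma bracketC x y : bracket x y = - bracket y x.
Proof. by rewrite /bracket opprB. Qed.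

Lemma jacobi x y z :
  bracket x (bracket y z) = bracket (bracket x y) z + bracket y (bracket x z).
Proof.
rewrite /bracket !(mulmxBl, mulmxBr) !mulmxA !opprB.
move: (x *m y *m z) (y *m z *m x) (x *m z *m y) (z *m y *m x) (y *m x *m z) (z *m x *m y).
by move=> a b c d e g; apply/matrixP => i j; rewrite !mxE; ring.
Qed.

Lemma mxtrace_bracket x y : \tr (bracket x y) = 0.
Proof. by rewrite linearB /= mxtrace_mulC subrr. Qed.

Lemma trace_bracket_invariant x y z : \tr (bracket x y *m z) = \tr (y *m bracket z x).
Proof.
rewrite /bracket mulmxBl mulmxBr !linearB /= !mulmxA -(mulmxA x) mxtrace_mulC.
by congr (_ - _); rewrite -mulmxA mxtrace_mulC -mulmxA [RHS]mxtrace_mulC.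
Qed.

Lemma bracket_lieg x y : x \in lieg -> y \in lieg -> bracket x y \in lieg.
Proof.
rewrite !in_lieg; case: (is_sl L) => [_ _|/eqP hx /eqP hy].
  by rewrite mxtrace_bracket.
by rewrite linearB /= !antitrM hx hy !mulNmx !mulmxN !opprK opprB.
Qed.

Lemma size_gt2 : (2 < N)%N.
Proof. by case: L => n hn //=; apply: leq_trans hn. Qed.

Lemma size_neq0 : N%:R != 0 :> C.
Proof. by rewrite pnatr_eq0 -lt0n; apply: ltn_trans size_gt2. Qed.

Lemma half_double (V : lmodType C) (v : V) : (2^-1 : C) *: (v + v) = v.
Proof. have -> : v + v = (2 : C) *: v by rewrite scaler_nat mulr2n.
by rewrite scalerA mulVf ?pnatr_eq0 // scale1r. Qed.

Definition lproj x : M :=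
  if is_sl L then x - (\tr x / N%:R)%:M else 2^-1 *: (x - antitr x).

Lemma lproj_linear : linear lproj.
Proof.
move=> c x y; rewrite /lproj; case: (is_sl L).
  rewrite linearP /= mulrDl -mulrA scalerBr scale_scalar_mx raddfD /=.
  by rewrite opprD addrACA.
by rewrite linearP /= opprD scalerA [c * _]mulrC -scalerA -scalerDr scalerBr addrACA.
Qed.
HB.instance Definition _ := GRing.isLinear.Build _ _ _ _ lproj lproj_linear.

Lemma lproj_in x : lproj x \in lieg.
Proof.
rewrite in_lieg /lproj; case: (is_sl L).
  by rewrite linearB /= mxtrace_scalar -[_ *+ N]mulr_natr divfK ?size_neq0 // subrr.
by rewrite linearZ linearB /= antitrK -scalerN opprB.
Qed.

Lemma lproj_id x : x \in lieg -> lproj x = x.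
Proof.
rewrite in_lieg /lproj; case: (is_sl L) => /eqP ->.
  by rewrite mul0r raddf0 subr0.
by rewrite opprK half_double.
Qed.

Lemma lproj_bracket Z x : Z \in lieg -> lproj (bracket Z x) = bracket Z (lproj x).
Proof.
rewrite in_lieg /lproj; case: (is_sl L) => /eqP HZ.
  rewrite mxtrace_bracket mul0r raddf0 subr0 linearB /=.
  by rewrite /bracket (scalar_mxC _ Z) subrr subr0.
have -> : antitr (bracket Z x) = bracket Z (antitr x).
  by rewrite /bracket linearB /= !antitrM HZ mulNmx mulmxN opprK addrC.
by rewrite bracketZr bracketBr.
Qed.

Lemma trace_lproj x z : z \in lieg -> \tr (lproj x *m z) = \tr (x *m z).
Proof.
rewrite in_lieg /lproj; case: (is_sl L) => /eqP Hz.
  by rewrite mulmxBl linearB /= mul_scalar_mx linearZ /= Hz mulr0 subr0.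
rewrite -scalemxAl linearZ /= mulmxBl linearB /=.
have -> : \tr (antitr x *m z) = - \tr (x *m z).
  by rewrite -mxtrace_antitr antitrM antitrK Hz mulNmx linearN /= mxtrace_mulC.
by move: (\tr (x *m z)) => t; field.
Qed.

Definition kill_const : C := if is_sl L then (2 * N)%:R else (N - 2)%:R.

Lemma kill_const_neq0 : kill_const != 0.
Proof.
rewrite /kill_const; have := size_gt2; case: (is_sl L) => H; rewrite pnatr_eq0 -lt0n.
  by rewrite muln_gt0; apply: ltn_trans H.
by rewrite subn_gt0.
Qed.

Lemma killingE x y : x \in lieg -> y \in lieg ->
  killing x y = kill_const * \tr (x *m y).
Proof.
move=> hx hy.
pose f0 : {linear M -> M} := bracket x \o bracket y.
pose f z := bracket x (bracket y z).
rewrite /killing; transitivity (\sum_i \sum_j (f (lproj (delta_mx i j))) i j).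
  apply: (@trace_subspace _ _ _ f0 lproj) => [z hz|z|z].
  - by rewrite /= !bracket_lieg.
  - exact: lproj_in.
  - exact: lproj_id.
have fE z : f z = x *m y *m z *m 1%:M - x *m z *m y - y *m z *m x + 1%:M *m z *m (y *m x).
  by rewrite /f /= /bracket mulmxBl mulmxBr !mulmxA mulmx1 mul1mx opprD opprK addrA.
have T1 : \sum_i \sum_j (f (delta_mx i j)) i j
   = \tr (x *m y) * N%:R - \tr x * \tr y - \tr y * \tr x + N%:R * \tr (y *m x).
  rewrite -mxtrace1 -!trace_sandwich -!sumrB -big_split /=; apply: eq_bigr => i _.
  rewrite -!sumrB -big_split /=; apply: eq_bigr => j _.
  by rewrite fE mxE [X in X + _]mxE [X in X + _ + _]mxE !mxE.
have T2 : \sum_i \sum_j (f (antitr (delta_mx i j))) i j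
   = \tr (x *m y *m antitr 1%:M) - \tr (x *m antitr y) - \tr (y *m antitr x) + \tr (1%:M *m antitr (y *m x)).
  rewrite -!trace_antisandwich -!sumrB -big_split /=; apply: eq_bigr => i _.
  rewrite -!sumrB -big_split /=; apply: eq_bigr => j _.
  by rewrite fE !mxE.
move: hx hy; rewrite !in_lieg /lproj /kill_const; case: (is_sl L) => /eqP hx /eqP hy.
  transitivity (\sum_i \sum_j (f (delta_mx i j)) i j).
    apply: eq_bigr => i _; apply: eq_bigr => j _.
    by rewrite /f (bracketBr y) bracket_scalar subr0.
  by rewrite T1 hx hy mxtrace_mulC; ring.
transitivity (2^-1 * (\sum_i \sum_j (f (delta_mx i j)) i j
    - \sum_i \sum_j (f (antitr (delta_mx i j))) i j)).
  rewrite -sumrB mulr_sumr; apply: eq_bigr => i _.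
  rewrite -sumrB mulr_sumr; apply: eq_bigr => j _.
  rewrite /f (bracketZr _ y) (bracketBr y) (bracketZr _ x) (bracketBr x).
  by rewrite mxE; congr (_ * _); rewrite mxE; congr (_ + _); rewrite mxE.
have tr0 z : antitr z = - z -> \tr z = 0.
  move=> hz; apply/eqP; have : \tr z = - \tr z by rewrite -{1}mxtrace_antitr hz linearN.
  by move/eqP; rewrite -addr_eq0 -mulr2n -mulr_natr mulf_eq0 pnatr_eq0 orbF.
have S1 : \tr (x *m antitr y) = - \tr (x *m y) by rewrite hy mulmxN raddfN.
have S2 : \tr (y *m antitr x) = - \tr (x *m y).
  by rewrite hx mulmxN raddfN /= mxtrace_mulC.
have S3 : \tr (1%:M *m antitr (y *m x)) = \tr (x *m y).
  by rewrite mul1mx mxtrace_antitr mxtrace_mulC.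
have S4 : \tr (x *m y *m antitr 1%:M) = \tr (x *m y) by rewrite antitr1 mulmx1.
have congr_half (u v u' v' : C) : u = u' -> v = v' -> 2^-1 * (u - v) = 2^-1 * (u' - v') by move=> -> ->.
rewrite (congr_half _ _ _ _ T1 T2).
rewrite S1 S2 S3 S4 (tr0 x hx) (tr0 y hy) (mxtrace_mulC y x).
rewrite natrB; last exact: ltnW size_gt2.
by move: (\tr (x *m y)) (N%:R : C) => t c; field.
Qed.

End Lie.

(*PART Lie2*)
Lemma mxBE (F : zmodType) m n (A B : 'M[F]_(m, n)) u v : (A - B) u v = A u v - B u v.
Proof. by rewrite !mxE. Qed.

Section Lie2.
Variables (R : realType) (L : simple_algebra).
Local Notation C := (complex R).
Local Notation N := (matrix_size L).
Local Notation M := 'M[C]_N.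
Local Notation lieg := (lieg R L).
Implicit Types x y z Z : M.

Lemma size_gt0 : (0 < N)%N. Proof. exact: leq_ltn_trans (size_gt2 L). Qed.
Lemma size_gt1 : (1 < N)%N. Proof. exact: ltn_trans (size_gt2 L). Qed.
Definition idx0 : 'I_N := Ordinal size_gt0.
Definition idx1 : 'I_N := Ordinal size_gt1.
Definition idx2 : 'I_N := Ordinal (size_gt2 L).

Lemma so_size : is_sl L = false -> (5 < N)%N.
Proof. by case: L. Qed.

Local Notation i0 := idx0.
Local Notation i1 := idx1.
Local Notation i2 := idx2.
Definition Xtheta : M :=
  if is_sl L then delta_mx i0 (rev_ord i0)
  else delta_mx i0 (rev_ord i1) - delta_mx i1 (rev_ord i0).
Definition Ytheta : M := Xtheta^T.

Lemma so_entry x : is_sl L = false -> x \in lieg ->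
  forall u v, x u v = - x (rev_ord v) (rev_ord u).
Proof.
move=> slL; rewrite in_lieg slL => /eqP/matrixP H u v.
by have := H (rev_ord v) (rev_ord u); rewrite !mxE !rev_ordK => ->; rewrite ?opprK.
Qed.

(* raising root vectors *)
Definition raising (i j : 'I_N) :=
  (i < j)%N && (is_sl L || ((i != rev_ord i) && (j != rev_ord i))).

Lemma bracket_lproj_delta i j x : x \in lieg -> raising i j ->
  bracket (lproj (delta_mx i j)) x = 0 -> forall u v,
  (if u == i then x j v else 0) - (if v == j then x u i else 0)
  = if is_sl L then 0 else (if u == rev_ord j then x (rev_ord i) v else 0)
     - (if v == rev_ord i then x u (rev_ord j) else 0).
Proof.
move=> xg /andP[ij _] + u v; rewrite /lproj; case slL : (is_sl L).
  have -> : \tr (delta_mx i j : M) = 0.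
    have := mxtrace_delta_mulmx (1%:M : M) i j; rewrite mulmx1 mxE => ->.
    by rewrite -val_eqE /= gtn_eqF.
  rewrite mul0r raddf0 subr0 /bracket => /matrixP /(_ u v).
  by rewrite mxBE delta_mulmx mulmx_delta mxE => ->.
rewrite /bracket -scalemxAl -scalemxAr -scalerBr antitr_delta => /eqP.
rewrite scaler_eq0 invr_eq0 pnatr_eq0 /= mulmxBl mulmxBr => /eqP/matrixP /(_ u v).
rewrite !mxBE !delta_mulmx !mulmx_delta mxE => /eqP H.
by apply/eqP; rewrite -subr_eq0; apply/eqP; rewrite -[RHS](eqP H) !opprD !opprK !addrA; congr (_ + _); exact: addrAC.
Qed.

Definition killed x := forall i j, raising i j -> bracket (lproj (delta_mx i j)) x = 0.

Lemma killed_Xtheta x : x \in lieg -> killed x -> exists c, x = c *: Xtheta.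
Proof.
move=> xg kx; have kE i j (ij : raising i j) := bracket_lproj_delta xg ij (kx i j ij).
have N2 := size_gt2 L.
rewrite /Xtheta; case slL : (is_sl L) kE => kE.
  have raiseE (i j : 'I_N) : (i < j)%N -> raising i j by rewrite /raising slL => ->.
  exists (x i0 (rev_ord i0)).
  have row (u v : 'I_N) : (0 < u)%N -> u != v -> x u v = 0.
    move=> u0 uv; have := kE i0 u (raiseE i0 u u0) i0 v.
    by rewrite eqxx eq_sym (negPf uv) subr0.
  have diag (u : 'I_N) : x u u = x i0 i0.
    case: (posnP u) => [u0|u0]; first by congr (x _ _); apply: val_inj.
    have := kE i0 u (raiseE i0 u u0) i0 u.
    by rewrite !eqxx => /eqP; rewrite subr_eq0 => /eqP.
  have x00 : x i0 i0 = 0.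
    move: xg; rewrite in_lieg slL /mxtrace (eq_bigr (fun=> x i0 i0)) ?sumr_const ?card_ord //.
    by rewrite -mulr_natr mulf_eq0 (negPf (size_neq0 R L)) orbF => /eqP.
  have col (u v : 'I_N) : (u < N.-1)%N -> u != v -> x v u = 0.
    move=> uN uv.
    have lt : (u < rev_ord i0)%N by rewrite /= subn1.
    have := kE u (rev_ord i0) (raiseE _ _ lt) v (rev_ord i0).
    by rewrite eqxx (eq_sym v) (negPf uv) sub0r => /eqP; rewrite oppr_eq0 => /eqP.
  apply/matrixP => u v; rewrite !mxE.
  case: (eqVneq u i0) => [->|u0] /=; last first.
    rewrite mulr0; case: (eqVneq u v) => [<-|uv]; first by rewrite diag x00.
    by apply: row => //; rewrite lt0n.
  case: (eqVneq v (rev_ord i0)) => [->|v0]; rewrite ?mulr1 // mulr0.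
  case: (eqVneq i0 v) => [<-|v1] //.
  apply: col; last by rewrite eq_sym.
  by move: v0 (ltn_ord v); rewrite -val_eqE /=; lia.
have N5 := so_size slL; have anti := so_entry slL xg.
have two0 (c : C) : c = - c -> c = 0.
  by move/eqP; rewrite -addr_eq0 -mulr2n mulrn_eq0 /= => /eqP.
exists (x i0 (rev_ord i1)).
have raiseE (i j : 'I_N) : (i < j)%N -> (i.*2 != N.-1)%N -> (i + j != N.-1)%N -> raising i j.
  by rewrite /raising slL -!val_eqE /= => -> /=; have := ltn_ord i; have := ltn_ord j; lia.
have A (j v : 'I_N) : (0 < j)%N -> (j < N.-1)%N -> (v < N.-1)%N ->
   x j v = if v == j then x i0 i0 else 0.
  move=> j0 jN vN; have := kE i0 j (raiseE i0 j _ _ _) i0 v.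
  rewrite eqxx -[i0 == rev_ord j]val_eqE -[v == rev_ord i0]val_eqE /=.
  have -> : (0 == N - j.+1)%N = false by lia.
  have -> : (nat_of_ord v == N - 1)%N = false by lia.
  by rewrite subr0 => H; apply/eqP; rewrite -subr_eq0; apply/eqP; apply: H => //; lia.
have x00 : x i0 i0 = 0.
  have e2 : x i2 i2 = x i0 i0 by rewrite A ?eqxx //=; lia.
  have e2' : x (rev_ord i2) (rev_ord i2) = x i0 i0 by rewrite A ?eqxx //=; lia.
  by apply: two0; rewrite -{1}e2 (anti i2 i2) e2'.
have A0 (j v : 'I_N) : (0 < j)%N -> (j < N.-1)%N -> (v < N.-1)%N -> x j v = 0.
  by move=> *; rewrite A // x00 if_same.
have row0 (v : 'I_N) : (v != rev_ord i1) -> x i0 v = 0.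
  rewrite -val_eqE /= => v1; have vN := ltn_ord v.
  case: (posnP v) => [v0|v0]; first by rewrite -[RHS]x00; congr (x _ _); apply: val_inj.
  case: (eqVneq (nat_of_ord v) N.-1) => vN1.
    by apply: two0; rewrite [LHS]anti; congr (- x _ _); apply: val_inj; rewrite /=; lia.
  case: (eqVneq (nat_of_ord v) 1%N) => v1'.
    have := kE i2 (rev_ord i1) (raiseE _ _ _ _ _) i0 (rev_ord i2).
    rewrite eqxx rev_ordK -!val_eqE /=.
    have -> : (N - 3 == N - 2)%N = false by lia.
    have -> : i1 = v by apply: val_inj.
    by rewrite !subr0 sub0r => H; apply/eqP; rewrite -oppr_eq0 -H //; lia.
  have := kE i1 (rev_ord v) (raiseE _ _ _ _ _) i0 (rev_ord i1).
  rewrite eqxx rev_ordK -!val_eqE /=.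
  have -> : (N - 2 == N - v.+1)%N = false by lia.
  have -> : (0 == v)%N = false by lia.
  by rewrite !subr0 sub0r => H; apply/eqP; rewrite -oppr_eq0 -H //=; lia.
have all0 (u v : 'I_N) : (u, v) != (i0, rev_ord i1) -> (u, v) != (i1, rev_ord i0) -> x u v = 0.
  rewrite !xpair_eqE => h1 h2.
  case: (eqVneq u i0) h1 => [->|u0] /= h1; first exact: row0.
  case: (eqVneq v (rev_ord i0)) h2 => [->|v0] h2.
    rewrite (anti u) rev_ordK row0 ?oppr0 // (inj_eq rev_ord_inj).
    by move: h2; rewrite andbT.
  have v0' : (v < N.-1)%N by move: v0 (ltn_ord v); rewrite -val_eqE /=; lia.
  have u0' : (0 < u)%N by rewrite lt0n.
  case: (ltnP u N.-1) => uN; first exact: A0.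
  have uE : rev_ord u = i0 by apply: val_inj => /=; have := ltn_ord u; lia.
  rewrite (anti u v) uE; case: (posnP v) => [v1|v1].
    rewrite -uE -(anti u v); apply: two0; rewrite [LHS]anti; congr (- x _ _); apply: val_inj => /=; rewrite ?uE; have := ltn_ord u; lia.
  by rewrite A0 ?oppr0 //=; have := ltn_ord v; lia.
apply/matrixP => u v; rewrite !mxE.
case: (eqVneq (u, v) (i0, rev_ord i1)) => [[-> ->]|n1].
  by rewrite !eqxx -[i0 == i1]val_eqE /= subr0 mulr1.
case: (eqVneq (u, v) (i1, rev_ord i0)) => [[-> ->]|n2].
  by rewrite !eqxx -[i1 == i0]val_eqE /= sub0r mulrN1 (anti i1) !rev_ordK.
rewrite all0 //; move: n1 n2; rewrite !xpair_eqE => /negPf -> /negPf ->.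
by rewrite subr0 mulr0.
Qed.
End Lie2.

(*PART Lie3*)
Section Lie3.
Variables (R : realType) (L : simple_algebra).
Local Notation C := (complex R).
Local Notation N := (matrix_size L).
Local Notation M := 'M[C]_N.
Local Notation lieg := (lieg R L).
Local Notation Xtheta := (Xtheta R L).
Implicit Types x y z Z : M.

Lemma lproj_delta_sl (i j : 'I_N) : is_sl L -> i != j ->
  lproj (delta_mx i j) = delta_mx i j :> M.
Proof.
move=> slL ij; rewrite lproj_id // in_lieg slL.
by have := mxtrace_delta_mulmx (1%:M : M) i j; rewrite mulmx1 mxE eq_sym (negPf ij) => ->.
Qed.

Lemma raising_weight i j : raising i j -> exists t (c : C),
  [/\ t \in lieg, is_trig_mx t^T, c != 0 &
      bracket t (lproj (delta_mx i j)) = c *: lproj (delta_mx i j)].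
Proof.
have dd0 (k u v : 'I_N) : (u == v :> nat) = false -> (delta_mx k k : M) u v = 0.
  move=> uv; rewrite mxE; case: (eqVneq u k) => [<-|//].
  by rewrite -[v == u]val_eqE /= eq_sym uv.
case/andP=> ij; case slL: (is_sl L) => /= h.
  have ne : i != j by rewrite -val_eqE /= ltn_eqF.
  exists (delta_mx i i - delta_mx j j), 2; split; rewrite ?pnatr_eq0 //.
  - rewrite in_lieg slL linearB /=.
    have tr1 (k : 'I_N) : \tr (delta_mx k k : M) = 1.
      by have := mxtrace_delta_mulmx (1%:M : M) k k; rewrite mulmx1 mxE eqxx => ->.
    by rewrite !tr1 subrr.
  - by apply/is_trig_mxP => u v uv; rewrite mxE mxBE !dd0 ?subrr // gtn_eqF.
  - rewrite lproj_delta_sl // /bracket mulmxBl mulmxBr !mul_delta_mx_cond.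
    rewrite !eqxx (eq_sym j) (negPf ne) mulr0n mulr1n subr0 sub0r opprK.
    by rewrite scaler_nat mulr2n.
case/andP: h => ii ji.
have ne : i != j by rewrite -val_eqE /= ltn_eqF.
exists (delta_mx i i - delta_mx (rev_ord i) (rev_ord i)), 1; split; rewrite ?oner_neq0 //.
- by rewrite in_lieg slL linearB /= !antitr_delta rev_ordK opprB.
- by apply/is_trig_mxP => u v uv; rewrite mxE mxBE !dd0 ?subrr // gtn_eqF.
rewrite scale1r /lproj slL bracketZr; congr (_ *: _).
rewrite antitr_delta /bracket !(mulmxBl, mulmxBr) !mul_delta_mx_cond.
rewrite !eqxx !(inj_eq rev_ord_inj) (negPf ji) (eq_sym j i) (negPf ne) (eq_sym _ i) (negPf ii).
have -> : (i == rev_ord j) = false.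
  by rewrite -(can2_eq (@rev_ordK _) (@rev_ordK _)) eq_sym (negPf ji).
by rewrite !mulr0n !mulr1n ?subr0 ?sub0r ?opprK ?oppr0 ?add0r.
Qed.

Lemma raising_strict i j : raising i j ->
  forall u v : 'I_N, (v <= u)%N -> (lproj (delta_mx i j) : M) u v = 0.
Proof.
case/andP=> ij h u v uv.
have d0 (a b : 'I_N) : (a < b)%N -> (delta_mx a b : M) u v = 0.
  move=> ab; rewrite mxE -!val_eqE /=.
  by case: andP => // -[/eqP ua /eqP vb]; move: ab uv; rewrite -ua -vb; lia.
case slL : (is_sl L).
  by rewrite lproj_delta_sl ?d0 // -val_eqE /= ltn_eqF.
rewrite /lproj slL antitr_delta mxE mxBE !d0 ?subrr ?mulr0 //.
by have := ltn_ord i; have := ltn_ord j => /=; lia.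
Qed.

Lemma raising_trig i j : raising i j -> is_trig_mx (lproj (delta_mx i j) : M)^T.
Proof.
move=> ij; apply/is_trig_mxP => u v uv; rewrite mxE.
by apply: raising_strict ij _ _ _; apply: ltnW.
Qed.

Lemma highest_killed x : highest_root_vector x -> killed x.
Proof.
case=> xg x0 hx i j ij.
have [t [c [tg tt c0 tE]]] := raising_weight ij.
have [ct Ht] := hx t tg tt.
have [cz Hz] := hx _ (lproj_in _) (raising_trig ij).
set Z := lproj _ in tE Hz *.
have := jacobi t Z x; rewrite tE Hz Ht (bracketZr _ t) (bracketZr _ Z) Ht Hz.
have -> : bracket (c *: Z) x = c *: bracket Z x.
  by rewrite bracketC (bracketZr _ x) -scalerN -bracketC.
rewrite Hz !scalerA (mulrC ct) => /eqP; rewrite eq_sym -subr_eq0 addrK scaler_eq0.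
by rewrite (negPf x0) orbF mulf_eq0 (negPf c0) => /eqP ->; rewrite scale0r.
Qed.

Lemma highest_Xtheta x : highest_root_vector x -> exists2 c, c != 0 & x = c *: Xtheta.
Proof.
move=> hx; have [xg x0 _] := hx.
have [c xE] := killed_Xtheta xg (highest_killed hx).
by exists c => //; apply: contraNneq x0 => c0; rewrite xE c0 scale0r.
Qed.

Lemma Xtheta_highest c : c != 0 -> highest_root_vector (c *: Xtheta).
Proof.
have [x hx] := highest_root_vector_ex R L.
have [c' c'0 xE] := highest_Xtheta hx; case: hx => xg x0 hx c0.
have E : c *: Xtheta = (c / c') *: x by rewrite xE scalerA divfK.
rewrite E; split; first exact: rpredZ.
  by rewrite scaler_eq0 negb_or x0 mulf_neq0 // invr_neq0.
move=> b bg bt; have [d Hd] := hx b bg bt; exists d.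
by rewrite bracketZr Hd !scalerA mulrC.
Qed.

Lemma Xtheta_in : Xtheta \in lieg.
Proof. by have [] := Xtheta_highest (oner_neq0 _); rewrite scale1r. Qed.

(* an ideal contains the highest root vector *)
Definition graded (g : nat) (x : M) := forall u v : 'I_N, (v + N < u + g)%N -> x u v = 0.

Lemma graded_bracket g Z x : (forall u v : 'I_N, (v <= u)%N -> Z u v = 0) ->
  graded g x -> graded g.+1 (bracket Z x).
Proof.
move=> hZ hx u v uv; rewrite /bracket mxBE !mxE !big1 ?subrr // => k _.
  by case: (leqP v k) => vk; [rewrite (hZ k) ?mulr0 | rewrite hx ?mul0r //; lia].
by case: (leqP k u) => vk; [rewrite (hZ u) ?mul0r | rewrite hx ?mulr0 //; lia].
Qed.

Lemma ideal_Xtheta (P : M -> Prop) :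
  (forall c x, P x -> P (c *: x)) ->
  (forall Z x, Z \in lieg -> x \in lieg -> P x -> P (bracket Z x)) ->
  forall x, x \in lieg -> x != 0 -> P x -> P Xtheta.
Proof.
move=> PZ PB.
have main n : forall g x, (2 * N - g = n)%N -> graded g x ->
    x \in lieg -> x != 0 -> P x -> P Xtheta.
  elim: n => [|n IH] g x gn gx xg x0 Px.
    case/eqP: x0; apply/matrixP => u v; rewrite mxE gx //.
    by have := ltn_ord v; lia.
  case: (pselect (killed x)) => [kx|].
    have [c xE] := killed_Xtheta xg kx.
    have c0 : c != 0 by apply: contraNneq x0 => c0; rewrite xE c0 scale0r.
    by have := PZ c^-1 x Px; rewrite xE scalerA mulVf // scale1r.
  case/existsNP=> i /existsNP => -[j /not_implyP[ij /eqP nz]].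
  apply: (IH g.+1 (bracket (lproj (delta_mx i j)) x)) => //; first by lia.
  - exact: graded_bracket (raising_strict ij) gx.
  - by apply: bracket_lieg => //; exact: lproj_in.
  - by apply: PB => //; exact: lproj_in.
move=> x; apply: (main (2 * N)%N 0%N) => //; first by rewrite subn0.
by move=> u v uv; have := ltn_ord u; lia.
Qed.
End Lie3.

(*PART Lie4*)
Section Lie4.
Variables (R : realType) (L : simple_algebra).
Local Notation C := (complex R).
Local Notation N := (matrix_size L).
Local Notation M := 'M[C]_N.
Local Notation lieg := (lieg R L).
Local Notation Xtheta := (Xtheta R L).
Local Notation Ytheta := (Ytheta R L).
Implicit Types x y z Z k : M.

Lemma in_groupE k : in_group k <-> \det k = 1 /\ (is_sl L = false -> antitr k *m k = 1%:M).
Proof.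
have E : antidiag R L *m (k^T *m antidiag R L *m k) = antitr k *m k.
  by rewrite -antidiag_mul !mulmxA.
rewrite /in_group; split=> -[dk h]; split=> //.
  by move=> slL; rewrite -E h ?slL // antidiagK.
move/negbTE/h; rewrite -E => H.
by have := congr1 (mulmx (antidiag R L)) H; rewrite mulmxA antidiagK mul1mx mulmx1.
Qed.

Lemma group_unit k : in_group k -> k \in unitmx.
Proof. by case=> dk _; rewrite unitmxE dk unitr1. Qed.

Lemma group_inv k : in_group k -> is_sl L = false -> invmx k = antitr k.
Proof.
move=> hk slL; have ku := group_unit hk; move/in_groupE: hk => [_ /(_ slL) h].
by rewrite -[RHS]mulmx1 -(mulmxV ku) mulmxA h mul1mx.
Qed.

Lemma group_mul k k' : in_group k -> in_group k' -> in_group (k *m k').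
Proof.
move=> /in_groupE[dk hk] /in_groupE[dk' hk']; apply/in_groupE; split.
  by rewrite det_mulmx dk dk' mulr1.
move=> slL; rewrite antitrM mulmxA -(mulmxA (antitr k')) hk // mulmx1; exact: hk'.
Qed.

Lemma group_invmx k : in_group k -> in_group (invmx k).
Proof.
move=> hk; have ku := group_unit hk; apply/in_groupE; split.
  by rewrite det_inv; case: hk => -> _; rewrite invr1.
by move=> slL; rewrite (group_inv hk slL) antitrK -(group_inv hk slL) mulmxV.
Qed.

Lemma invmx_mul k k' : k \in unitmx -> k' \in unitmx ->
  invmx (k *m k') = invmx k' *m invmx k.
Proof.
move=> ku ku'; have kku : k *m k' \in unitmx by rewrite unitmx_mul ku.
by rewrite -[RHS]mulmx1 -(mulmxV kku) !mulmxA mulmxKV // mulVmx // mul1mx.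
Qed.

Lemma Ad_mul k k' x : k \in unitmx -> k' \in unitmx -> Ad (k *m k') x = Ad k (Ad k' x).
Proof. by move=> ku ku'; rewrite /Ad invmx_mul // !mulmxA. Qed.

Lemma AdK k x : k \in unitmx -> Ad (invmx k) (Ad k x) = x.
Proof. by move=> ku; rewrite /Ad invmxK !mulmxA mulVmx // mul1mx -mulmxA mulVmx // mulmx1. Qed.

Lemma AdZ k c x : Ad k (c *: x) = c *: Ad k x.
Proof. by rewrite /Ad -scalemxAr -scalemxAl. Qed.

Lemma Ad_in k x : in_group k -> x \in lieg -> Ad k x \in lieg.
Proof.
move=> hk; have ku := group_unit hk; rewrite !in_lieg /Ad.
case slL: (is_sl L) => /eqP h; first by rewrite mxtrace_mulC mulmxA mulVmx // mul1mx h.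
by rewrite (group_inv hk slL) !antitrM antitrK h mulNmx mulmxN mulmxA.
Qed.

Lemma trace_Ad k x z : k \in unitmx -> \tr (Ad k x *m z) = \tr (x *m Ad (invmx k) z).
Proof.
by move=> ku; rewrite /Ad invmxK -!mulmxA mxtrace_mulC !mulmxA.
Qed.

Lemma Omin_in z : Omin z -> z \in lieg.
Proof. by case=> k [x [hk [xg _ _] ->]]; exact: Ad_in. Qed.

Lemma Omin_Ad k z : in_group k -> Omin z -> Omin (Ad k z).
Proof.
move=> hk [k' [x [hk' hx ->]]]; exists (k *m k'), x; split=> //; first exact: group_mul.
by rewrite Ad_mul ?group_unit.
Qed.

Lemma Omin_form z : Omin z -> exists k c, [/\ in_group k, c != 0 & z = c *: Ad k Xtheta].
Proof.
case=> k [x [hk hx ->]]; have [c c0 ->] := highest_Xtheta hx.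
by exists k, c; split=> //; rewrite AdZ.
Qed.

Lemma Omin_scale k c : in_group k -> c != 0 -> Omin (c *: Ad k Xtheta).
Proof. by move=> hk c0; exists k, (c *: Xtheta); split; rewrite ?AdZ //; exact: Xtheta_highest. Qed.

Lemma OminZ c z : c != 0 -> Omin z -> Omin (c *: z).
Proof.
move=> c0 /Omin_form [k [c' [hk c'0 ->]]]; rewrite scalerA; apply: Omin_scale => //.
exact: mulf_neq0.
Qed.

(* unipotent elements *)
Section SquareZero.
Variable Z : M.
Hypothesis Zg : Z \in lieg.
Hypothesis ZZ : Z *m Z = 0.

Lemma unipotent_inv (s s' : C) : (1%:M + s *: Z) *m (1%:M + s' *: Z) = 1%:M + (s + s') *: Z.
Proof.
rewrite mulmxDl mul1mx mulmxDr mulmx1 -scalemxAl -scalemxAr ZZ !scaler0 addr0.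
by rewrite -addrA -scalerDl addrC [s' + s]addrC addrC.
Qed.

Lemma unipotentV (s : C) : (1%:M + s *: Z) *m (1%:M - s *: Z) = 1%:M.
Proof. by rewrite -scaleNr unipotent_inv subrr scale0r addr0. Qed.

Lemma unipotent_det (s : C) : \det (1%:M + s *: Z) = 1.
Proof.
pose Zp : 'M[{poly C}]_N := map_mx polyC Z.
pose P : {poly C} := \det (1%:M + 'X *: Zp); pose Q : {poly C} := \det (1%:M - 'X *: Zp).
have ZpZp : Zp *m Zp = 0 by rewrite /Zp -map_mxM ZZ map_mx0.
have PQ : P * Q = 1.
  rewrite /P /Q -det_mulmx mulmxDl mul1mx mulmxBr mulmx1.
  rewrite -scalemxAr -scalemxAl ZpZp !scaler0 subr0.
  by rewrite -addrA addNr addr0 det1.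
have hor t : P.[t] = \det (1%:M + t *: Z).
  rewrite /P -horner_evalE -det_map_mx; congr (\det _).
  apply/matrixP => i j; rewrite !mxE /= horner_evalE hornerD hornerM hornerX hornerC.
  by rewrite hornerMn -[1]polyC1 hornerC.
have : size P == 1%N.
  have P0 : P != 0 by apply/eqP => P0; move: PQ; rewrite P0 mul0r => /eqP; rewrite eq_sym oner_eq0.
  have Q0 : Q != 0 by apply/eqP => Q0; move: PQ; rewrite Q0 mulr0 => /eqP; rewrite eq_sym oner_eq0.
  have sPQ : (size P + size Q).-1 = 1%N by rewrite -size_mul // PQ size_poly1.
  rewrite -size_poly_gt0 in P0; rewrite -size_poly_gt0 in Q0.
  by move: (size P) (size Q) sPQ P0 Q0 => a b; lia.
case/size_poly1P => c _ Pc.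
by rewrite -hor Pc hornerC -(hornerC c 0) -Pc hor scale0r addr0 det1.
Qed.

Lemma unipotent_group (s : C) : in_group (1%:M + s *: Z).
Proof.
apply/in_groupE; split; first exact: unipotent_det.
move=> slL; move: Zg; rewrite in_lieg slL => /eqP h.
have -> : antitr (1%:M + s *: Z) = 1%:M - s *: Z.
  rewrite [_ + _]addrC antitr_linear h antitr1.
  by rewrite scalerN addrC.
by rewrite -scaleNr unipotent_inv addNr scale0r addr0.
Qed.

Lemma unipotent_invmx (s : C) : invmx (1%:M + s *: Z) = 1%:M - s *: Z.
Proof.
have ku := group_unit (unipotent_group s).
by rewrite -[RHS](mulKmx ku) unipotentV mulmx1.
Qed.

Lemma unipotent_Ad (s : C) x :
  Ad (1%:M + s *: Z) x = x + s *: bracket Z x - s ^+ 2 *: (Z *m x *m Z).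
Proof.
rewrite /Ad unipotent_invmx mulmxBr mulmx1 mulmxDl mul1mx -scalemxAr mulmxDl.
rewrite -!scalemxAl scalerDr scalerA -expr2 /bracket scalerBr opprD !addrA.
by [].
Qed.
End SquareZero.

End Lie4.

(*PART Lie5*)
Lemma mxDE (F : nmodType) m n (A B : 'M[F]_(m, n)) u v : (A + B) u v = A u v + B u v.
Proof. by rewrite mxE. Qed.

Section Lie5.
Variables (R : realType) (L : simple_algebra).
Local Notation C := (complex R).
Local Notation N := (matrix_size L).
Local Notation M := 'M[C]_N.
Local Notation lieg := (lieg R L).
Local Notation X := (Xtheta R L).
Local Notation Y := (Ytheta R L).
Local Notation i0 := (idx0 L).
Local Notation i1 := (idx1 L).
Local Notation r0 := (rev_ord i0).
Local Notation r1 := (rev_ord i1).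
Implicit Types x y z Z k : M.

Lemma ends_neq : ((i0 == r0) = false) * ((r0 == i0) = false).
Proof.
by have := size_gt2 L => N2; split; rewrite -val_eqE /=; lia.
Qed.

Lemma corners_neq : is_sl L = false ->
  ((i0 == i1) = false) * ((i1 == i0) = false) * ((r0 == r1) = false) * ((r1 == r0) = false)
  * ((i0 == r1) = false) * ((r1 == i0) = false) * ((i1 == r0) = false) * ((r0 == i1) = false)
  * ((i1 == r1) = false) * ((r1 == i1) = false).
Proof. by move/so_size => N2; do !split; rewrite -val_eqE /=; lia. Qed.

Lemma YthetaE : Y = if is_sl L then delta_mx r0 i0 else delta_mx r1 i0 - delta_mx r0 i1.
Proof. by rewrite /Ytheta /Xtheta; case: (is_sl L); rewrite ?raddfB /= !trmx_delta. Qed.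

Lemma Xsq : X *m X = 0.
Proof.
rewrite /Xtheta; case slL: (is_sl L); rewrite ?mulmxBl ?mulmxBr !mul_delta_mx_cond ?eqxx.
  by rewrite !ends_neq.
by rewrite !(corners_neq slL) !ends_neq !mulr0n !subr0.
Qed.

Lemma Ysq : Y *m Y = 0.
Proof. by rewrite /Ytheta -trmx_mul Xsq trmx0. Qed.

Lemma XYE : X *m Y = if is_sl L then delta_mx i0 i0 else delta_mx i0 i0 + delta_mx i1 i1.
Proof.
rewrite YthetaE /Xtheta; case slL: (is_sl L); rewrite ?mulmxBl ?mulmxBr !mul_delta_mx_cond ?eqxx //.
by rewrite !(corners_neq slL) !mulr0n !mulr1n sub0r subr0 opprK.
Qed.

Lemma YXE : Y *m X = if is_sl L then delta_mx r0 r0 else delta_mx r1 r1 + delta_mx r0 r0.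
Proof.
rewrite YthetaE /Xtheta; case slL: (is_sl L); rewrite ?mulmxBl ?mulmxBr !mul_delta_mx_cond ?eqxx //.
by rewrite !(corners_neq slL) !mulr0n !mulr1n sub0r subr0 opprK.
Qed.

Lemma XYX : X *m Y *m X = X.
Proof.
rewrite XYE /Xtheta; case slL: (is_sl L); rewrite ?mulmxDl ?mulmxBr !mul_delta_mx_cond ?eqxx //.
by rewrite !(corners_neq slL) !mulr0n !mulr1n subr0 sub0r.
Qed.

Lemma YXY : Y *m X *m Y = Y.
Proof. by apply: trmx_inj; rewrite /Ytheta !trmx_mul !trmxK mulmxA; exact: XYX. Qed.

Lemma Y_in : Y \in lieg.
Proof.
rewrite in_lieg YthetaE; case slL: (is_sl L).
  have := mxtrace_delta_mulmx (1%:M : M) r0 i0; rewrite mulmx1 => ->.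
  by rewrite mxE ends_neq.
by rewrite linearB /= !antitr_delta !rev_ordK opprB.
Qed.

Lemma Omin_Ytheta : Omin Y.
Proof.
have Xg := Xtheta_in R L; have Yg := Y_in.
have gX := unipotent_group Xg Xsq 1; have gY := unipotent_group Yg Ysq (-1).
have E : Ad (1%:M + 1 *: X) (Ad (1%:M + -1 *: Y) (Ad (1%:M + 1 *: X) X)) = - Y.
  have A1 : Ad (1%:M + 1 *: X) X = X.
    by rewrite (unipotent_Ad Xg Xsq) /bracket subrr Xsq mul0mx !scaler0 addr0 subr0.
  have A2 : Ad (1%:M + -1 *: Y) X = X + bracket X Y - Y.
    by rewrite (unipotent_Ad Yg Ysq) YXY sqrrN expr1n scale1r scaleN1r -bracketC.
  rewrite A1 A2 (unipotent_Ad Xg Xsq) expr1n !scale1r.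
  have hX : bracket X (X + bracket X Y - Y) = - X *+ 2 - bracket X Y.
    rewrite bracketBr bracketDr {1}/bracket subrr add0r; congr (_ - _).
    rewrite /bracket mulmxBr mulmxBl !mulmxA Xsq mul0mx -mulmxA -(mulmxA Y) Xsq mulmx0 sub0r subr0.
    by rewrite mulmxA XYX mulNrn mulr2n opprD.
  rewrite hX.
  have -> : X *m (X + bracket X Y - Y) *m X = - X.
    rewrite /bracket mulmxBr mulmxDr Xsq add0r mulmxBr !mulmxA Xsq mul0mx sub0r.
    by rewrite mulmxBl mulNmx -!mulmxA Xsq !mulmx0 oppr0 sub0r mulmxA XYX.
  rewrite opprK mulNrn mulr2n; move: X Y (bracket X Y) => a b c.
  by apply/matrixP => i j; rewrite !mxE; ring.
have O1 : Omin X.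
  exists 1%:M, X; split; last by rewrite /Ad invmx1 mul1mx mulmx1.
    by have := unipotent_group Xg Xsq 0; rewrite scale0r addr0.
  by have := @Xtheta_highest R L 1 (oner_neq0 _); rewrite scale1r.
rewrite -[Y]opprK -scaleN1r; apply: OminZ; rewrite ?oppr_eq0 ?oner_neq0 // -E.
by do !apply: Omin_Ad.
Qed.

(* the semisimple element *)
Definition htheta : M := bracket X Y.

Lemma h_in : htheta \in lieg.
Proof. by apply: bracket_lieg; [exact: Xtheta_in | exact: Y_in]. Qed.

Definition hweight (i : 'I_N) : int :=
  if is_sl L then (i == i0)%:Z - (i == r0)%:Z
  else ((i == i0) || (i == i1))%:Z - ((i == r0) || (i == r1))%:Z.

Lemma h_bracket x i j : bracket htheta x i j = (hweight i - hweight j)%:~R * x i j.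
Proof.
have hE : htheta = diag_mx (\row_i (hweight i)%:~R).
  rewrite /htheta /bracket XYE YXE /hweight; apply/matrixP => u v.
  case: (eqVneq u v) => [<-|uv]; last first.
    have d0 (k : 'I_N) : (delta_mx k k : M) u v = 0.
      by rewrite mxE; case: eqP => [<-|//] /=; rewrite eq_sym (negPf uv).
    case: (is_sl L); first by rewrite mxBE !d0 subrr mxE (negPf uv) mulr0n.
    by rewrite mxBE !mxDE !d0 addr0 subrr mxE (negPf uv) mulr0n.
  have d1 (k : 'I_N) : (delta_mx k k : M) u u = (u == k)%:R by rewrite mxE andbb.
  rewrite [RHS]mxE eqxx mulr1n [RHS]mxE; case slL: (is_sl L).
    by rewrite mxBE !d1 rmorphB /= -!pmulrn.
  rewrite mxBE !mxDE !d1 rmorphB /= -!pmulrn.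
  case: (eqVneq u i0) => [->|_]; first by rewrite !(corners_neq slL) !ends_neq; ring.
  case: (eqVneq u i1) => [->|_]; first by rewrite !(corners_neq slL); ring.
  case: (eqVneq u r0) => [->|_]; first by rewrite !(corners_neq slL); ring.
  by case: (u == r1); ring.
rewrite hE /bracket mxBE mul_diag_mx mul_mx_diag !mxE rmorphB /=; ring.
Qed.

Definition ycoef x : C := if is_sl L then x r0 i0 else x r1 i0.

Lemma lowest_weight_space x : x \in lieg ->
  (forall i j, (hweight i - hweight j != -2) -> x i j = 0) -> x = ycoef x *: Y.
Proof.
move=> xg hx; rewrite /ycoef YthetaE; have := hx; rewrite /hweight.
case slL: (is_sl L) => {}hx; apply/matrixP => u v; rewrite mxE.
  rewrite mxE; case: (eqVneq u r0) => [->|u0] /=.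
    case: (eqVneq v i0) => [->|v0] /=; rewrite ?mulr1 // mulr0; apply: hx.
    by rewrite eqxx !ends_neq (negPf v0); case: (v == r0).
  by rewrite mulr0; apply: hx; rewrite (negPf u0); case: (u == i0); case: (v == i0); case: (v == r0).
rewrite mxBE !mxE; have anti := so_entry slL xg.
have two0 (c : C) : c = - c -> c = 0.
  by move/eqP; rewrite -addr_eq0 -mulr2n mulrn_eq0 /= => /eqP.
case: (boolP [|| (u, v) == (r1, i0), (u, v) == (r0, i1), (u, v) == (r0, i0) | (u, v) == (r1, i1)]).
  case/or4P => /eqP[-> ->]; rewrite ?eqxx ?(corners_neq slL) ?mulr0n ?mulr1n ?subr0 ?sub0r ?mulr1 ?mulrN ?mulr0 //=.
  - by rewrite mulr1 anti rev_ordK.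
  - by rewrite ?oppr0 ?mulr0; apply: two0; rewrite [LHS]anti rev_ordK.
  - by rewrite ?oppr0 ?mulr0; apply: two0; rewrite [LHS]anti rev_ordK.
rewrite !xpair_eqE !negb_or => /and4P[/negPf h1 /negPf h2 /negPf h3 /negPf h4].
rewrite h1 h2 subrr mulr0; apply: hx.
have gen (p q p' q' : bool) : q && p' = false ->
    p%:Z - q%:Z - (p'%:Z - q'%:Z) != -2 by case: p; case: q; case: p'; case: q'.
by apply: gen; rewrite andb_orl !andb_orr h1 h2 h3 h4.
Qed.

Lemma functional_lowest (f : M -> C) :
  (forall c x y, x \in lieg -> y \in lieg -> f (c *: x + y) = c * f x + f y) ->
  (forall x, x \in lieg -> f (bracket htheta x) = -2 * f x) ->
  forall x, x \in lieg -> f x = ycoef x * f Y.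
Proof.
move=> fL fh x xg; pose T (c : int) z := - c%:~R *: z + bracket htheta z.
have Tg c z : z \in lieg -> T c z \in lieg.
  by move=> zg; rewrite rpredD ?rpredZ //; apply: bracket_lieg => //; exact: h_in.
have Tf c z : z \in lieg -> f (T c z) = (- 2 - c%:~R) * f z.
  by move=> zg; rewrite fL ?fh //; [ring | apply: bracket_lieg => //; exact: h_in].
have TE c z i j : T c z i j = (hweight i - hweight j - c)%:~R * z i j.
  by rewrite mxE mxE h_bracket !rmorphB /=; ring.
pose U := T 2 (T 1 (T 0 (T (-1) x))).
have Ug : U \in lieg by rewrite !Tg.
have fU : f U = 24 * f x by rewrite !Tf ?Tg //; ring.
have UE i j : U i j = let w := hweight i - hweight j in ((w - 2) * (w - 1) * w * (w + 1))%:~R * x i j.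
  by rewrite !TE /= !rmorphM /= !rmorphB !rmorphD /=; ring.
have UY : U = ycoef U *: Y.
  apply: lowest_weight_space => // i j w2; rewrite UE /=.
  suff -> : ((hweight i - hweight j - 2) * (hweight i - hweight j - 1) *
    (hweight i - hweight j) * (hweight i - hweight j + 1) = 0) by rewrite mul0r.
  have hw (k : 'I_N) : (-1 <= hweight k <= 1).
    have gen (b b' : bool) : -1 <= b%:Z - b'%:Z <= 1 by case: b; case: b'.
    by rewrite /hweight; case: (is_sl L).
  have: (hweight i - hweight j = -1 \/ hweight i - hweight j = 0) \/
    (hweight i - hweight j = 1 \/ hweight i - hweight j = 2).
    by move: (hw i) (hw j) w2; move: (hweight i) (hweight j) => a b; lia.
  by case=> -[] ->.
have yU : ycoef U = 24 * ycoef x.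
  rewrite /ycoef /hweight; case slL: (is_sl L); rewrite UE /hweight slL !eqxx.
    by rewrite !ends_neq.
  by rewrite !(corners_neq slL) orbT !ends_neq.
have f0 : f (ycoef U *: Y) = ycoef U * f Y.
  have f00 : f 0 = 0.
    by have := fL 1 0 0 (rpred0 _) (rpred0 _); rewrite scaler0 addr0 mul1r => /eqP; rewrite -subr_eq0 opprD addNKr oppr_eq0 => /eqP.
  by rewrite -[_ *: Y]addr0 fL ?f00 ?addr0 ?rpred0 // Y_in.
have /eqP := fU; rewrite UY f0 yU -mulrA -subr_eq0 -mulrBr mulf_eq0 pnatr_eq0 /=.
by rewrite subr_eq0 => /eqP <-.
Qed.

(* shape of the points of the orbit *)
Lemma Omin_sq z : Omin z -> z *m z = 0.
Proof.
case/Omin_form => k [c [hk c0 ->]]; have ku := group_unit hk.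
rewrite -scalemxAl -scalemxAr /Ad -!mulmxA (mulmxA (invmx k)) mulVmx // mul1mx.
by rewrite (mulmxA X) Xsq !(mul0mx, mulmx0) !scaler0.
Qed.

Lemma Omin_sl z : is_sl L -> Omin z -> exists a b : 'I_N -> C, forall i j, z i j = a i * b j.
Proof.
move=> slL /Omin_form [k [c [hk c0 ->]]].
exists (fun i => c * k i i0), (fun j => invmx k r0 j) => i j.
by rewrite mxE /Ad /Xtheta slL mul_delta_entry mulrA.
Qed.

Lemma Omin_so z : is_sl L = false -> Omin z -> exists u v : 'I_N -> C,
  forall i j, z i (rev_ord j) = u i * v j - v i * u j.
Proof.
move=> slL /Omin_form [k [c [hk c0 ->]]].
exists (fun i => c * k i i0), (fun j => k j i1) => i j.
rewrite mxE /Ad /Xtheta slL (group_inv hk slL) mulmxBr mulmxBl mxBE !mul_delta_entry.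
by rewrite !mxE !rev_ordK; ring.
Qed.
End Lie5.

(*PART Lie6*)
Section Lie6.
Variables (R : realType) (L : simple_algebra).
Local Notation C := (complex R).
Local Notation N := (matrix_size L).
Local Notation M := 'M[C]_N.
Local Notation lieg := (lieg R L).
Implicit Types x y z Z k : M.
Implicit Types a b : 'cV[C]_N.

(* symmetric form and decomposable elements of so(n) *)
Definition form a b : C := \sum_i a i 0 * b (rev_ord i) 0.
Definition wedge a b : M := \matrix_(i, j) (a i 0 * b (rev_ord j) 0 - b i 0 * a (rev_ord j) 0).

Lemma formC a b : form a b = form b a.
Proof.
rewrite /form [LHS](reindex_inj rev_ord_inj) /=.
by apply: eq_bigr => i _; rewrite rev_ordK mulrC.
Qed.

Lemma wedgeN a b : wedge b a = - wedge a b.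
Proof. by apply/matrixP => i j; rewrite !mxE opprB. Qed.

Lemma wedgeL c a a' b : wedge (c *: a + a') b = c *: wedge a b + wedge a' b.
Proof. by apply/matrixP => i j; rewrite !mxE; ring. Qed.

Lemma wedgeR c a b b' : wedge a (c *: b + b') = c *: wedge a b + wedge a b'.
Proof. by apply/matrixP => i j; rewrite !mxE; ring. Qed.

Lemma formL c a a' b : form (c *: a + a') b = c * form a b + form a' b.
Proof.
rewrite /form mulr_sumr -big_split; apply: eq_bigr => i _.
by rewrite !mxE mulrDl mulrA.
Qed.

Lemma formR c a b b' : form a (c *: b + b') = c * form a b + form a b'.
Proof. by rewrite formC formL !(formC _ a). Qed.

Lemma wedge_in a b : is_sl L = false -> wedge a b \in lieg.
Proof.
move=> slL; rewrite in_lieg slL; apply/eqP/matrixP => i j.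
by rewrite !mxE rev_ordK; ring.
Qed.

Lemma wedge_sq a b : form a a = 0 -> form a b = 0 -> form b b = 0 ->
  wedge a b *m wedge a b = 0.
Proof.
move=> aa ab bb; apply/matrixP => i j; rewrite !mxE.
transitivity (form a b * (a i 0 * b (rev_ord j) 0) - form b b * (a i 0 * a (rev_ord j) 0)
   - form a a * (b i 0 * b (rev_ord j) 0) + form b a * (b i 0 * a (rev_ord j) 0)).
  rewrite /form !mulr_suml -!sumrB -big_split /=.
  apply: eq_bigr => k _; rewrite !mxE; ring.
by rewrite aa ab bb (formC b a) ab !mul0r !subr0 addr0.
Qed.

Local Notation e i := (delta_mx i 0 : 'cV[C]_N).

Lemma form_delta i j : form (e i) (e j) = (i == rev_ord j)%:R.
Proof.
rewrite /form (bigD1 i) //= big1 => [|k ki]; rewrite !mxE ?(negPf ki) ?mul0r // !eqxx andbT mul1r addr0.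
by rewrite (can2_eq rev_ordK rev_ordK) andbT.
Qed.

Lemma wedge_delta i j : wedge (e i) (e (rev_ord j)) = delta_mx i j - delta_mx (rev_ord j) (rev_ord i).
Proof.
apply/matrixP => u v; rewrite !mxE !andbT (inj_eq rev_ord_inj).
by rewrite [rev_ord v == i](can2_eq rev_ordK rev_ordK) -!natrM !mulnb.
Qed.

Section Span.
Variable P : M -> Prop.
Hypothesis PL : forall (c : C) x y, P x -> P y -> P (c *: x + y).
Hypothesis PS : forall Z, Z \in lieg -> Z *m Z = 0 -> P Z.

Let P0 : P 0. Proof. by apply: PS; rewrite ?rpred0 ?mulmx0. Qed.
Let PZ (c : C) x : P x -> P (c *: x).
Proof. by move=> Px; rewrite -[_ *: _]addr0; exact: PL. Qed.
Let PD x y : P x -> P y -> P (x + y).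
Proof. by move=> Px Py; rewrite -[x]scale1r; exact: PL. Qed.
Let PN x : P x -> P (- x).
Proof. by move=> Px; rewrite -scaleN1r; exact: PZ. Qed.
Let Psum (I : finType) (F : I -> M) : (forall i, P (F i)) -> P (\sum_i F i).
Proof. by move=> h; elim/big_ind: _. Qed.

Lemma span_sl : is_sl L -> forall x, x \in lieg -> P x.
Proof.
move=> slL x xg.
have PE (i j : 'I_N) : i != j -> P (delta_mx i j).
  move=> ij; apply: PS; last by rewrite mul_delta_mx_cond eq_sym (negPf ij).
  by rewrite -(lproj_delta_sl _ slL ij) lproj_in.
have PH i : P (delta_mx i i - delta_mx (idx0 L) (idx0 L)).
  case: (eqVneq i (idx0 L)) => [->|ne]; first by rewrite subrr.
  set k := idx0 L in ne *; have ne' : (k == i) = false by rewrite eq_sym (negPf ne).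
  have -> : delta_mx i i - delta_mx k k = (delta_mx i i - delta_mx k k - delta_mx i k + delta_mx k i)
     + (delta_mx i k - delta_mx k i) :> M.
    by move: (delta_mx _ _) (delta_mx _ _) (delta_mx _ _) (delta_mx _ _) => a b c d;
       apply/matrixP => u v; rewrite !mxE; ring.
  apply: PD; last by apply: PD; [exact: PE | apply: PN; apply: PE; rewrite eq_sym].
  have trE (u v : 'I_N) : \tr (delta_mx u v : M) = (u == v)%:R.
    by have := mxtrace_delta_mulmx (1%:M : M) u v; rewrite mulmx1 mxE eq_sym.
  apply: PS.
    rewrite in_lieg slL !(raddfD, raddfN) /= !trE !eqxx ?(negPf ne) ?ne'.
    by rewrite subrr subr0 addr0.
  rewrite !(mulmxDl, mulmxDr, mulmxBl, mulmxBr, mulNmx, mulmxN) !mul_delta_mx_cond !eqxx ?(negPf ne) ?ne'.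
  rewrite !mulr0n !mulr1n.
  move: (delta_mx _ _) (delta_mx _ _) (delta_mx _ _) (delta_mx _ _) => a b c d.
  by apply/matrixP => u v; rewrite !mxE; ring.
have -> : x = \sum_i (x i i *: (delta_mx i i - delta_mx (idx0 L) (idx0 L))
   + \sum_(j | j != i) x i j *: delta_mx i j).
  rewrite {1}(matrix_sum_delta x).
  have tr0 : \sum_i x i i *: (delta_mx (idx0 L) (idx0 L) : M) = 0.
    by move: xg; rewrite -scaler_suml in_lieg slL -/(\tr x) => /eqP ->; rewrite scale0r.
  rewrite -[LHS]subr0 -[X in _ - X]tr0 -sumrB; apply: eq_bigr => i _.
  by rewrite (bigD1 i) //= scalerBr addrAC.
apply: Psum => i; apply: PD; first exact: PZ.
by elim/big_ind: _ => // j ji; apply/PZ/PE; rewrite eq_sym.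
Qed.

Lemma span_so : is_sl L = false -> forall x, x \in lieg -> P x.
Proof.
move=> slL x xg; have N5 := so_size slL.
have PW a b : form a a = 0 -> form a b = 0 -> form b b = 0 -> P (wedge a b).
  by move=> aa ab bb; apply: PS; [exact: wedge_in | exact: wedge_sq].
have pick (j : 'I_N) : exists k : 'I_N, [/\ k != j, k != rev_ord j & k != rev_ord k].
  case: (ltnP 2 j) => j2; last first.
    case: (eqVneq (nat_of_ord j) 0%N) => j0.
      by exists (idx1 L); split; rewrite -val_eqE /=; have := ltn_ord j; lia.
    by exists (idx0 L); split; rewrite -val_eqE /=; have := ltn_ord j; lia.
  case: (eqVneq (nat_of_ord j) N.-1) => j0.
    by exists (idx1 L); split; rewrite -val_eqE /=; have := ltn_ord j; lia.
  by exists (idx0 L); split; rewrite -val_eqE /=; have := ltn_ord j; lia.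
have fE := form_delta; have rE (i j : 'I_N) : (rev_ord i == j) = (i == rev_ord j).
  by rewrite (can2_eq rev_ordK rev_ordK).
have PN1 a b : P (wedge a b) -> P (wedge b a) by move=> h; rewrite wedgeN; exact: PN.
have P1 (i j : 'I_N) : i != rev_ord i -> j != rev_ord j -> i != rev_ord j -> P (wedge (e i) (e j)).
  by move=> ii jj ij; apply: PW; rewrite fE ?(negPf ii) ?(negPf jj) ?(negPf ij).
have P2 (i j : 'I_N) : i == rev_ord i -> j != i -> P (wedge (e i) (e j)).
  move=> ii ji; have [k [kj kj' kk]] := pick j.
  have ki : k != i by apply: contraNneq kk => ->.
  have jj : j != rev_ord j.
    by apply: contraNneq ji => jj; rewrite -val_eqE; move: ii (congr1 val jj); rewrite -val_eqE /=; have := ltn_ord i; have := ltn_ord j; lia.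
  have [w wE] : exists w, w = (- 2^-1) *: e (rev_ord k) + (1 *: e k + e i) by eexists.
  have -> : e i = 2^-1 *: e (rev_ord k) + (-1 *: e k + w).
    rewrite wE; move: (e i) (e k) (e (rev_ord k)) => a b c.
    by apply/matrixP => u v; rewrite !mxE; ring.
  rewrite !wedgeL; apply: PL; first apply: P1 => //.
  - by rewrite rev_ordK eq_sym.
  - by rewrite (inj_eq rev_ord_inj).
  apply: PL; first by apply: P1.
  have ki' : (k == rev_ord i) = false by rewrite -(eqP ii) (negPf ki).
  have ij' : (i == rev_ord j) = false.
    by rewrite (eqP ii) (inj_eq rev_ord_inj) eq_sym (negPf ji).
  apply: PW; rewrite ?wE ?(formL, formR) !fE ?rev_ordK ?rE ?(inj_eq rev_ord_inj) ?eqxx.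
  - rewrite ii ki' (eq_sym i (rev_ord k)) rE ki' (negPf kk) (eq_sym i k) (negPf ki) /=.
    by rewrite !rev_ordK eqxx (negPf ki) /=; field.
  - by rewrite ?rev_ordK (negPf kj) (negPf kj') ij' /=; ring.
  - by rewrite (negPf jj).
have P3 (i : 'I_N) : i != rev_ord i -> P (wedge (e i) (e (rev_ord i))).
  move=> ii; have [k [ki ki' kk]] := pick i.
  have E : wedge (e i) (e (rev_ord i)) = 2^-1 *: (
     wedge (1 *: e i + e k) (-1 *: e (rev_ord k) + e (rev_ord i))
   + wedge (1 *: e i + e (rev_ord k)) (-1 *: e k + e (rev_ord i))
   + (wedge (e i) (e (rev_ord k)) + wedge (e i) (e k)
    - wedge (e k) (e (rev_ord i)) - wedge (e (rev_ord k)) (e (rev_ord i)))).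
    rewrite !(wedgeL, wedgeR) (wedgeN (e (rev_ord k)) (e k)).
    by move: (wedge _ _) (wedge _ _) (wedge _ _) (wedge _ _) (wedge _ _) (wedge _ _) => a b c d f g;
      apply/matrixP => u v; rewrite !mxE; field.
  have f1 := negPf ii; have f2 := negPf kk; have f3 := negPf ki; have f4 := negPf ki'.
  have f5 : (i == k) = false by rewrite eq_sym.
  have f6 : (i == rev_ord k) = false by rewrite eq_sym rE.
  rewrite E; apply: PZ; apply: PD; first apply: PD.
  - by apply: PW; rewrite ?(formL, formR) !fE ?(rE, rev_ordK) ?(eqxx, f1, f2, f3, f4, f5, f6) /=; ring.
  - by apply: PW; rewrite ?(formL, formR) !fE ?(rE, rev_ordK) ?(eqxx, f1, f2, f3, f4, f5, f6) /=; ring.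
  have Pk (j : 'I_N) : j != rev_ord j -> k != rev_ord j -> k != j -> P (wedge (e k) (e j)).
    by move=> jj kj _; exact: P1.
  do !apply: PD.
  - by apply: P1; rewrite ?rev_ordK ?rE ?(eq_sym i k) // eq_sym.
  - by apply: P1 => //; rewrite eq_sym rE.
  - by apply: PN; apply: P1 => //; rewrite ?rev_ordK ?rE // eq_sym.
  - by apply: PN; apply: P1; rewrite ?rev_ordK ?rE ?(inj_eq rev_ord_inj) // eq_sym.
have Pall (i j : 'I_N) : P (wedge (e i) (e j)).
  case: (eqVneq i j) => [->|ij].
    suff -> : wedge (e j) (e j) = 0 by [].
    by apply/matrixP => u v; rewrite !mxE subrr.
  case: (boolP (i == rev_ord i)) => ii; first by apply: P2 => //; rewrite eq_sym.
  case: (boolP (j == rev_ord j)) => jj; first by apply: PN1; apply: P2.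
  case: (eqVneq i (rev_ord j)) => [h|h]; last exact: P1.
  have -> : j = rev_ord i by rewrite h rev_ordK.
  exact: P3.
have -> : x = 2^-1 *: \sum_i \sum_j x i j *: wedge (e i) (e (rev_ord j)).
  rewrite -[LHS](lproj_id xg) /lproj slL; congr (_ *: _).
  have -> : antitr x = \sum_i \sum_j x i j *: delta_mx (rev_ord j) (rev_ord i).
    rewrite {1}(matrix_sum_delta x) raddf_sum; apply: eq_bigr => i _.
    rewrite raddf_sum; apply: eq_bigr => j _.
    by rewrite -antitr_delta; apply/matrixP => u v; rewrite !mxE.
  rewrite {1}(matrix_sum_delta x) -sumrB; apply: eq_bigr => i _.
  rewrite -sumrB; apply: eq_bigr => j _.
  by rewrite wedge_delta scalerBr.
by apply: PZ; apply: (Psum (F := fun i => _)) => i; apply: (Psum (F := fun j => _)) => j; exact: PZ.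
Qed.

(* every element of g is a combination of square-zero elements of g *)
Lemma square_zero_span x : x \in lieg -> P x.
Proof. by case slL: (is_sl L); [apply: span_sl | apply: span_so]. Qed.
End Span.
End Lie6.

(*PART Func*)
Lemma mpoly_alg_ind (F : comNzRingType) n (P : {mpoly F[n]} -> Prop) :
  (forall c, P c%:MP) -> (forall i, P 'X_i) ->
  (forall p q, P p -> P q -> P (p + q)) ->
  (forall p q, P p -> P q -> P (p * q)) -> forall p, P p.
Proof.
move=> PC PX PD PM p; rewrite (mpolyE p).
elim/big_ind: _ => // [|m _]; first by rewrite -mpolyC0.
rewrite -mul_mpolyC; apply: (PM) => //; rewrite mpolyXE_id.
elim/big_ind: _ => // [|i _]; first by rewrite -mpolyC1.
by elim: (m i) => [|k IH]; rewrite ?expr0 ?exprS -?mpolyC1 //; apply: PM.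
Qed.

Lemma poly0_nat (F : numFieldType) (p : {poly F}) : (forall n : nat, p.[n%:R] = 0) -> p = 0.
Proof.
move=> p0; apply/eqP; apply: contraT => nz.
have := @max_poly_roots _ p [seq i%:R | i <- iota 0 (size p)] nz.
rewrite size_map size_iota ltnn => -> //.
  by apply/allP => _ /mapP[i _ ->]; rewrite /root p0.
rewrite map_inj_uniq ?iota_uniq // => i j /eqP; rewrite eqr_nat; exact: eqP.
Qed.

Lemma curve_poly (F : comNzRingType) n (V : 'I_n -> {poly F}) (p : {mpoly F[n]}) :
  exists P : {poly F}, (forall s, P.[s] = p.@[fun j => (V j).[s]]) /\
    P`_1 = \sum_j p^`M(j).@[fun j => (V j).[0]] * (V j)`_1.
Proof.
elim/mpoly_alg_ind: p => [c|i|p q [P [P0 P1]] [Q [Q0 Q1]]|p q [P [P0 P1]] [Q [Q0 Q1]]].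
- exists c%:P; split=> [s|]; first by rewrite hornerC mevalC.
  by rewrite coefC big1 //= => j _; rewrite mderivC meval0 mul0r.
- exists (V i); split=> [s|]; first by rewrite mevalXU.
  rewrite (bigD1 i) //= big1 => [|j ji]; last first.
    by rewrite mderivX mnm1E eq_sym (negPf ji) scale0r meval0 mul0r.
  rewrite mderivX mnm1E eqxx scale1r.
  have -> : (U_(i) - U_(i))%MM = 0%MM :> 'X_{1..n} by apply/mnmP => j; rewrite mnmBE subnn mnm0E.
  by rewrite mpolyX0 meval1 mul1r addr0.
- exists (P + Q); split=> [s|]; first by rewrite hornerD P0 Q0 mevalD.
  rewrite coefD P1 Q1 -big_split; apply: eq_bigr => j _.
  by rewrite mderivD mevalD mulrDl.
exists (P * Q); split=> [s|]; first by rewrite hornerM P0 Q0 mevalM.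
rewrite coefM 2!big_ord_recl big_ord0 addr0 /= P1 Q1 -!horner_coef0 P0 Q0.
rewrite mulr_sumr mulr_suml -big_split; apply: eq_bigr => j _ /=.
by rewrite mderivM mevalD !mevalM; ring.
Qed.

Lemma curve_tangent (F : numFieldType) n (V : 'I_n -> {poly F}) (p : {mpoly F[n]}) :
  (forall m : nat, p.@[fun j => (V j).[m%:R]] = 0) ->
  \sum_j p^`M(j).@[fun j => (V j).[0]] * (V j)`_1 = 0.
Proof.
move=> p0; have [P [P0 <-]] := curve_poly V p.
by rewrite (@poly0_nat _ P) ?coef0 // => m; rewrite P0.
Qed.

Section Func.
Variables (R : realType) (L : simple_algebra).
Local Notation C := (complex R).
Local Notation N := (matrix_size L).
Local Notation M := 'M[C]_N.
Local Notation lieg := (lieg R L).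
Local Notation RO := (RO R L).
Local Notation Sg := (Sg R L).
Local Notation d := (\dim lieg).
Implicit Types (x y z Z k : M) (f g : RO) (F G : Sg).

Lemma gbasis_in (i : 'I_d) : gbasis i \in lieg.
Proof. by apply: vbasis_mem; rewrite mem_nth ?size_tuple ?ltn_ord. Qed.

Lemma gbasis_coord x : x \in lieg -> x = \sum_(i < d) coord (vbasis lieg) i x *: gbasis i.
Proof. exact: coord_vbasis. Qed.

Lemma killingLr x (c : C) y z : killing x (c *: y + z) = c * killing x y + killing x z.
Proof.
rewrite /killing mulr_sumr -big_split; apply: eq_bigr => i _ /=.
have -> : bracket (c *: y + z) (gbasis i) = c *: bracket y (gbasis i) + bracket z (gbasis i).
  exact: (bracket_linearl _ c y z).
rewrite bracketDr (bracketZr _ x).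
by rewrite linearD linearZ.
Qed.

Lemma killing_coord (phi : M -> C) x : (forall c y z, phi (c *: y + z) = c * phi y + phi z) ->
  x \in lieg -> \sum_(i < d) coord (vbasis lieg) i x * phi (gbasis i) = phi x.
Proof.
move=> phiL xg; rewrite {2}(gbasis_coord xg).
have phi0 : phi 0 = 0.
  have := phiL 1 0 0; rewrite scaler0 addr0 mul1r => /eqP.
  by rewrite -subr_eq0 opprD addNKr oppr_eq0 => /eqP.
elim/big_rec2: _ => [|i y1 y2 _ ->]; first by rewrite phi0.
by rewrite phiL.
Qed.

Lemma killingLl z (c : C) x y : killing (c *: x + y) z = c * killing x z + killing y z.
Proof.
rewrite /killing mulr_sumr -big_split; apply: eq_bigr => i _ /=.
have -> : bracket (c *: x + y) (bracket z (gbasis i)) = c *: bracket x (bracket z (gbasis i)) + bracket y (bracket z (gbasis i)).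
  exact: (bracket_linearl _ c x y).
by rewrite linearD linearZ.
Qed.

Lemma killing_bracket x y z : x \in lieg -> y \in lieg -> z \in lieg ->
  killing (bracket x y) z = killing y (bracket z x).
Proof.
move=> xg yg zg; rewrite !killingE ?bracket_lieg //; congr (_ * _).
exact: trace_bracket_invariant.
Qed.

Lemma evalS_mu x z : x \in lieg -> evalS (muS x) z = killing x z.
Proof.
move=> xg; rewrite -(killing_coord (killingLl z) xg) /evalS /muS raddf_sum.
by apply: eq_bigr => i _; rewrite /= mevalZ mevalXU.
Qed.

Definition evalR z f : C := evalS (repr f) z.

Lemma piRO_eq F G : (piRO F = piRO G) <-> (forall z, Omin z -> evalS F z = evalS G z).
Proof.
have E : (piRO F = piRO G) <-> (F - G \in (@Imin R L)).
  have H := Quotient.idealrBE (@Imin R L : idealr Sg) F G.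
  by split=> [/eqP|]; [rewrite -H | rewrite [_ \in _]H => /eqP].
rewrite E; split=> [/asboolP h z /h|h].
  by rewrite /evalS mevalB => /eqP; rewrite subr_eq0 => /eqP.
by apply/asboolP => z /h; rewrite /evalS mevalB => ->; rewrite subrr.
Qed.

Lemma reprRO f : piRO (repr f) = f. Proof. exact: reprK. Qed.

Lemma evalR_pi z F : Omin z -> evalR z (piRO F) = evalS F z.
Proof. by rewrite /evalR; move: z; apply/piRO_eq; rewrite reprRO. Qed.

Lemma RO_ext f g : (forall z, Omin z -> evalR z f = evalR z g) -> f = g.
Proof. by move=> h; rewrite -(reprRO f) -(reprRO g); apply/piRO_eq. Qed.

Lemma piRO_D F G : piRO (F + G) = piRO F + piRO G. Proof. by rewrite /piRO raddfD. Qed.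
Lemma piRO_M F G : piRO (F * G) = piRO F * piRO G. Proof. by rewrite /piRO rmorphM. Qed.
Lemma piRO_C c : piRO c%:MP = c%:A :> RO.
Proof. by rewrite -[RHS]/(piRO _ * 1) mulr1. Qed.

Lemma RO_ind (P : RO -> Prop) : (forall c, P c%:A) ->
  (forall x, x \in lieg -> P (mu x)) -> (forall f g, P f -> P g -> P (f + g)) ->
  (forall f g, P f -> P g -> P (f * g)) -> forall f, P f.
Proof.
move=> PC PX PD PM f; rewrite -(reprRO f); elim/mpoly_alg_ind: (repr f) => [c|i|p q|p q].
- by rewrite piRO_C.
- have -> : 'X_i = muS (gbasis i) :> Sg.
    rewrite /muS (bigD1 i) //= big1 => [|j ji]; rewrite coord_free ?(basis_free (vbasisP _)) //.
      by rewrite eqxx scale1r addr0.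
    by rewrite eq_sym (negPf ji) scale0r.
  exact/PX/gbasis_in.
- by rewrite piRO_D; exact: PD.
- by rewrite piRO_M; exact: PM.
Qed.
End Func.

(*PART Func2*)
Lemma quad_horner (F : comNzRingType) (a b c s : F) :
  (a%:P + 'X * b%:P - 'X^2 * c%:P).[s] = a + s * b - s ^+ 2 * c.
Proof. by rewrite !hornerE. Qed.

Lemma quad_coef1 (F : comNzRingType) (a b c : F) :
  (a%:P + 'X * b%:P - 'X^2 * c%:P)`_1 = b.
Proof. by rewrite coefB coefD coefC coefXM coefXnM !coefC /= subr0 add0r. Qed.

Section Func2.
Variables (R : realType) (L : simple_algebra).
Local Notation C := (complex R).
Local Notation N := (matrix_size L).
Local Notation M := 'M[C]_N.
Local Notation lieg := (lieg R L).
Local Notation RO := (RO R L).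
Local Notation Sg := (Sg R L).
Local Notation d := (\dim lieg).
Implicit Types (x y z Z k : M) (f g : RO) (F G : Sg).

Section Eval.
Variables (z : M) (Oz : Omin z).
Lemma evalRD f g : evalR z (f + g) = evalR z f + evalR z g.
Proof. by rewrite -(reprRO f) -(reprRO g) -piRO_D !evalR_pi // /evalS mevalD. Qed.
Lemma evalRM f g : evalR z (f * g) = evalR z f * evalR z g.
Proof. by rewrite -(reprRO f) -(reprRO g) -piRO_M !evalR_pi // /evalS mevalM. Qed.
Lemma evalRA c : evalR z c%:A = c.
Proof. by rewrite -piRO_C evalR_pi // /evalS mevalC. Qed.
Lemma evalR1 : evalR z 1 = 1.
Proof. by have := evalRA 1; rewrite scale1r. Qed.
Lemma evalRZ c f : evalR z (c *: f) = c * evalR z f.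
Proof.
have -> : c *: f = c%:A * f by rewrite -scalerAl mul1r.
by rewrite evalRM evalRA.
Qed.
Lemma evalR0 : evalR z 0 = 0.
Proof. by have := evalRA 0; rewrite scale0r. Qed.
Lemma evalRN f : evalR z (- f) = - evalR z f.
Proof. by rewrite -scaleN1r evalRZ mulN1r. Qed.
Lemma evalRB f g : evalR z (f - g) = evalR z f - evalR z g.
Proof. by rewrite evalRD evalRN. Qed.
Lemma evalRX f n : evalR z (f ^+ n) = evalR z f ^+ n.
Proof. by elim: n => [|n IH]; rewrite ?expr0 ?evalR1 // !exprS evalRM IH. Qed.
Lemma evalRMn f n : evalR z (f *+ n) = evalR z f *+ n.
Proof. by rewrite -scaler_nat evalRZ mulr_natl. Qed.
Lemma evalRsum (I : finType) (P : pred I) (h : I -> RO) :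
  evalR z (\sum_(i | P i) h i) = \sum_(i | P i) evalR z (h i).
Proof. by elim/big_rec2: _ => [|i a b _ <-]; rewrite ?evalR0 ?evalRD. Qed.
Lemma evalR_mu x : x \in lieg -> evalR z (mu x) = kill_const R L * \tr (x *m z).
Proof.
move=> xg; rewrite /mu evalR_pi // evalS_mu // killingE //.
exact: Omin_in.
Qed.
End Eval.

Lemma mu_linear c x y : mu (c *: x + y) = c *: mu x + mu y :> RO.
Proof.
rewrite /mu -[c *: piRO _]/(piRO _ * piRO _) -piRO_M -piRO_D; congr piRO.
rewrite /muS mulr_sumr -big_split; apply: eq_bigr => i _ /=.
by rewrite linearD linearZ /= scalerDl mul_mpolyC scalerA.
Qed.

Lemma mu0 : mu 0 = 0 :> RO.
Proof. by have := mu_linear (-1) 0 0; rewrite scaler0 addr0 scaleN1r addNr. Qed.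
Lemma muN x : mu (- x) = - mu x :> RO.
Proof. by have := mu_linear (-1) x 0; rewrite mu0 !addr0 !scaleN1r. Qed.

Lemma killing0r x : killing x 0 = 0 :> C.
Proof. by have := killingLr x (-1) 0 0; rewrite scaler0 addr0 mulN1r addNr. Qed.
Lemma killingNr x y : killing x (- y) = - killing x y :> C.
Proof. by have := killingLr x (-1) y 0; rewrite addr0 scaleN1r killing0r addr0 mulN1r. Qed.
Lemma killing0l x : killing 0 x = 0 :> C.
Proof. by have := killingLl x (-1) 0 0; rewrite scaler0 addr0 mulN1r addNr. Qed.
Lemma killingNl x y : killing (- x) y = - killing x y :> C.
Proof. by have := killingLl y (-1) x 0; rewrite addr0 scaleN1r killing0l addr0 mulN1r. Qed.

(* vector fields *)
Lemma tangent Z F z : Z \in lieg -> Omin z -> (forall z, Omin z -> evalS F z = 0) ->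
  \sum_j F^`M(j).@[fun i => killing (gbasis i) z] * killing (bracket Z (gbasis j)) z = 0.
Proof.
move=> Zg Oz F0; have zg := Omin_in Oz; move: Z Zg.
pose S W := \sum_j F^`M(j).@[fun i => killing (gbasis i) z] * killing (bracket W (gbasis j)) z.
apply: (@square_zero_span _ _ (fun W => S W = 0)) => [c x y hx hy|Z Zg ZZ].
  have -> : S (c *: x + y) = c * S x + S y.
    rewrite mulr_sumr -big_split; apply: eq_bigr => j _ /=.
    have -> : bracket (c *: x + y) (gbasis j) = c *: bracket x (gbasis j) + bracket y (gbasis j).
      exact: (bracket_linearl _ c x y).
    by rewrite killingLl mulrDr mulrCA.
  by rewrite hx hy mulr0 addr0.
rewrite /S; move=> {S}.
pose V (j : 'I_d) : {poly C} := (killing (gbasis j) z)%:P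
   + 'X * (killing (gbasis j) (bracket Z z))%:P - 'X^2 * (killing (gbasis j) (Z *m z *m Z))%:P.
have VE (s : C) j : (V j).[s] = killing (gbasis j) (Ad (1%:M + s *: Z) z).
  have -> : Ad (1%:M + s *: Z) z = (- s ^+ 2) *: (Z *m z *m Z) + (s *: bracket Z z + z).
    by rewrite (unipotent_Ad Zg ZZ) scaleNr addrC (addrC z).
  by rewrite /V quad_horner killingLr killingLr mulNr [RHS]addrC [X in X - _ = _]addrC.
have := @curve_tangent _ _ V F.
have -> : (fun j => (V j).[0]) = (fun i => killing (gbasis i) z).
  by apply/funext => j; rewrite VE scale0r addr0 /Ad invmx1 mul1mx mulmx1.
have V1 j : (V j)`_1 = - killing (bracket Z (gbasis j)) z.
  by rewrite killing_bracket ?gbasis_in // (bracketC z) killingNr opprK /V quad_coef1.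
move=> h; apply/eqP; rewrite -oppr_eq0 -sumrN; apply/eqP.
rewrite -[RHS]h; first by apply: eq_bigr => j _; rewrite V1 mulrN.
move=> n; rewrite -[RHS](F0 (Ad (1%:M + n%:R *: Z) z)); last first.
  by apply: Omin_Ad => //; exact: unipotent_group.
by rewrite /evalS; apply: meval_eq => j; rewrite VE.
Qed.

(* value of the bracket *)
Lemma evalS_poisson F G z : evalS (poissonS F G) z =
  \sum_i \sum_j F^`M(i).@[fun i => killing (gbasis i) z] * G^`M(j).@[fun i => killing (gbasis i) z]
     * killing (bracket (gbasis i) (gbasis j)) z.
Proof.
rewrite /poissonS /evalS raddf_sum; apply: eq_bigr => i _.
rewrite raddf_sum; apply: eq_bigr => j _.
by rewrite /= !mevalM -(evalS_mu z (bracket_lieg (gbasis_in i) (gbasis_in j))).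
Qed.

Lemma poissonS_pi F F' G G' : piRO F = piRO F' -> piRO G = piRO G' ->
  piRO (poissonS F G) = piRO (poissonS F' G') :> RO.
Proof.
move=> /piRO_eq hF /piRO_eq hG; apply/piRO_eq => z Oz; rewrite !evalS_poisson.
have tan A A' y : (forall z, Omin z -> evalS A z = evalS A' z) -> y \in lieg ->
  \sum_j A^`M(j).@[fun i => killing (gbasis i) z] * killing (bracket y (gbasis j)) z =
  \sum_j A'^`M(j).@[fun i => killing (gbasis i) z] * killing (bracket y (gbasis j)) z.
  move=> hA yg; apply/eqP; rewrite -subr_eq0 -sumrB; apply/eqP.
  rewrite -[RHS](@tangent y (A - A') z yg Oz).
    by apply: eq_bigr => j _; rewrite mderivB mevalB mulrBl.
  by move=> w Ow; rewrite /evalS mevalB [meval _ A]hA // subrr.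
transitivity (\sum_i \sum_j F^`M(i).@[fun i => killing (gbasis i) z] *
   G'^`M(j).@[fun i => killing (gbasis i) z] * killing (bracket (gbasis i) (gbasis j)) z).
  apply: eq_bigr => i _.
  under eq_bigr do rewrite -mulrA; rewrite -mulr_sumr (tan _ _ _ hG (gbasis_in i)) mulr_sumr.
  by apply: eq_bigr => j _; rewrite mulrA.
rewrite exchange_big [RHS]exchange_big /=; apply: eq_bigr => j _.
have antis A : \sum_i A^`M(i).@[fun i => killing (gbasis i) z] * G'^`M(j).@[fun i => killing (gbasis i) z] * killing (bracket (gbasis i) (gbasis j)) z
  = - G'^`M(j).@[fun i => killing (gbasis i) z] * \sum_i A^`M(i).@[fun i => killing (gbasis i) z] * killing (bracket (gbasis j) (gbasis i)) z.
  rewrite mulr_sumr; apply: eq_bigr => i _; rewrite bracketC.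
  by rewrite killingNl; move: (killing _ _) => c; ring.
by rewrite !antis (tan _ _ _ hF (gbasis_in j)).
Qed.
End Func2.

(*PART Func3*)
Lemma submm n (m : 'X_{1..n}) : (m - m)%MM = 0%MM.
Proof. by apply/mnmP => j; rewrite mnmBE subnn mnm0E. Qed.

Section EulerS.
Variables (F : comNzRingType) (n : nat).
Implicit Type p : {mpoly F[n]}.
Definition eulerS p : {mpoly F[n]} := \sum_j 'X_j * p^`M(j).

Lemma eulerSD p q : eulerS (p + q) = eulerS p + eulerS q.
Proof. by rewrite -big_split; apply: eq_bigr => j _; rewrite mderivD mulrDr. Qed.
Lemma eulerSM p q : eulerS (p * q) = eulerS p * q + p * eulerS q.
Proof.
rewrite mulr_suml mulr_sumr -big_split; apply: eq_bigr => j _ /=.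
by rewrite mderivM; ring.
Qed.
Lemma eulerSC c : eulerS c%:MP = 0.
Proof. by rewrite /eulerS big1 // => j _; rewrite mderivC mulr0. Qed.
Lemma eulerSXU i : eulerS 'X_i = 'X_i.
Proof.
rewrite /eulerS (bigD1 i) //= big1 => [|j ji].
  by rewrite mderivX mnm1E eqxx scale1r submm mpolyX0 mulr1 addr0.
by rewrite mderivX mnm1E eq_sym (negPf ji) scale0r mulr0.
Qed.
Lemma eulerSX m : eulerS 'X_[m] = 'X_[m] *+ mdeg m.
Proof.
rewrite mdegE -sumrMnr; apply: eq_bigr => j _.
rewrite mderivX -scalerAr -mpolyXD scaler_nat.
case: (posnP (m j)) => [->|mj]; first by rewrite !mulr0n.
by congr ('X_[_] *+ _); rewrite addmC submK // lep1mP -lt0n.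
Qed.
Lemma eulerS_homog q p : p \is q.-homog -> eulerS p = p *+ q.
Proof.
move/dhomogP=> hp; rewrite (mpolyE p) -sumrMnl.
rewrite (big_morph eulerS eulerSD (_ : eulerS 0 = 0)); last first.
  by rewrite -mpolyC0 eulerSC.
rewrite big_seq [RHS]big_seq; apply: eq_bigr => m mp.
rewrite -mul_mpolyC eulerSM eulerSC mul0r add0r eulerSX.
by rewrite (hp m mp) mulrnAr.
Qed.
End EulerS.

Section Func3.
Variables (R : realType) (L : simple_algebra).
Local Notation C := (complex R).
Local Notation N := (matrix_size L).
Local Notation M := 'M[C]_N.
Local Notation lieg := (lieg R L).
Local Notation RO := (RO R L).
Local Notation Sg := (Sg R L).
Local Notation d := (\dim lieg).
Local Notation Y := (Ytheta R L).
Implicit Types (x y z Z k : M) (f g : RO) (F G : Sg).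

Definition ham Z f : RO := poisson (mu Z) f.

Lemma ham_pi Z F : ham Z (piRO F) = piRO (poissonS (muS Z) F).
Proof. by rewrite /ham /poisson; apply: poissonS_pi; rewrite reprRO. Qed.

Lemma eulerE f : euler f = piRO (\sum_(i < d) 'X_i * (repr f)^`M(i)).
Proof. by []. Qed.
Lemma actE k f : act k f = piRO (repr f \mPo [tuple muS (Ad k (gbasis i)) | i < d]).
Proof. by []. Qed.
Lemma muE x : mu x = piRO (muS x) :> RO.
Proof. by []. Qed.
Lemma piRO_MnE F n : piRO (F *+ n) = piRO F *+ n.
Proof. by rewrite /piRO raddfMn. Qed.
Lemma piRO_expE F n : piRO (F ^+ n) = piRO F ^+ n.
Proof. by rewrite /piRO rmorphXn. Qed.
Lemma piRO_0E : piRO (0 : Sg) = 0.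
Proof. by rewrite /piRO raddf0. Qed.
Lemma piRO_sumE (I : finType) (h : I -> Sg) : piRO (\sum_i h i) = \sum_i piRO (h i).
Proof. by rewrite /piRO raddf_sum. Qed.
Lemma evalS_act k F z : in_group k -> Omin z ->
  evalS (F \mPo [tuple muS (Ad k (gbasis i)) | i < d]) z = evalS F (Ad (invmx k) z).
Proof.
move=> hk Oz; apply: etrans (comp_mpoly_meval _ _ _) _; apply: meval_eq => i.
have kg := Ad_in hk (gbasis_in i); have zg := Omin_in Oz.
have zg' := Ad_in (group_invmx hk) zg.
rewrite tnth_mktuple [LHS](evalS_mu _ kg) !killingE ?gbasis_in //.
by rewrite trace_Ad ?group_unit.
Qed.

Lemma evalR_act k f z : in_group k -> Omin z ->
  evalR z (act k f) = evalR (Ad (invmx k) z) f.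
Proof.
move=> hk Oz; apply: etrans (congr1 (evalR z) (actE k f)) _.
exact: etrans (evalR_pi _ Oz) (evalS_act _ hk Oz).
Qed.


Definition vfield Z F z : C :=
  \sum_j F^`M(j).@[fun i => killing (gbasis i) z] * killing (bracket Z (gbasis j)) z.

Lemma vfieldD Z F G z : vfield Z (F + G) z = vfield Z F z + vfield Z G z.
Proof.
by rewrite -big_split; apply: eq_bigr => j _; rewrite mderivD mevalD mulrDl.
Qed.

Lemma vfieldM Z F G z :
  vfield Z (F * G) z = vfield Z F z * evalS G z + evalS F z * vfield Z G z.
Proof.
rewrite mulr_suml mulr_sumr -big_split.
apply: eq_bigr => j _ /=; rewrite mderivM mevalD !mevalM mulrDl.
by rewrite mulrAC mulrA.
Qed.

Lemma muS_deriv x i : (muS x : Sg)^`M(i) = (coord (vbasis lieg) i x)%:MP.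
Proof.
rewrite /muS raddf_sum (bigD1 i) //= mderivZ mderivX mnm1E eqxx scale1r submm mpolyX0.
rewrite -mul_mpolyC mulr1 big1 ?addr0 // => k ki.
by rewrite mderivZ mderivX mnm1E (negPf ki) scale0r scaler0.
Qed.

Lemma evalR_ham Z F z : Z \in lieg -> Omin z ->
  evalR z (ham Z (piRO F)) = vfield Z F z.
Proof.
move=> Zg Oz; rewrite ham_pi evalR_pi // evalS_poisson exchange_big /=.
rewrite /vfield; apply: eq_bigr => j _.
pose phi x := killing (bracket x (gbasis j)) z.
rewrite -[X in _ = _ * X](@killing_coord _ _ phi Z _ Zg) ?mulr_sumr.
  by apply: eq_bigr => i _; rewrite muS_deriv mevalC /phi mulrCA mulrA.
move=> c x y; rewrite /phi -killingLl; congr killing.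
exact: (bracket_linearl _ c x y).
Qed.

Lemma piRO_surj f : exists F, f = piRO F.
Proof. by exists (repr f); rewrite reprRO. Qed.

Section Ham.
Variables (Z : M) (Zg : Z \in lieg).

Lemma hamD f g : ham Z (f + g) = ham Z f + ham Z g.
Proof.
have [F ->] := piRO_surj f; have [G ->] := piRO_surj g.
rewrite -(piRO_D F G); apply: RO_ext => z Oz.
apply: etrans (evalR_ham _ Zg Oz) _; apply: etrans (vfieldD _ _ _ _) _; apply/esym.
by apply: etrans (evalRD Oz _ _) _; congr (_ + _); exact: evalR_ham.
Qed.

Lemma hamM f g : ham Z (f * g) = ham Z f * g + f * ham Z g.
Proof.
have [F ->] := piRO_surj f; have [G ->] := piRO_surj g.
rewrite -(piRO_M F G); apply: RO_ext => z Oz.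
apply: etrans (evalR_ham _ Zg Oz) _; apply: etrans (vfieldM _ _ _ _) _; apply/esym.
apply: etrans (evalRD Oz _ _) _; congr (_ + _).
  apply: etrans (evalRM Oz _ _) _; congr (_ * _); first exact: evalR_ham.
  exact: evalR_pi.
apply: etrans (evalRM Oz _ _) _; congr (_ * _); last exact: evalR_ham.
exact: evalR_pi.
Qed.

Lemma hamA c : ham Z c%:A = 0.
Proof.
rewrite -piRO_C; apply: RO_ext => z Oz; rewrite evalR_ham // evalR0 // /vfield big1 // => j _.
by rewrite mderivC meval0 mul0r.
Qed.

Lemma ham0 : ham Z 0 = 0.
Proof. by have := hamA 0; rewrite scale0r. Qed.

Lemma hamZ c f : ham Z (c *: f) = c *: ham Z f.
Proof.
have -> : c *: f = c%:A * f by rewrite -scalerAl mul1r.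
by rewrite hamM hamA mul0r add0r -scalerAl mul1r.
Qed.

Lemma ham_mu x : x \in lieg -> ham Z (mu x) = mu (bracket Z x).
Proof.
move=> xg; apply: RO_ext => z Oz; have Zxg := bracket_lieg Zg xg.
rewrite muE evalR_ham // evalR_pi // evalS_mu //.
pose phi x := killing (bracket Z x) z.
rewrite -[RHS]/(phi x) -(@killing_coord _ _ phi x _ xg); last first.
  by move=> c y y'; rewrite /phi bracketDr (bracketZr _ Z) killingLl.
by rewrite /vfield; apply: eq_bigr => j _; rewrite muS_deriv mevalC.
Qed.

Lemma ham_lowest f : bracket Z Y = 0 -> evalR Y (ham Z f) = 0.
Proof.
move=> ZY; have [F ->] := piRO_surj f; rewrite evalR_ham //; last exact: Omin_Ytheta.
rewrite /vfield big1 // => j _; by rewrite killing_bracket ?gbasis_in ?Y_in // bracketC ZY oppr0 killing0r mulr0.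
Qed.
End Ham.

Lemma bracket_hY : bracket (htheta R L) Y = - Y *+ 2.
Proof.
rewrite /htheta /bracket mulmxBl mulmxBr -mulmxA Ysq mulmx0 sub0r !mulmxA YXY Ysq mul0mx subr0.
by rewrite mulNrn mulr2n opprD.
Qed.

Lemma ham_h f (q : nat) : in_degree q f ->
  evalR Y (ham (htheta R L) f) = (2 * q)%:R * evalR Y f.
Proof.
case=> F hF ->; have OY := Omin_Ytheta R L; rewrite evalR_ham ?h_in // evalR_pi //.
have -> : (2 * q)%:R * evalS F Y = 2 * evalS (eulerS F) Y.
  by rewrite (eulerS_homog hF) /evalS mevalMn; ring.
rewrite /vfield /eulerS /evalS raddf_sum mulr_sumr; apply: eq_bigr => j _.
rewrite killing_bracket ?gbasis_in ?Y_in ?h_in // bracketC bracket_hY mulNrn opprK.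
rewrite /= mevalM mevalXU.
have -> : Y *+ 2 = 1 *: Y + Y by rewrite scale1r mulr2n.
by rewrite killingLr mul1r; move: (killing _ _) (_.@[_]) => a b; ring.
Qed.

(* Euler field *)
Lemma euler_pi F : euler (piRO F) = piRO (eulerS F).
Proof.
have main G : (forall z, Omin z -> evalS G z = 0) -> forall z, Omin z -> evalS (eulerS G) z = 0.
  move=> G0 z Oz.
  pose V (j : 'I_d) : {poly C} := (killing (gbasis j) z)%:P * (1 + 'X).
  have VE (s : C) j : (V j).[s] = killing (gbasis j) z * (1 + s).
    by rewrite /V hornerM hornerC hornerD hornerX -polyC1 hornerC.
  have := @curve_tangent _ _ V G.
  have -> : (fun j => (V j).[0]) = (fun i => killing (gbasis i) z).
    by apply/funext => j; rewrite VE addr0 mulr1.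
  have V1 j : (V j)`_1 = killing (gbasis j) z.
    by rewrite /V coefCM coefD coef1 coefX /=; ring.
  move=> h; rewrite -[RHS]h.
    rewrite /eulerS /evalS raddf_sum; apply: eq_bigr => j _.
    by rewrite V1 /= mevalM mevalXU mulrC.
  move=> n; rewrite -[RHS](G0 (n.+1%:R *: z)); last first.
    by apply: OminZ => //; rewrite pnatr_eq0.
  rewrite /evalS; apply: meval_eq => j; rewrite VE -[_ *: z]addr0 killingLr.
  by rewrite killing0r addr0 mulrC -natr1 addrC.
rewrite eulerE; apply/piRO_eq => z Oz; apply/eqP; rewrite -subr_eq0; apply/eqP.
have -> : evalS (\sum_(i < d) 'X_i * (repr (piRO F))^`M(i)) z - evalS (eulerS F) z
   = evalS (eulerS (repr (piRO F) - F)) z.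
  rewrite /evalS -mevalB; congr meval; rewrite /eulerS -sumrB; apply: eq_bigr => j _.
  by rewrite mderivB mulrBr.
apply: main => // w Ow; rewrite /evalS mevalB.
have /piRO_eq := reprRO (piRO F) => /(_ w Ow); rewrite /evalS => ->; exact: subrr.
Qed.

Lemma eulerD f g : euler (f + g) = euler f + euler g.
Proof.
have [F ->] := piRO_surj f; have [G ->] := piRO_surj g.
by rewrite -(piRO_D F G) !euler_pi eulerSD piRO_D.
Qed.
Lemma eulerM f g : euler (f * g) = euler f * g + f * euler g.
Proof.
have [F ->] := piRO_surj f; have [G ->] := piRO_surj g.
by rewrite -(piRO_M F G) !euler_pi eulerSM piRO_D !piRO_M.
Qed.
Lemma eulerA c : euler (c%:A : RO) = 0.
Proof. by rewrite -piRO_C euler_pi eulerSC piRO_0E. Qed.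
Lemma euler0 : euler (0 : RO) = 0.
Proof. by have := eulerA 0; rewrite scale0r. Qed.
Lemma eulerZ c f : euler (c *: f) = c *: euler f.
Proof.
have -> : c *: f = c%:A * f by rewrite -scalerAl mul1r.
by rewrite eulerM eulerA mul0r add0r -scalerAl mul1r.
Qed.

Lemma euler_degree f (q : nat) : in_degree q f -> euler f = q%:R *: f.
Proof.
case=> F hF ->; rewrite euler_pi (eulerS_homog hF) piRO_MnE.
by rewrite scaler_nat.
Qed.

Lemma euler_mu x : euler (mu x : RO) = mu x.
Proof.
rewrite muE euler_pi; congr piRO; rewrite /muS.
rewrite (big_morph (@eulerS C d) (@eulerSD _ _) (_ : eulerS 0 = 0)); last first.
  by rewrite -mpolyC0 eulerSC.
by apply: eq_bigr => i _; rewrite -mul_mpolyC eulerSM eulerSC eulerSXU mul0r add0r.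
Qed.

Lemma euler_ham Z f : Z \in lieg -> euler (ham Z f) = ham Z (euler f).
Proof.
move=> Zg; elim/RO_ind: f => [c|x xg|f g hf hg|f g hf hg].
- by rewrite hamA // eulerA ham0 // euler0.
- by rewrite (euler_mu x) (ham_mu Zg xg) (euler_mu (bracket Z x)).
- apply: etrans (congr1 (@euler R L) (hamD Zg f g)) _; apply: etrans (eulerD _ _) _.
  apply/esym; apply: etrans (congr1 (ham Z) (eulerD f g)) _; apply: etrans (hamD Zg _ _) _.
  exact: (congr2 +%R (esym hf) (esym hg)).
apply: etrans (congr1 (@euler R L) (hamM Zg f g)) _; apply: etrans (eulerD _ _) _.
apply: etrans (congr2 +%R (eulerM _ _) (eulerM _ _)) _.
apply/esym; apply: etrans (congr1 (ham Z) (eulerM f g)) _; apply: etrans (hamD Zg _ _) _.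
apply: etrans (congr2 +%R (hamM Zg _ _) (hamM Zg _ _)) _.
apply: etrans (addrACA _ _ _ _) _.
exact: (congr2 (fun a b => a * g + ham Z f * euler g + (euler f * ham Z g + f * b)) (esym hf) (esym hg)).
Qed.

(* degrees *)
Lemma degree_ind (P : RO -> Prop) : (forall f g, P f -> P g -> P (f + g)) ->
  (forall (q : nat) f, in_degree q f -> P f) -> forall f, P f.
Proof.
move=> PD Ph f; rewrite -(reprRO f) (pihomog_partitionE (leqnn (msize (repr f)))).
rewrite piRO_sumE; elim/big_ind: _ => // [|i _].
  by apply: (Ph 0%N); exists 0; rewrite ?dhomog0 // piRO_0E.
by apply: (Ph i); exists (pihomog mdeg i (repr f)) => //; exact: pihomogP.
Qed.

Lemma degree_mul (p q : nat) f g : in_degree p f -> in_degree q g -> in_degree (p + q)%N (f * g).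
Proof.
by move=> [F hF ->] [G hG ->]; exists (F * G); [exact: dhomogM | rewrite piRO_M].
Qed.

Lemma degree_mu x : in_degree 1%N (mu x : RO).
Proof.
exists (muS x); rewrite ?muE // /muS; apply: rpred_sum => i _.
by apply: rpredZ; rewrite dhomogX; apply/eqP; exact: mdeg1.
Qed.

Lemma degreeZ (q : nat) c f : in_degree q f -> in_degree q (c *: f).
Proof.
case=> F hF ->; exists (c *: F); first exact: dhomogZ.
by rewrite -mul_mpolyC piRO_M piRO_C -scalerAl mul1r.
Qed.

Lemma degree_exp (p q : nat) f : in_degree q f -> in_degree (q * p)%N (f ^+ p).
Proof. by case=> F hF ->; exists (F ^+ p); [exact: dhomogMn | rewrite piRO_expE]. Qed.
End Func3.

#[local] Opaque evalR mu ham euler act piRO.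

(*PART Diff*)
Section BinomialPoly.
Variable K : numFieldType.

Definition bin_poly (i : nat) : {poly K} :=
  (i`!)%:R^-1 *: \prod_(j < i) ('X - (j%:R)%:P).

Lemma bin_polyE i p : (bin_poly i).[p%:R] = 'C(p, i)%:R.
Proof.
have ff : (p ^_ i)%:R = \prod_(j < i) (p%:R - j%:R) :> K.
  elim: i => [|i IH]; first by rewrite big_ord0.
  rewrite big_ord_recr /= -IH ffactnSr natrM.
  case: (leqP i p) => ip; first by rewrite natrB.
  by rewrite ffact_small // !mul0r.
rewrite /bin_poly hornerZ horner_prod.
under eq_bigr do rewrite hornerXsubC.
rewrite -ff -bin_ffact natrM mulrC mulfK //.
by rewrite pnatr_eq0 -lt0n fact_gt0.
Qed.
End BinomialPoly.

Section DiffOp.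
Variables (K : numFieldType) (A : comAlgType K).
Implicit Types (D E : A -> A) (a f g : A).

Lemma order_le_poly (ev : A -> K) a g k D :
  (forall f g, ev (f + g) = ev f + ev g) -> (forall f g, ev (f * g) = ev f * ev g) ->
  ev a = 1 -> order_le k D ->
  exists P : {poly K}, forall p : nat, ev (D (a ^+ p * g)) = P.[p%:R].
Proof.
move=> evD evM eva oD.
have evB f h : ev (f - h) = ev f - ev h.
  by apply/eqP; rewrite -(inj_eq (addIr (ev h))) -evD !subrK.
have [c hc] : exists c : nat -> K, forall p,
    ev (D (a ^+ p * g)) = \sum_(i < k.+1) c i * 'C(p, i)%:R.
  elim: k D oD => [|k IH] D oD.
    exists (fun=> ev (D g)) => p; rewrite big_ord1 bin0 mulr1.
    elim: p => [|p IHp]; first by rewrite expr0 mul1r.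
    by rewrite exprS -mulrA oD evM eva mul1r.
  have [c hc] := IH _ (oD a).
  exists (fun i => if i is i'.+1 then c i' else ev (D g)) => p.
  rewrite big_ord_recl bin0 mulr1 /=.
  elim: p => [|p IHp].
    by rewrite expr0 mul1r big1 ?addr0 // => i _; rewrite bin0n mulr0.
  have := hc p; rewrite evB evM eva mul1r mulrA -exprS => /eqP.
  rewrite subr_eq => /eqP ->; rewrite IHp addrCA; congr (_ + _).
  rewrite -big_split; apply: eq_bigr => i _ /=.
  by rewrite binS natrD mulrDr addrC.
exists (\sum_(i < k.+1) c i *: bin_poly K i) => p.
rewrite hc horner_sum; apply: eq_bigr => i _.
by rewrite hornerZ bin_polyE.
Qed.

Lemma diffop_poly (ev : A -> K) a g D :
  (forall f g, ev (f + g) = ev f + ev g) -> (forall f g, ev (f * g) = ev f * ev g) ->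
  ev a = 1 -> diffop D ->
  exists P : {poly K}, forall p : nat, ev (D (a ^+ p * g)) = P.[p%:R].
Proof. by move=> evD evM eva [k [_ oD]]; exact: order_le_poly evD evM eva oD. Qed.

Lemma order_le_ext k D E : D =1 E -> order_le k D -> order_le k E.
Proof. by move/funext ->. Qed.

Lemma order_leD k D E : order_le k D -> order_le k E -> order_le k (fun f => D f + E f).
Proof.
elim: k D E => [|k IH] D E oD oE a; first by move=> f; rewrite oD oE mulrDr.
apply: order_le_ext (IH _ _ (oD a) (oE a)) => f.
by rewrite mulrDr opprD addrACA.
Qed.

Lemma order_leZ k (c : K) D : order_le k D -> order_le k (fun f => c *: D f).
Proof.
elim: k D => [|k IH] D oD a; first by move=> f; rewrite oD scalerAr.
apply: order_le_ext (IH _ (oD a)) => f.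
by rewrite scalerBr scalerAr.
Qed.

Section Derivation.
Variable dl : A -> A.
Hypothesis dlL : linear dl.
Hypothesis dlM : forall f g, dl (f * g) = dl f * g + f * dl g.

Let dlB f g : dl (f - g) = dl f - dl g.
Proof. by have := dlL (-1) g f; rewrite !scaleN1r => h; rewrite addrC h addrC. Qed.

Lemma order_le_comm k D : linear D -> order_le k D ->
  order_le k (fun f => dl (D f) - D (dl f)).
Proof.
have linB E f g : linear E -> E (f - g) = E f - E g.
  by move=> EL; have := EL (-1) g f; rewrite !scaleN1r => h; rewrite addrC h addrC.
have linD E f g : linear E -> E (f + g) = E f + E g.
  by move=> EL; have := EL 1 f g; rewrite !scale1r.
elim: k D => [|k IH] D lD oD a.
  move=> f; rewrite oD !dlM (linD D _ _ lD) !oD mulrBr.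
  by rewrite opprD addrACA subrr add0r.
pose Da f := D (a * f) - a * D f.
have lDa : linear Da.
  move=> c f g; rewrite /Da mulrDr -scalerAr !lD mulrDr -scalerAr.
  by rewrite scalerBr opprD addrACA.
apply: order_le_ext (order_leD (IH _ lDa (oD a)) (order_leZ (-1) (oD (dl a)))) => f.
rewrite /Da dlB !dlM (linD D _ _ lD) scaleN1r.
by move: (dl _) (D (dl a * f)) (D (a * dl f)) (dl (D f)) (D (dl f)) => u v w x y; ring.
Qed.

Lemma diffop_comm D : diffop D -> diffop (fun f => dl (D f) - D (dl f)).
Proof.
case=> k [lD oD]; exists k; split; last exact: order_le_comm.
move=> c f g; rewrite lD !dlL lD scalerBr opprD addrACA.
by [].
Qed.
End Derivation.

Lemma diffopZ (c : K) D : diffop D -> diffop (fun f => c *: D f).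
Proof.
case=> k [lD oD]; exists k; split; last exact: order_leZ.
by move=> c' f g; rewrite lD scalerDr !scalerA mulrC.
Qed.
End DiffOp.

(*PART Family*)
Section Coord.
Variables (R : realType) (L : simple_algebra).
Local Notation C := (complex R).
Local Notation N := (matrix_size L).
Local Notation M := 'M[C]_N.
Local Notation lieg := (lieg R L).
Local Notation RO := (RO R L).
Local Notation X := (Xtheta R L).
Local Notation Y := (Ytheta R L).
Local Notation kc := (kill_const R L).
Local Notation i0 := (idx0 L).
Local Notation i1 := (idx1 L).
Local Notation r0 := (rev_ord i0).
Local Notation r1 := (rev_ord i1).
Implicit Types (x y z Z : M) (f g : RO).

Definition tau x : RO := kc^-1 *: mu (lproj x).
Definition zeta (i j : 'I_N) : RO := tau (delta_mx j i).

Lemma tau_linear c x y : tau (c *: x + y) = c *: tau x + tau y.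
Proof.
rewrite /tau linearP /=; apply: etrans (congr1 _ (mu_linear _ _ _)) _.
by rewrite scalerDr !scalerA mulrC.
Qed.

Lemma tau0 : tau 0 = 0.
Proof. by have := tau_linear (-1) 0 0; rewrite scaler0 addr0 scaleN1r addNr. Qed.
Lemma tauZ c x : tau (c *: x) = c *: tau x.
Proof. by rewrite -[c *: x]addr0 tau_linear tau0 addr0. Qed.
Lemma tauD x y : tau (x + y) = tau x + tau y.
Proof. by rewrite -{1}(scale1r x) tau_linear scale1r. Qed.
Lemma tauN x : tau (- x) = - tau x.
Proof. by rewrite -scaleN1r tauZ scaleN1r. Qed.
Lemma tauB x y : tau (x - y) = tau x - tau y.
Proof. by rewrite tauD tauN. Qed.
Lemma mu_tau x : mu (lproj x) = kc *: tau x.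
Proof. by rewrite /tau scalerA mulfV ?kill_const_neq0 // scale1r. Qed.

Lemma ham_tau Z x : Z \in lieg -> ham Z (tau x) = tau (bracket Z x).
Proof.
move=> Zg; apply: etrans (hamZ Zg _ _) _; congr (_ *: _).
apply: etrans (ham_mu Zg (lproj_in _)) _; congr mu.
by rewrite lproj_bracket.
Qed.

Lemma evalR_tau z x : Omin z -> evalR z (tau x) = \tr (x *m z).
Proof.
move=> Oz; apply: etrans (evalRZ Oz _ _) _.
apply: etrans (congr1 _ (evalR_mu Oz (lproj_in _))) _.
by rewrite trace_lproj ?Omin_in // mulKf ?kill_const_neq0.
Qed.

Lemma evalR_zeta z i j : Omin z -> evalR z (zeta i j) = z i j.
Proof. by move=> Oz; rewrite (evalR_tau _ Oz) mxtrace_delta_mulmx. Qed.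

Lemma degree_tau x : in_degree 1%N (tau x).
Proof.
exact: degreeZ (degree_mu _).
Qed.

Lemma lproj_antitr x : is_sl L = false -> lproj (antitr x) = - lproj x.
Proof. by move=> slL; rewrite /lproj slL antitrK -scalerN opprB. Qed.

Lemma half_RO f : f + f = 0 -> f = 0.
Proof.
move=> h; have : 2^-1 *: (f + f) = f by rewrite half_double.
by rewrite h scaler0.
Qed.

(* relations *)
Lemma zeta_minor : is_sl L -> forall i j k m : 'I_N,
  zeta i j * zeta k m = zeta i m * zeta k j.
Proof.
move=> slL i j k m; apply: RO_ext => z Oz.
apply: etrans (evalRM Oz _ _) _.
apply: etrans (congr2 *%R (evalR_zeta i j Oz) (evalR_zeta k m Oz)) _.
apply/esym; apply: etrans (evalRM Oz _ _) _.
apply: etrans (congr2 *%R (evalR_zeta i m Oz) (evalR_zeta k j Oz)) _.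
by have [a [b E]] := Omin_sl slL Oz; rewrite !E; ring.
Qed.

Lemma zeta_trace : is_sl L -> \sum_k zeta k k = 0.
Proof.
move=> slL; apply: RO_ext => z Oz; rewrite (evalR0 Oz).
apply: etrans (evalRsum Oz _ _) _.
rewrite (eq_bigr (fun k => z k k)) => [|k _]; last exact: evalR_zeta.
by have := Omin_in Oz; rewrite in_lieg slL => /eqP.
Qed.

Definition chi (i j : 'I_N) : RO := zeta i (rev_ord j).

Lemma evalR_chi z i j : Omin z -> evalR z (chi i j) = z i (rev_ord j).
Proof. exact: evalR_zeta. Qed.

Lemma chi_anti : is_sl L = false -> forall i j, chi i j = - chi j i.
Proof.
move=> slL i j; apply: RO_ext => z Oz; apply/esym; apply: etrans (evalRN Oz _) _.
apply: etrans (congr1 -%R (evalR_chi j i Oz)) _; apply/esym; apply: etrans (evalR_chi i j Oz) _.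
by have [u [v E]] := Omin_so slL Oz; rewrite !E; ring.
Qed.

Lemma evalR_chi2 z i j k m : Omin z ->
  evalR z (chi i j * chi k m) = z i (rev_ord j) * z k (rev_ord m).
Proof.
move=> Oz; apply: etrans (evalRM Oz _ _) _.
exact: (congr2 (fun a b : C => a * b) (evalR_chi i j Oz) (evalR_chi k m Oz)).
Qed.

Lemma chi_plucker : is_sl L = false -> forall i j k m,
  chi i j * chi k m - chi i k * chi j m + chi i m * chi j k = 0.
Proof.
move=> slL i j k m; apply: RO_ext => z Oz; apply/esym; apply: etrans (evalR0 Oz) _; apply/esym.
apply: etrans (evalRD Oz _ _) _.
apply: etrans (congr2 +%R (evalRB Oz _ _) (evalR_chi2 i m j k Oz)) _.
apply: etrans (congr2 (fun a b => a - b + _) (evalR_chi2 i j k m Oz) (evalR_chi2 i k j m Oz)) _.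
by have [u [v E]] := Omin_so slL Oz; rewrite !E; ring.
Qed.

Lemma chi_isotropic : is_sl L = false -> forall i j, \sum_k chi i k * chi j (rev_ord k) = 0.
Proof.
move=> slL i j; apply: RO_ext => z Oz; apply/esym; apply: etrans (evalR0 Oz) _; apply/esym.
apply: etrans (evalRsum Oz _ _) _.
have zz : \sum_k z i k * z k (rev_ord j) = 0.
  by have := Omin_sq Oz => /matrixP /(_ i (rev_ord j)); rewrite !mxE.
have E k : evalR z (chi i k * chi j (rev_ord k)) = - (z i (rev_ord k) * z (rev_ord k) (rev_ord j)).
  apply: etrans (evalR_chi2 i k j (rev_ord k) Oz) _.
  rewrite -mulrN; congr (_ * _); rewrite rev_ordK; exact: (so_entry slL (Omin_in Oz) j k).
apply: etrans (eq_bigr _ (fun k _ => E k)) _.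
rewrite sumrN; apply/eqP; rewrite oppr_eq0; apply/eqP.
by rewrite -[RHS]zz [RHS](reindex_inj rev_ord_inj).
Qed.
End Coord.

(*PART Fam2*)
Section Fam.
Variables (R : realType) (L : simple_algebra).
Local Notation C := (complex R).
Local Notation N := (matrix_size L).
Local Notation M := 'M[C]_N.
Local Notation lieg := (lieg R L).
Local Notation RO := (RO R L).
Local Notation X := (Xtheta R L).
Local Notation Y := (Ytheta R L).
Local Notation kc := (kill_const R L).
Local Notation i0 := (idx0 L).
Local Notation i1 := (idx1 L).
Local Notation r0 := (rev_ord i0).
Local Notation r1 := (rev_ord i1).
Local Notation zt := (@zeta R L).
Local Notation ch := (@chi R L).
Implicit Types (x y z Z : M) (f g : RO).

Lemma bracketBl x y z : bracket (x - y) z = bracket x z - bracket y z.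
Proof. by rewrite /bracket mulmxBl mulmxBr opprD addrACA -opprD. Qed.

Lemma bracket_delta (i j v u : 'I_N) :
  bracket (delta_mx i j) (delta_mx v u) =
  (if j == v then delta_mx i u else 0) - (if u == i then delta_mx v j else 0) :> M.
Proof.
by rewrite /bracket !mul_delta_mx_cond; do 2![case: eqP => _]; rewrite ?mulr0n ?mulr1n.
Qed.

Record lie_family (B : M -> RO -> RO) : Prop := LieFamily {
  fam_linx : forall (c : C) x y f, x \in lieg -> y \in lieg ->
    B (c *: x + y) f = c *: B x f + B y f;
  fam_add : forall x f g, x \in lieg -> B x (f + g) = B x f + B x g;
  fam_equiv : forall Z x f, Z \in lieg -> x \in lieg ->
    ham Z (B x f) = B (bracket Z x) f + B x (ham Z f)
}.

Section Ker.
Variables (B : M -> RO -> RO) (FB : lie_family B).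
Definition lowval x f : C := evalR Y (B (lproj x) f).

Lemma lowval_linear c x y f : lowval (c *: x + y) f = c * lowval x f + lowval y f.
Proof.
rewrite /lowval linearP /=.
apply: etrans (congr1 (evalR Y) (fam_linx FB c f (lproj_in x) (lproj_in y))) _.
apply: etrans (evalRD (Omin_Ytheta R L) _ _) _.
by congr (_ + _); exact: evalRZ (Omin_Ytheta R L) _ _.
Qed.

Lemma lowval_add x f g : lowval x (f + g) = lowval x f + lowval x g.
Proof.
apply: etrans (congr1 (evalR Y) (fam_add FB f g (lproj_in x))) _.
exact: evalRD (Omin_Ytheta R L) _ _.
Qed.

Lemma lowval0 f : lowval 0 f = 0.
Proof. by have := lowval_linear (-1) 0 0 f; rewrite scaler0 addr0 mulN1r addNr. Qed.
Lemma lowvalZ c x f : lowval (c *: x) f = c * lowval x f.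
Proof. by rewrite -[c *: x]addr0 lowval_linear lowval0 addr0. Qed.
Lemma lowvalD x y f : lowval (x + y) f = lowval x f + lowval y f.
Proof. by rewrite -{1}(scale1r x) lowval_linear mul1r. Qed.
Lemma lowvalN x f : lowval (- x) f = - lowval x f.
Proof. by rewrite -scaleN1r lowvalZ mulN1r. Qed.
Lemma lowvalB x y f : lowval (x - y) f = lowval x f - lowval y f.
Proof. by rewrite lowvalD lowvalN. Qed.

Lemma lowval_ham Z x f : Z \in lieg -> bracket Z Y = 0 ->
  lowval x (ham Z f) = - lowval (bracket Z x) f.
Proof.
move=> Zg ZY; have := ham_lowest Zg (B (lproj x) f) ZY.
move/(etrans (esym (congr1 (evalR Y) (fam_equiv FB f Zg (lproj_in x))))).
move/(etrans (esym (evalRD (Omin_Ytheta R L) _ _))).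
rewrite -(lproj_bracket _ Zg) -/(lowval _ _) -/(lowval _ _) => /eqP.
by rewrite addrC addr_eq0 => /eqP.
Qed.

Lemma lowval_subg f g x : lowval x (f - g) = lowval x f - lowval x g.
Proof. by apply/eqP; rewrite eq_sym subr_eq -lowval_add subrK. Qed.

Definition lowval_map x : {additive RO -> C} := HB.pack (lowval x)
  (GRing.isZmodMorphism.Build _ _ (lowval x) (fun f g => lowval_subg f g x)).

Lemma lowval_id x f : x \in lieg -> lowval x f = evalR Y (B x f).
Proof. by move=> xg; rewrite /lowval lproj_id. Qed.

Section Sl.
Hypothesis slL : is_sl L.
Let ham_delta_zeta (i j u v : 'I_N) : i != j -> ham (lproj (delta_mx i j)) (zt u v) =
    (if v == j then zt u i else 0) - (if u == i then zt j v else 0).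
Proof.
move=> ij; apply: etrans (ham_tau _ (lproj_in _)) _.
rewrite (lproj_delta_sl _ slL ij) bracket_delta; apply: etrans (tauB _ _) _.
by rewrite (eq_sym v); do 2![case: eqP => _]; rewrite ?tau0.
Qed.

Let lowval_delta_ham (i j u v : 'I_N) f : i != j -> i != i0 -> j != r0 ->
  lowval_map (delta_mx v u) (ham (lproj (delta_mx i j)) f) =
    (if u == i then lowval_map (delta_mx v j) f else 0) - (if v == j then lowval_map (delta_mx i u) f else 0).
Proof.
move=> ij ii jr; rewrite /= lowval_ham ?lproj_in //; last first.
  rewrite (lproj_delta_sl _ slL ij) /Ytheta /Xtheta slL trmx_delta bracket_delta.
  by rewrite (negPf jr) eq_sym (negPf ii) subr0.
rewrite (lproj_delta_sl _ slL ij) bracket_delta lowvalB opprB.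
by rewrite (eq_sym v); do 2![case: eqP => _]; rewrite ?lowval0.
Qed.

Let ends : i0 != r0. Proof. by rewrite ends_neq. Qed.

Lemma sl_eta p :
  lowval X (zt r0 i0 ^+ p.+1 * zt i0 r0)
    * (p.+2 * (2 * p.+1 + N.-2 + 1) * (p.+2 * (2 * p.+2 + N.-2)))%:R
  = lowval Y (zt r0 i0 ^+ p.+2) * (2 * p.+1 ^ 2 + (2 * N.-2 + 4) * p.+1 + (N.-2 + 1) * (N.-2 + 2))%:R.
Proof.
have := @K_eta_sl C RO N i0 r0 (zt) (fun i j => ham (lproj (delta_mx i j)))
  (fun u v => lowval_map (delta_mx v u)) ends (zeta_minor R slL) (zeta_trace R slL)
  (fun i j => hamD (lproj_in _)) (fun i j => hamM (lproj_in _)) ham_delta_zeta lowval_delta_ham p.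
by rewrite /Ytheta /Xtheta slL trmx_delta.
Qed.

Let mid1 : (i1 != i0) && (i1 != r0).
Proof. by rewrite -!val_eqE /=; have := size_gt2 L; lia. Qed.

Lemma sl_minor p :
  (lowval (delta_mx r0 i1) (zt r0 i0 ^+ p * zt r0 i1)
   + lowval (delta_mx i1 r0) (zt r0 i0 ^+ p * zt i1 r0)
   - lowval (delta_mx r0 r0) (zt r0 i0 ^+ p * zt i1 i1)
   - lowval (delta_mx i1 i1) (zt r0 i0 ^+ p * zt r0 r0))
    * (p.+1 ^ 2 * (2 * p.+1 + N.-2))%:R
  = lowval Y (zt r0 i0 ^+ p.+1) * ((p + 2) * (2 * p.+1 + N.-2 + 1))%:R.
Proof.
have := @K_minor C RO N i0 r0 (zt) (fun i j => ham (lproj (delta_mx i j)))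
  (fun u v => lowval_map (delta_mx v u)) ends (zeta_minor R slL) (zeta_trace R slL)
  (fun i j => hamD (lproj_in _)) (fun i j => hamM (lproj_in _)) ham_delta_zeta lowval_delta_ham i1 p mid1.
by rewrite /Ytheta /Xtheta slL trmx_delta.
Qed.
End Sl.

Section So.
Hypothesis soL : is_sl L = false.
Definition so_rot (i j : 'I_N) : M := -2 *: lproj (delta_mx i j).

Lemma so_rot_in i j : so_rot i j \in lieg.
Proof. by rewrite rpredZ // lproj_in. Qed.

Lemma so_rotE i j : so_rot i j = delta_mx (rev_ord j) (rev_ord i) - delta_mx i j.
Proof.
rewrite /so_rot /lproj soL antitr_delta scalerA mulNr mulfV ?pnatr_eq0 //.
by rewrite scaleN1r opprB.
Qed.

Lemma bracket_rot (i j v u : 'I_N) : bracket (so_rot i j) (delta_mx (rev_ord v) u) =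
  ((if u == i then delta_mx (rev_ord v) j else 0)
   - (if u == rev_ord j then delta_mx (rev_ord v) (rev_ord i) else 0))
 + ((if v == i then delta_mx (rev_ord j) u else 0)
   - (if v == rev_ord j then delta_mx i u else 0)).
Proof.
have -> : bracket (so_rot i j) (delta_mx (rev_ord v) u) =
    bracket (delta_mx (rev_ord j) (rev_ord i)) (delta_mx (rev_ord v) u)
    - bracket (delta_mx i j) (delta_mx (rev_ord v) u).
  by rewrite so_rotE; exact: bracketBl.
rewrite !bracket_delta (inj_eq rev_ord_inj) (eq_sym i) (eq_sym j) (can2_eq rev_ordK rev_ordK).
have aux (V : zmodType) (a b c e : V) : a - b - (c - e) = e - b + (a - c).
  by rewrite opprB addrACA [RHS]addrACA (addrC a) (addrC (- b)).
exact: aux.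
Qed.

Lemma ham_rot_chi (i j u v : 'I_N) : ham (so_rot i j) (ch u v) =
    (if u == i then ch j v else 0) - (if u == rev_ord j then ch (rev_ord i) v else 0)
  + ((if v == i then ch u j else 0) - (if v == rev_ord j then ch u (rev_ord i) else 0)).
Proof.
apply: etrans (ham_tau _ (so_rot_in _ _)) _.
rewrite bracket_rot; apply: etrans (tauD _ _) _.
apply: etrans (congr2 +%R (tauB _ _) (tauB _ _)) _.
by do 4![case: eqP => _]; rewrite ?tau0 /chi ?rev_ordK.
Qed.

Let lowval_rot_ham (i j u v : 'I_N) f : lowering r1 r0 i j ->
  lowval_map (delta_mx (rev_ord v) u) (ham (so_rot i j) f) = -
   ((if u == i then lowval_map (delta_mx (rev_ord v) j) f else 0)
     - (if u == rev_ord j then lowval_map (delta_mx (rev_ord v) (rev_ord i)) f else 0)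
  + ((if v == i then lowval_map (delta_mx (rev_ord j) u) f else 0)
     - (if v == rev_ord j then lowval_map (delta_mx (rev_ord (rev_ord i)) u) f else 0))).
Proof.
move=> lij; rewrite /= lowval_ham ?so_rot_in //; last first.
  move: lij; rewrite /lowering YthetaE soL so_rotE !rev_ordK => /orP[/eqP[-> ->]|].
    by rewrite rev_ordK -opprB /bracket mulNmx mulmxN subrr.
  rewrite !inE !negb_or => /andP[ii /and4P[j1 j2 j3 j4]].
  have E (u' v' : 'I_N) : (rev_ord u' == v') = (u' == rev_ord v') by rewrite (can2_eq rev_ordK rev_ordK).
  rewrite /bracket !mulmxBl !mulmxBr !mul_delta_mx_cond.
  rewrite !E (negPf j1) (negPf j2) (eq_sym _ (rev_ord j)) (eq_sym _ (rev_ord j)) !E.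
  have/orP[/eqP->|/eqP->] := ii; rewrite ?rev_ordK ?(eq_sym i0 j) ?(eq_sym i1 j) ?(negPf j1) ?(negPf j2) ?(negPf j3) ?(negPf j4)
    ?(corners_neq soL, ends_neq) ?mulr0n ?subrr //.
rewrite bracket_rot lowvalD !lowvalB.
by do 4![case: eqP => _]; rewrite ?lowval0 ?rev_ordK.
Qed.

Let corners : uniq [:: r1; r0; rev_ord r1; rev_ord r0].
Proof.
by rewrite /= !rev_ordK !inE !negb_or !(corners_neq soL, ends_neq).
Qed.

Let twoC (c : C) : c + c = 0 -> c = 0.
Proof. by move/eqP; rewrite -mulr2n mulrn_eq0 /= => /eqP. Qed.

Let lowval_anti (i j : 'I_N) f :
  lowval_map (delta_mx (rev_ord j) i) f = - lowval_map (delta_mx (rev_ord i) j) f.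
Proof.
rewrite /= -[delta_mx (rev_ord i) j]antitrK antitr_delta rev_ordK /lowval.
by rewrite (lproj_antitr _ soL) -(raddfN (@lproj R L)) -/(lowval (- _) f) lowvalN opprK.
Qed.


Lemma lowval_congr x y f : lproj x = lproj y -> lowval x f = lowval y f.
Proof. by rewrite /lowval => ->. Qed.

Lemma lowval_ab f : lowval (delta_mx (rev_ord r0) r1) f = 2^-1 * lowval X f.
Proof.
rewrite -lowvalZ; apply: lowval_congr; rewrite [RHS]lproj_id; last by rewrite rpredZ // Xtheta_in.
by rewrite /lproj soL /Xtheta soL antitr_delta !rev_ordK.
Qed.

Lemma lowval_a'b' f : lowval (delta_mx (rev_ord (rev_ord r0)) (rev_ord r1)) f = - (2^-1 * lowval Y f).
Proof.
rewrite -lowvalZ -lowvalN; apply: lowval_congr.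
rewrite [RHS]lproj_id; last by rewrite rpredN rpredZ // Y_in.
by rewrite /lproj soL YthetaE soL antitr_delta !rev_ordK -scalerN opprB.
Qed.

Lemma so_eta p :
  lowval X (ch r1 r0 ^+ p * ch (rev_ord r1) (rev_ord r0))
    * ((2 * p + (N - 4) + 1) * (p.+2 * (p.+1 * (2 * p + (N - 4)))))%:R
  = - lowval Y (ch r1 r0 ^+ p.+1) * (2 * (p ^ 2 + (N - 4 + 2) * p + (N - 4) * (N - 4 + 1)))%:R.
Proof.
have := @K_eta_so C RO N r1 r0 ch (fun i j => ham (so_rot i j))
  (fun u v => lowval_map (delta_mx (rev_ord v) u)) corners (@half_RO R L) twoC
  (@chi_anti R L soL) (@chi_plucker R L soL) (@chi_isotropic R L soL)
  (fun i j => hamD (so_rot_in _ _)) (fun i j => hamM (so_rot_in _ _))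
  (fun i j u v _ _ => ham_rot_chi i j u v) lowval_anti lowval_rot_ham p.
rewrite /= lowval_ab lowval_a'b' -mulrN -!mulrA => /(congr1 (fun c => 2 * c)).
by rewrite !mulVKf ?pnatr_eq0.
Qed.

Local Notation ks u v := (lowval (delta_mx (rev_ord v) u)).
Local Notation a := r1.
Local Notation b := r0.
Local Notation "i ^!" := (rev_ord i) (at level 1, format "i ^!").

Lemma so_quadric p :
  (\sum_(l | l \notin [:: a; b; a^!; b^!])
     (ks a l (ch a b ^+ p * ch a^! l^!) + ks a^! l^! (ch a b ^+ p * ch a l))
   - (ks a a^! (ch a b ^+ p * (ch a a^! - ch b b^!)) + ks a a^! (ch a b ^+ p * ch a a^!)
      - ks b b^! (ch a b ^+ p * ch a a^!))
   - (ks a b^! (ch a b ^+ p * ch b a^!) + ks b a^! (ch a b ^+ p * ch a b^!)) *+ 2)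
  * (p.+2 * (p.+1 * (2 * p + (N - 4))))%:R
  = - (2^-1 * lowval Y (ch a b ^+ p.+1)) * ((N - 4) * (2 * p + (N - 4) + 3) * (p + 4))%:R.
Proof.
have := @K_quadric C RO N r1 r0 ch (fun i j => ham (so_rot i j))
  (fun u v => lowval_map (delta_mx (rev_ord v) u)) corners (@half_RO R L) twoC
  (@chi_anti R L soL) (@chi_plucker R L soL) (@chi_isotropic R L soL)
  (fun i j => hamD (so_rot_in _ _)) (fun i j => hamM (so_rot_in _ _))
  (fun i j u v _ _ => ham_rot_chi i j u v) lowval_anti lowval_rot_ham p.
by rewrite -lowval_a'b'.
Qed.
End So.
End Ker.
End Fam.

(*PART Star*)
Section StarProduct.
Variables (K : comNzRingType) (A : comAlgType K).
Variable star : {poly A} -> {poly A} -> {poly A}.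
Hypothesis starl : forall (c : {poly K}) u v w,
  star (map_poly (in_alg A) c * u + v) w = map_poly (in_alg A) c * star u w + star v w.
Hypothesis starr : forall (c : {poly K}) u v w,
  star u (map_poly (in_alg A) c * v + w) = map_poly (in_alg A) c * star u v + star u w.
Hypothesis starA : associative star.
Hypothesis star0 : forall f g, (star f%:P g%:P)`_0 = f * g.

Definition cf p f g : A := (star f%:P g%:P)`_p.

Lemma starDl u v w : star (u + v) w = star u w + star v w.
Proof. by have := starl 1 u v w; rewrite rmorph1 !mul1r. Qed.
Lemma starDr u v w : star u (v + w) = star u v + star u w.
Proof. by have := starr 1 u v w; rewrite rmorph1 !mul1r. Qed.
Lemma star0l u : star 0 u = 0.
Proof. by apply: (addrI (star 0 u)); rewrite -starDl !addr0. Qed.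
Lemma star0r u : star u 0 = 0.
Proof. by apply: (addrI (star u 0)); rewrite -starDr !addr0. Qed.
Lemma starXl u v : star ('X * u) v = 'X * star u v.
Proof.
by have := starl 'X u 0 v; rewrite star0l !addr0 map_polyX.
Qed.
Lemma starXr u v : star u ('X * v) = 'X * star u v.
Proof. by have := starr 'X u v 0; rewrite star0r !addr0 map_polyX. Qed.

Lemma cf_linearl p c f g h : cf p (c *: f + g) h = c *: cf p f h + cf p g h.
Proof.
have := starl c%:P f%:P g%:P h%:P; rewrite map_polyC /= -polyCM -polyCD -scalerAl mul1r.
by rewrite /cf => ->; rewrite coefD coefCM -scalerAl mul1r.
Qed.
Lemma cf_linearr p c f g h : cf p h (c *: f + g) = c *: cf p h f + cf p h g.
Proof.
have := starr c%:P h%:P f%:P g%:P; rewrite map_polyC /= -polyCM -polyCD -scalerAl mul1r.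
by rewrite /cf => ->; rewrite coefD coefCM -scalerAl mul1r.
Qed.

Lemma cf_quadratic f g a b c : star f%:P g%:P = a%:P + b%:P * 'X + c%:P * 'X^2 ->
  cf 1 f g = b /\ cf 2 f g = c.
Proof.
by rewrite /cf => ->; rewrite !(coefD, coefMX, coefMXn, coefC) /= !(addr0, add0r).
Qed.

Section Equivariance.
Variables (m : A) (h : A -> A).
Hypothesis hD : forall f g, h (f + g) = h f + h g.
Hypothesis comm : forall f, star m%:P f%:P - star f%:P m%:P = 'X * (h f)%:P.

Lemma comm_poly u : exists2 v, star m%:P u - star u m%:P = 'X * v & forall n, v`_n = h u`_n.
Proof.
have h0 : h 0 = 0 by apply: (addrI (h 0)); rewrite -hD !addr0.
elim/poly_ind: u => [|u c [v E vE]]; first by exists 0; rewrite ?star0l ?star0r ?subr0 ?mulr0 // => n; rewrite !coef0 h0.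
exists ('X * v + (h c)%:P).
  rewrite mulrC starDl starDr starXl starXr opprD addrACA comm -mulrBr E.
  by rewrite mulrDr.
move=> n; rewrite mulrC !coefD !coefMX !coefC; case: n => [|n] /=; first by rewrite !add0r.
by rewrite !addr0.
Qed.

Lemma cf_derivation p f g : h (cf p f g) = cf p (h f) g + cf p f (h g).
Proof.
have [v E vE] := comm_poly (star f%:P g%:P).
rewrite -[LHS]vE -coefD.
have : 'X * v = 'X * (star (h f)%:P g%:P + star f%:P (h g)%:P).
  rewrite -E mulrDr -starXl -starXr -!comm starDl starDr.
  rewrite (_ : star (- _) _ = - star f%:P (star m%:P g%:P)); last first.
    by apply: (addrI (star (star f%:P m%:P) g%:P)); rewrite -starDl subrr star0l starA subrr.
  rewrite (_ : star _ (- _) = - star f%:P (star g%:P m%:P)); last first.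
    by apply: (addrI (star f%:P (star g%:P m%:P))); rewrite -starDr !subrr star0r.
  by rewrite addrA addrNK !starA.
by move/(congr1 (fun w : {poly A} => w`_p.+1)); rewrite !coefXM.
Qed.
End Equivariance.

Lemma cf_assoc mx my (bx by' lx ly : A -> A) f :
  (forall f, star mx%:P f%:P = (mx * f)%:P + (bx f)%:P * 'X + (lx f)%:P * 'X^2) ->
  (forall f, star my%:P f%:P = (my * f)%:P + (by' f)%:P * 'X + (ly f)%:P * 'X^2) ->
  cf 2 (mx * my) f + cf 1 (bx my) f + lx my * f
  = lx (my * f) + bx (by' f) + mx * ly f.
Proof.
move=> Ex Ey.
have := congr1 (fun w : {poly A} => w`_2) (starA mx%:P my%:P f%:P).
rewrite Ex Ey ![_%:P * 'X]mulrC ![_%:P * 'X^2]mulrC !expr2 -!mulrA.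
rewrite !starDl !starDr !starXl !starXr !Ex.
rewrite !(coefD, coefXM, coefMX, coefMXn, coefC) /= star0 !(addr0, add0r) -!/(cf _ _ _).
by rewrite addrC addrA addrAC => <-; rewrite addrAC.
Qed.

Lemma cf_assoc_symm mx my (bx by' lx ly : A -> A) f :
  (forall f, star mx%:P f%:P = (mx * f)%:P + (bx f)%:P * 'X + (lx f)%:P * 'X^2) ->
  (forall f, star my%:P f%:P = (my * f)%:P + (by' f)%:P * 'X + (ly f)%:P * 'X^2) ->
  bx my = - by' mx ->
  cf 2 (mx * my) f + cf 2 (mx * my) f + (lx my + ly mx) * f
  = lx (my * f) + ly (mx * f) + (bx (by' f) + by' (bx f)) + (mx * ly f + my * lx f).
Proof.
move=> Ex Ey bxy; have H := cf_assoc f Ex Ey; have H' := cf_assoc f Ey Ex.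
have b0 : cf 1 (bx my) f + cf 1 (by' mx) f = 0.
  have := cf_linearl 1 1 (bx my) (by' mx) f; rewrite !scale1r bxy => <-.
  by rewrite addNr /cf polyC0 star0l coef0.
have : cf 2 (mx * my) f + cf 2 (mx * my) f + (lx my + ly mx) * f
   = (cf 2 (mx * my) f + cf 1 (bx my) f + lx my * f)
     + (cf 2 (my * mx) f + cf 1 (by' mx) f + ly mx * f)
     - (cf 1 (bx my) f + cf 1 (by' mx) f).
  by rewrite (mulrC my mx); move: (cf 2 _ f) (cf 1 _ f) (cf 1 _ f) => a b c; ring.
rewrite b0 subr0 H H' => ->.
by move: (lx _) (ly _) (bx _) (by' _) (lx _) (ly _) => a b c d e g; ring.
Qed.
End StarProduct.

(*PART Arith*)
Lemma horner_eq_nat (F : numFieldType) (P Q : {poly F}) :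
  (forall n : nat, P.[n.+1%:R] = Q.[n.+1%:R]) -> forall s, P.[s] = Q.[s].
Proof.
move=> H; suff -> : P = Q by [].
have := @poly0_nat F ((P - Q) * 'X); case: (eqVneq (P - Q) 0) => [/eqP|nz].
  by rewrite subr_eq0 => /eqP.
have h : forall n : nat, ((P - Q) * 'X).[n%:R] = 0.
  by case=> [|n]; rewrite hornerMX ?mulr0 // hornerD hornerN H subrr mul0r.
by move/(_ h)/eqP; rewrite mulf_eq0 polyX_eq0 orbF subr_eq0 => /eqP.
Qed.


Section Arith.
Variables (F : numFieldType) (r : nat) (P : {poly F}).

Lemma sl_star_contradiction (k c0 : F) (b S : nat -> F) :
  (forall n, P.[n.+1%:R] * (n.+2 * (2 * n.+1 + r + 1) * (n.+2 * (2 * n.+2 + r)))%:R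
     = b n * (2 * n.+1 ^ 2 + (2 * r + 4) * n.+1 + (r + 1) * (r + 2))%:R) ->
  (forall n, S n * (n.+2 ^ 2 * (2 * n.+2 + r))%:R = b n * ((n.+1 + 2) * (2 * n.+2 + r + 1))%:R) ->
  (forall n, k * S n = c0 - 4^-1 * n.+1%:R) -> False.
Proof.
move=> HP HS Hk.
have hE := (@hornerZ F, @hornerM F, @hornerD F, @hornerN F, @hornerC F, @hornerX F, @hornerXn F).
pose c : {poly F} := 2%:R *: 'X^2 + (2 * r + 4)%:R *: 'X + ((r + 1) * (r + 2))%:R%:P.
pose lhs := k *: (P * (2%:R *: 'X + (r + 1)%:R%:P) * ('X + 2%:R%:P) * (2%:R *: 'X + (r + 3)%:R%:P)).
have key : forall s, lhs.[s] = ((c0%:P - 4^-1 *: 'X) * c).[s].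
  apply: horner_eq_nat => n; rewrite /lhs /c !hE.
  have D0 : (n.+2 ^ 2 * (2 * n.+2 + r))%:R != 0 :> F by rewrite pnatr_eq0; lia.
  apply: (mulIf D0).
  transitivity (k * (P.[n.+1%:R] * (n.+2 * (2 * n.+1 + r + 1) * (n.+2 * (2 * n.+2 + r)))%:R)
     * ((n.+1 + 2) * (2 * n.+2 + r + 1))%:R); first by ring.
  rewrite HP.
  transitivity (k * (b n * ((n.+1 + 2) * (2 * n.+2 + r + 1))%:R)
    * (2 * n.+1 ^ 2 + (2 * r + 4) * n.+1 + (r + 1) * (r + 2))%:R); first by ring.
  rewrite -HS.
  transitivity (k * S n * (n.+2 ^ 2 * (2 * n.+2 + r))%:R
    * (2 * n.+1 ^ 2 + (2 * r + 4) * n.+1 + (r + 1) * (r + 2))%:R); first by ring.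
  by rewrite Hk; ring.
have c1 (w : nat) : (w == 1) || (w == 3)%N ->
    c.[- (r + w)%:R / 2] = ((r + 1) ^ 2)%:R / 2 :> F.
  by case/orP=> /eqP ->; rewrite /c !hE; field.
have root (w : nat) : (w == 1) || (w == 3)%N -> c0 = - (r + w)%:R / 8.
  move=> hw; have : lhs.[- (r + w)%:R / 2] = 0.
    by case/orP: hw => /eqP ->; rewrite /lhs !hE; field.
  rewrite key hornerM c1 // => /eqP; rewrite mulf_eq0 mulf_eq0 invr_eq0 !pnatr_eq0 /=.
  rewrite [X in _ || X](_ : _ = false) ?orbF; last by lia.
  rewrite !hE => /eqP H.
  have -> : c0 = c0 - 4^-1 * (- (r + w)%:R / 2) + - (r + w)%:R / 8 by field.
  by rewrite H add0r.
have := root 3%N isT; rewrite (root 1%N isT) => /eqP.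
rewrite -subr_eq0 (_ : _ - _ = 4^-1); last by field.
by rewrite invr_eq0 pnatr_eq0.
Qed.

Lemma so_star_contradiction (c0 c1 k : F) (b S : nat -> F) : (1 < r)%N -> c1 != 0 ->
  (forall n, P.[n.+1%:R] * ((2 * n.+1 + r + 1) * (n.+3 * (n.+2 * (2 * n.+1 + r))))%:R
     = - b n * (2 * (n.+1 ^ 2 + (r + 2) * n.+1 + r * (r + 1)))%:R) ->
  (forall n, S n * (n.+3 * (n.+2 * (2 * n.+1 + r)))%:R
     = - (2^-1 * b n) * (r * (2 * n.+1 + r + 3) * (n.+1 + 4))%:R) ->
  (forall n, k * S n = c0 - c1 * n.+1%:R) -> False.
Proof.
move=> r2 c1n HP HS Hk.
have hE := (@hornerZ F, @hornerM F, @hornerD F, @hornerN F, @hornerC F, @hornerX F, @hornerXn F).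
pose c : {poly F} := 'X^2 + (r + 2)%:R *: 'X + (r * (r + 1))%:R%:P.
pose lhs := k *: (P * (2%:R *: 'X + (r + 1)%:R%:P) * r%:R%:P * (2%:R *: 'X + (r + 3)%:R%:P) * ('X + 4%:R%:P)).
have key : forall s, lhs.[s] = (4%:R *: ((c0%:P - c1 *: 'X) * c)).[s].
  apply: horner_eq_nat => n; rewrite /lhs /c !hE.
  have D0 : (n.+3 * (n.+2 * (2 * n.+1 + r)))%:R != 0 :> F by rewrite pnatr_eq0; lia.
  apply: (mulIf D0).
  transitivity (k * (P.[n.+1%:R] * ((2 * n.+1 + r + 1) * (n.+3 * (n.+2 * (2 * n.+1 + r))))%:R)
     * (r * (2 * n.+1 + r + 3) * (n.+1 + 4))%:R); first by ring.
  rewrite HP.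
  transitivity (k * (- (2^-1 * b n) * (r * (2 * n.+1 + r + 3) * (n.+1 + 4))%:R)
    * (4 * (n.+1 ^ 2 + (r + 2) * n.+1 + r * (r + 1)))%:R); first by field.
  rewrite -HS.
  transitivity (k * S n * (n.+3 * (n.+2 * (2 * n.+1 + r)))%:R
    * (4 * (n.+1 ^ 2 + (r + 2) * n.+1 + r * (r + 1)))%:R); first by ring.
  by rewrite Hk; ring.
have cE (w : nat) : (w == 1) || (w == 3)%N ->
    4 * c.[- (r + w)%:R / 2] = (3 * (r ^ 2 - 1))%:R :> F.
  rewrite natrM; have -> : (r ^ 2 - 1)%:R = r%:R ^+ 2 - 1 :> F by rewrite natrB ?natrX // expn_gt0; lia.
  by case/orP=> /eqP ->; rewrite /c !hE; field.
have root (w : nat) : (w == 1) || (w == 3)%N -> c0 = - c1 * (r + w)%:R / 2.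
  move=> hw; have : lhs.[- (r + w)%:R / 2] = 0.
    by case/orP: hw => /eqP ->; rewrite /lhs !hE; field.
  rewrite key hornerZ hornerM mulrCA cE // => /eqP; rewrite mulf_eq0 pnatr_eq0.
  rewrite [X in _ || X](_ : _ = false) ?orbF; last by lia.
  rewrite !hE => /eqP H.
  have -> : c0 = c0 - c1 * (- (r + w)%:R / 2) + - c1 * (r + w)%:R / 2 by field.
  by rewrite H add0r.
have := root 3%N isT; rewrite (root 1%N isT) => /eqP.
rewrite -subr_eq0 (_ : _ - _ = c1); last by field.
by rewrite (negPf c1n).
Qed.
End Arith.

(*PART Arith2*)
Section DivisionArith.
Variables (F : numFieldType) (r m : nat) (A : {poly F}) (nu lam : F) (c : {poly F}).
Hypothesis nu0 : nu != 0.

Let hE := (@hornerZ F, @hornerM F, @hornerD F, @hornerN F, @hornerC F, @hornerX F, @hornerXn F).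

(* the functional equation satisfied by a left divisor *)
Definition division_eq (e w : nat) := forall s : F,
  (s + lam) * A.[s] * ((2 * s + e%:R) * (2 * s + e%:R + 1))
  = nu * ((2 * s + m%:R + 1) * (2 * s + m%:R + w%:R)) * c.[s].

Lemma no_division e w : lam = (m%:R + 1) / 2 -> c.[- e%:R / 2] != 0 -> c.[- (e%:R + 1) / 2] != 0 ->
  division_eq e w -> False.
Proof.
move=> lamE c1 c2 H.
have G s : (A * ((2%:R *: 'X + e%:R%:P) * (2%:R *: 'X + e%:R%:P + 1%:P))).[s]
   = ((2 * nu) *: ((2%:R *: 'X + m%:R%:P + w%:R%:P) * c)).[s].
  move: s; apply: horner_eq_nat => n; rewrite !hE.
  have l0 : n.+1%:R + lam != 0.
    have -> : n.+1%:R + lam = (2 * n.+1 + m + 1)%:R / 2 by rewrite lamE; field.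
    by rewrite mulf_neq0 ?invr_eq0 ?pnatr_eq0 //; lia.
  by apply: (mulfI l0); rewrite [LHS]mulrA H lamE; field.
have root e' : (e' == e) || (e' == e.+1) -> c.[- e'%:R / 2] != 0 -> (e' == m + w)%N.
  move=> he c0; have := G (- e'%:R / 2); rewrite !hE.
  have -> : A.[- e'%:R / 2] * ((2 * (- e'%:R / 2) + e%:R) * (2 * (- e'%:R / 2) + e%:R + 1)) = 0.
    by case/orP: he => /eqP ->; field.
  move/esym/eqP; rewrite !mulf_eq0 (negPf c0) (negPf nu0) pnatr_eq0 /= orbF.
  have -> : 2 * (- e'%:R / 2) + m%:R + w%:R = (m + w)%:R - e'%:R :> F by field.
  by rewrite subr_eq0 eqr_nat eq_sym.
have c2' : c.[- e.+1%:R / 2] != 0 by rewrite -natr1.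
have h1 : e.+1 == (m + w)%N by apply: root c2'; rewrite eqxx orbT.
have h2 : e == (m + w)%N by apply: root c1; rewrite eqxx.
by move: h1; rewrite -(eqP h2) => /eqP; lia.
Qed.

Lemma no_division_succ e w : lam = (m%:R + 3) / 2 ->
  (e == r.+1) && (w == 2) || (e == r) && (w == 0)%N ->
  c.[- e%:R / 2] != 0 -> c.[- (e%:R + 1) / 2] != 0 -> c.[- (r%:R + 3) / 2] != 0 ->
  division_eq e w -> False.
Proof.
move=> lamE ew c1 c2 c3 H.
have root (s : F) : (s + lam) * A.[s] * ((2 * s + e%:R) * (2 * s + e%:R + 1)) = 0 -> c.[s] != 0 ->
    (2 * s + m%:R + 1) * (2 * s + m%:R + w%:R) = 0.
  by rewrite H => /eqP; rewrite mulf_eq0 => /orP[|/eqP -> /eqP //]; rewrite mulf_eq0 (negPf nu0) => /eqP.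
have h1 : (m + 1 == e) || (m + w == e).
  have /root : (- e%:R / 2 + lam) * A.[- e%:R / 2] * ((2 * (- e%:R / 2) + e%:R) * (2 * (- e%:R / 2) + e%:R + 1)) = 0 by field.
  move/(_ c1)/eqP; rewrite mulf_eq0 => /orP[] /eqP h; apply/orP; [left|right];
    by rewrite -(eqr_nat F) -subr_eq0 ?natrD; apply/eqP; rewrite -[RHS]h; field.
have h2 : (m == e) || (m + w == e + 1).
  have /root : (- (e%:R + 1) / 2 + lam) * A.[- (e%:R + 1) / 2] * ((2 * (- (e%:R + 1) / 2) + e%:R) * (2 * (- (e%:R + 1) / 2) + e%:R + 1)) = 0 by field.
  move/(_ c2)/eqP; rewrite mulf_eq0 => /orP[] /eqP h; apply/orP; [left|right];
    by rewrite -(eqr_nat F) -subr_eq0 ?natrD; apply/eqP; rewrite -[RHS]h; field.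
have mr : m = r by lia.
have /root : (- (r%:R + 3) / 2 + lam) * A.[- (r%:R + 3) / 2] * ((2 * (- (r%:R + 3) / 2) + e%:R) * (2 * (- (r%:R + 3) / 2) + e%:R + 1)) = 0.
  by rewrite lamE mr; field.
move/(_ c3); rewrite mr.
case/orP: ew => /andP[_ /eqP ->] /eqP.
  by rewrite (_ : _ * _ = 2); [rewrite pnatr_eq0 | field].
by rewrite (_ : _ * _ = 6); [rewrite pnatr_eq0 | field].
Qed.
End DivisionArith.

Section DivisionCases.
Variables (F : numFieldType) (r m : nat) (A : {poly F}) (nu lam : F) (b kx : nat -> F).
Hypothesis r0 : (0 < r)%N.
Hypothesis nu0 : nu != 0.
Hypothesis kxA : forall n, kx n = (n.+1%:R + lam) * A.[n.+1%:R].
Hypothesis lamE : lam = (m%:R + 1) / 2 \/ lam = (m%:R + 3) / 2.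

Let hE := (@hornerZ F, @hornerM F, @hornerD F, @hornerN F, @hornerC F, @hornerX F, @hornerXn F).
Lemma sl_division_contradiction :
  (forall n, kx n * (n.+2 * (2 * n.+1 + r + 1) * (n.+2 * (2 * n.+2 + r)))%:R
     = b n * (2 * n.+1 ^ 2 + (2 * r + 4) * n.+1 + (r + 1) * (r + 2))%:R) ->
  (forall n, b n = nu * (n.+2%:R * (n.+2%:R + (m%:R - 1) / 2) * n.+2%:R * (n.+2%:R + m%:R / 2))) ->
  False.
Proof.
move=> HK Hb.
pose c : {poly F} := 2%:R *: 'X^2 + (2 * r + 4)%:R *: 'X + ((r + 1) * (r + 2))%:R%:P.
have key : division_eq m A (nu / 4) lam c r.+1 2.
  move=> s.
  suff : forall s, (('X + lam%:P) * A * ((2%:R *: 'X + r.+1%:R%:P) * (2%:R *: 'X + r.+1%:R%:P + 1%:P))).[s]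
    = ((nu / 4) *: ((2%:R *: 'X + m%:R%:P + 1%:P) * (2%:R *: 'X + m%:R%:P + 2%:R%:P) * c)).[s].
    by move/(_ s); rewrite !hE => E; exact: etrans E (mulrA _ _ _).
  apply: horner_eq_nat => n; rewrite !hE -kxA.
  have D0 : (n.+2 * n.+2)%:R != 0 :> F by rewrite pnatr_eq0.
  apply: (mulIf D0); transitivity (kx n * (n.+2 * (2 * n.+1 + r + 1) * (n.+2 * (2 * n.+2 + r)))%:R).
    by ring.
  by rewrite HK Hb; field.
have c1 : c.[- r.+1%:R / 2] != 0.
  rewrite (_ : c.[_] = (r.+1 ^ 2)%:R / 2); first by rewrite mulf_neq0 ?invr_eq0 ?pnatr_eq0.
  by rewrite /c !hE; field.
have c2 : c.[- (r.+1%:R + 1) / 2] != 0.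
  rewrite (_ : c.[_] = (r.+2 * r)%:R / 2); first by rewrite mulf_neq0 ?invr_eq0 ?pnatr_eq0 //; lia.
  by rewrite /c !hE; field.
have c3 : c.[- (r%:R + 3) / 2] != 0.
  rewrite (_ : c.[_] = (r.+1 ^ 2)%:R / 2); first by rewrite mulf_neq0 ?invr_eq0 ?pnatr_eq0.
  by rewrite /c !hE; field.
have nu4 : nu / 4 != 0 by rewrite mulf_neq0 ?invr_eq0 ?pnatr_eq0.
case: lamE => E; first exact: no_division E c1 c2 key.
by apply: no_division_succ E _ c1 c2 c3 key => //; rewrite eqxx.
Qed.

Lemma so_division_contradiction : (1 < r)%N ->
  (forall n, kx n * ((2 * n.+1 + r + 1) * (n.+3 * (n.+2 * (2 * n.+1 + r))))%:R
     = - b n * (2 * (n.+1 ^ 2 + (r + 2) * n.+1 + r * (r + 1)))%:R) ->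
  (forall n, b n = nu * (n.+2%:R * (n.+2%:R + (m%:R - 1) / 2) * (n.+2%:R + 1) * (n.+2%:R - 1 + m%:R / 2))) ->
  False.
Proof.
move=> r1 HK Hb.
pose c : {poly F} := 'X^2 + (r + 2)%:R *: 'X + (r * (r + 1))%:R%:P.
have key : division_eq m A (- nu / 2) lam c r 0.
  move=> s.
  suff : forall s, (('X + lam%:P) * A * ((2%:R *: 'X + r%:R%:P) * (2%:R *: 'X + r%:R%:P + 1%:P))).[s]
    = ((- nu / 2) *: ((2%:R *: 'X + m%:R%:P + 1%:P) * (2%:R *: 'X + m%:R%:P + 0%:R%:P) * c)).[s].
    by move/(_ s); rewrite !hE => E; exact: etrans E (mulrA _ _ _).
  apply: horner_eq_nat => n; rewrite !hE -kxA.
  have D0 : (n.+3 * n.+2)%:R != 0 :> F by rewrite pnatr_eq0.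
  apply: (mulIf D0); transitivity (kx n * ((2 * n.+1 + r + 1) * (n.+3 * (n.+2 * (2 * n.+1 + r))))%:R).
    by ring.
  by rewrite HK Hb; field.
have r2 : (r ^ 2 - 1)%:R = r%:R ^+ 2 - 1 :> F by rewrite natrB ?natrX // expn_gt0; lia.
have c1 : c.[- r%:R / 2] != 0.
  rewrite (_ : c.[_] = (3 * r ^ 2)%:R / 4); first by rewrite mulf_neq0 ?invr_eq0 ?pnatr_eq0 //; lia.
  by rewrite /c !hE; field.
have c2 : c.[- (r%:R + 1) / 2] != 0.
  rewrite (_ : c.[_] = 3 * (r ^ 2 - 1)%:R / 4); first by rewrite !mulf_neq0 ?invr_eq0 ?pnatr_eq0 //; lia.
  by rewrite r2 /c !hE; field.
have c3 : c.[- (r%:R + 3) / 2] != 0.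
  rewrite (_ : c.[_] = 3 * (r ^ 2 - 1)%:R / 4); first by rewrite !mulf_neq0 ?invr_eq0 ?pnatr_eq0 //; lia.
  by rewrite r2 /c !hE; field.
have nu2 : - nu / 2 != 0 by rewrite mulf_neq0 ?oppr_eq0 ?invr_eq0 ?pnatr_eq0.
case: lamE => E; first exact: no_division E c1 c2 key.
by apply: no_division_succ E _ c1 c2 c3 key => //; rewrite eqxx orbT.
Qed.
End DivisionCases.

(*PART Part1*)
Section Part1.
Variables (R : realType) (L : simple_algebra).
Local Notation C := (complex R).
Local Notation N := (matrix_size L).
Local Notation M := 'M[C]_N.
Local Notation lieg := (lieg R L).
Local Notation RO := (RO R L).
Local Notation X := (Xtheta R L).
Local Notation Y := (Ytheta R L).
Local Notation kc := (kill_const R L).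
Implicit Types (x y z Z : M) (f g : RO).

Lemma trace_tau_self w : \tr (w *m Y) = evalR Y (tau w).
Proof. by rewrite (evalR_tau _ (Omin_Ytheta R L)). Qed.

(* second derivative of a power *)
Lemma ham_ham_pow x y g p : x \in lieg -> y \in lieg -> evalR Y g = 1 ->
  evalR Y (ham x (ham y (g ^+ p.+1)))
  = (p.+1 * p)%:R * evalR Y (ham x g) * evalR Y (ham y g) + p.+1%:R * evalR Y (ham x (ham y g)).
Proof.
move=> xg yg w1; have OY := Omin_Ytheta R L.
have E : ham x (ham y (g ^+ p.+1)) =
   (g ^+ p.-1 * ham x g *+ p * ham y g + g ^+ p * ham x (ham y g)) *+ p.+1.
  apply: etrans (congr1 (ham x) (derX (hamM yg) g p.+1)) _.
  apply: etrans (derMn (hamD xg) (hamM xg) _ _) _; congr (_ *+ _).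
  apply: etrans (hamM xg _ _) _.
  exact: (congr1 (fun u : RO => u * ham y g + g ^+ p * ham x (ham y g)) (derX (hamM xg) g p)).
apply: etrans (congr1 (evalR Y) E) _.
apply: etrans (evalRMn OY _ _) _; apply: etrans (congr1 (fun c => c *+ p.+1) (evalRD OY _ _)) _.
have gX k : evalR Y (g ^+ k) = 1 by apply: etrans (evalRX OY _ _) _; rewrite w1 expr1n.
have E1 : evalR Y (g ^+ p.-1 * ham x g *+ p) = evalR Y (ham x g) *+ p.
  apply: etrans (evalRMn OY _ _) _; congr (_ *+ _); apply: etrans (evalRM OY _ _) _.
  by apply: etrans (congr1 (fun a : C => a * _) (gX _)) _; exact: mul1r.
have E3 : evalR Y (g ^+ p.-1 * ham x g *+ p * ham y g)
   = evalR Y (ham x g) *+ p * evalR Y (ham y g).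
  apply: etrans (evalRM OY _ _) _.
  exact: (congr1 (fun a : C => a * _) E1).
have E4 : evalR Y (g ^+ p * ham x (ham y g)) = evalR Y (ham x (ham y g)).
  apply: etrans (evalRM OY _ _) _.
  by apply: etrans (congr1 (fun a : C => a * _) (gX _)) _; exact: mul1r.
apply: etrans (congr2 (fun c c' : C => (c + c') *+ p.+1) E3 E4) _.
have aux (F : comNzRingType) (a b c : F) :
    (a *+ p * b + c) *+ p.+1 = (p.+1 * p)%:R * a * b + p.+1%:R * c by ring.
exact: aux.
Qed.

Variables (star : {poly RO} -> {poly RO} -> {poly RO}) (Lambda : M -> RO -> RO).
Hypothesis gsp : graded_star_product star.
Hypothesis eqv : star_equivariant star.
Hypothesis lam : star_lambda star Lambda.
Local Notation cf := (cf (A := RO) star).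

Let starl := star_linearl gsp.
Let starr := star_linearr gsp.

Lemma Lambda_cf x f : x \in lieg -> Lambda x f = cf 2 (mu x) f.
Proof. by move=> xg; have [_ ->] := cf_quadratic (lam f xg). Qed.

Lemma Lambda_family : lie_family Lambda.
Proof.
split=> [c x y f xg yg|x f g xg|Z x f Zg xg].
- have cxyg : c *: x + y \in lieg by rewrite rpredD ?rpredZ.
  apply: etrans (Lambda_cf _ cxyg) _.
  apply: etrans (congr1 (fun m => cf 2 m f) (mu_linear c x y)) _.
  apply: etrans (cf_linearl starl 2 c (mu x) (mu y) f) _.
  exact: (congr2 (fun a b => c *: a + b) (esym (Lambda_cf f xg)) (esym (Lambda_cf f yg))).
- apply: etrans (Lambda_cf _ xg) _.
  apply: etrans (_ : _ = cf 2 (mu x) (1 *: f + g)) _; first by rewrite scale1r.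
  apply: etrans (cf_linearr starr 2 1 f g (mu x)) _; rewrite scale1r.
  exact: (congr2 +%R (esym (Lambda_cf f xg)) (esym (Lambda_cf g xg))).
apply: etrans (congr1 (ham Z) (Lambda_cf f xg)) _.
apply: etrans (cf_derivation starl starr (star_assoc gsp) (hamD Zg) (fun f => eqv f Zg) 2 (mu x) f) _.
apply: (congr2 +%R); last exact: esym (Lambda_cf _ xg).
apply: etrans (congr1 (fun m => cf 2 m f) (ham_mu Zg xg)) _.
exact: esym (Lambda_cf _ (bracket_lieg Zg xg)).
Qed.

Lemma Lambda_assoc x y f : x \in lieg -> y \in lieg ->
  cf 2 (mu x * mu y) f + cf 2 (mu x * mu y) f + (Lambda x (mu y) + Lambda y (mu x)) * f
  = Lambda x (mu y * f) + Lambda y (mu x * f)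
    + (2^-1 *: ham x (2^-1 *: ham y f) + 2^-1 *: ham y (2^-1 *: ham x f))
    + (mu x * Lambda y f + mu y * Lambda x f).
Proof.
move=> xg yg.
apply: (cf_assoc_symm starl starr (star_assoc gsp) (star_coef0 gsp) f
  (fun f => lam f xg) (fun f => lam f yg)).
rewrite -scalerN; congr (_ *: _).
apply: etrans (ham_mu xg yg) _; apply: etrans (congr1 _ (bracketC x y)) _.
by apply: etrans (muN _) _; apply: (congr1 -%R); exact: esym (ham_mu yg xg).
Qed.

Local Notation lowval := (lowval Lambda).
Definition coef2_val f F : C := evalR Y (cf 2 F f).

Lemma Lambda_linear x : x \in lieg -> linear (Lambda x).
Proof.
move=> xg c f g; apply: etrans (Lambda_cf _ xg) _.
apply: etrans (cf_linearr starr 2 c f g (mu x)) _.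
exact: (congr2 (fun a b => c *: a + b) (esym (Lambda_cf f xg)) (esym (Lambda_cf g xg))).
Qed.

Lemma coef2_val_linear f c F G : coef2_val f (c *: F + G) = c * coef2_val f F + coef2_val f G.
Proof.
have OY := Omin_Ytheta R L.
apply: etrans (congr1 (evalR Y) (cf_linearl starl 2 c F G f)) _.
apply: etrans (evalRD OY _ _) _.
exact: (congr1 (fun a : C => a + _) (evalRZ OY _ _)).
Qed.

Lemma coef2_val0 f : coef2_val f 0 = 0.
Proof. by have := coef2_val_linear f (-1) 0 0; rewrite scaler0 addr0 mulN1r addNr. Qed.
Lemma coef2_valZ f c F : coef2_val f (c *: F) = c * coef2_val f F.
Proof. by rewrite -[c *: F]addr0 coef2_val_linear coef2_val0 addr0. Qed.
Lemma coef2_valD f F G : coef2_val f (F + G) = coef2_val f F + coef2_val f G.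
Proof. by rewrite -{1}(scale1r F) coef2_val_linear mul1r. Qed.
Lemma coef2_valB f F G : coef2_val f (F - G) = coef2_val f F - coef2_val f G.
Proof. by rewrite coef2_valD -scaleN1r coef2_valZ mulN1r. Qed.
Lemma coef2_val_sum f (I : finType) (P : pred I) (h : I -> RO) :
  coef2_val f (\sum_(i | P i) h i) = \sum_(i | P i) coef2_val f (h i).
Proof. by elim/big_rec2: _ => [|i a b _ <-]; rewrite ?coef2_val0 ?coef2_valD. Qed.


Definition ham2_val x y f : C := evalR Y (ham (lproj x) (ham (lproj y) f)).
Definition pair_const x y : C := evalR Y (Lambda (lproj x) (mu (lproj y))).

Lemma pairing x y f : evalR Y f = 1 -> \tr (x *m Y) = 0 -> \tr (y *m Y) = 0 ->
  kc * (lowval x (f * tau y) + lowval y (f * tau x)) + 4^-1 * (ham2_val x y f + ham2_val y x f)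
  = 2 * kc ^+ 2 * coef2_val f (tau x * tau y) + (pair_const x y + pair_const y x).
Proof.
move=> f1 xY yY; have OY := Omin_Ytheta R L.
have xg := lproj_in x; have yg := lproj_in y.
have mu_Y z : \tr (z *m Y) = 0 -> evalR Y (mu (lproj z)) = 0.
  move=> zY; apply: etrans (evalR_mu OY (lproj_in z)) _.
  by rewrite (trace_lproj _ (Y_in _ _)) zY mulr0.
have half2 : 2^-1 * 2^-1 = 4^-1 :> C by rewrite -invfM -natrM.
have kerE u v : evalR Y (Lambda (lproj u) (mu (lproj v) * f)) = kc * lowval u (f * tau v).
  have -> : mu (lproj v) * f = kc *: (f * tau v) + 0.
    have E : mu (lproj v) * f = (kc *: tau v) * f := congr1 (fun m : RO => m * f) (mu_tau v).
    by apply: (etrans E); rewrite -scalerAl mulrC addr0.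
  apply: etrans (congr1 (evalR Y) (Lambda_linear (lproj_in u) _ _ _)) _.
  have L0 : Lambda (lproj u) 0 = 0.
    have := Lambda_linear (lproj_in u) (-1) 0 0.
    by rewrite scaler0 addr0 scaleN1r addNr.
  apply: etrans (congr1 (fun g => evalR Y (kc *: Lambda (lproj u) (f * tau v) + g)) L0) _.
  by rewrite addr0; exact: evalRZ OY _ _.
have sqE : coef2_val f (mu (lproj x) * mu (lproj y)) = kc ^+ 2 * coef2_val f (tau x * tau y).
  have -> : mu (lproj x) * mu (lproj y) = kc ^+ 2 *: (tau x * tau y).
    have E : mu (lproj x) * mu (lproj y) = (kc *: tau x) * (kc *: tau y)
      := congr2 *%R (mu_tau x) (mu_tau y).
    by apply: (etrans E); rewrite -scalerAl -scalerAr scalerA.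
  exact: coef2_valZ.
have adE u v : evalR Y (2^-1 *: ham (lproj u) (2^-1 *: ham (lproj v) f)) = 4^-1 * ham2_val u v f.
  apply: etrans (evalRZ OY _ _) _.
  apply: etrans (congr1 (fun g => 2^-1 * evalR Y g) (hamZ (lproj_in u) _ _)) _.
  by apply: etrans (congr1 (fun c : C => 2^-1 * c) (evalRZ OY _ _)) _; rewrite mulrA half2.
have HL := congr1 (evalR Y) (Lambda_assoc f xg yg).
have E1 : evalR Y (cf 2 (mu (lproj x) * mu (lproj y)) f + cf 2 (mu (lproj x) * mu (lproj y)) f
   + (Lambda (lproj x) (mu (lproj y)) + Lambda (lproj y) (mu (lproj x))) * f)
   = 2 * kc ^+ 2 * coef2_val f (tau x * tau y) + (pair_const x y + pair_const y x).
  apply: etrans (evalRD OY _ _) _.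
  apply: etrans (congr2 (fun a b : C => a + b) (evalRD OY _ _) (evalRM OY _ _)) _.
  apply: etrans (congr2 (fun a b : C => a + a + b) sqE (congr2 (fun a b : C => a * b) (evalRD OY _ _) f1)) _.
  by rewrite mulr1 -mulrA mulr_natl mulr2n.
have mz u g : evalR Y (mu (lproj u)) = 0 -> evalR Y (mu (lproj u) * g) = 0.
  move=> u0; apply: etrans (evalRM OY _ _) _.
  by apply: etrans (congr1 (fun c : C => c * _) u0) _; exact: mul0r.
apply: etrans (etrans (esym HL) E1); apply/esym.
apply: etrans (evalRD OY _ _) _.
apply: etrans (congr2 (fun a b : C => a + b) (evalRD OY _ _) (evalRD OY _ _)) _.
apply: etrans (congr2 (fun a b : C => _ + (a + b)) (mz _ _ (mu_Y _ xY)) (mz _ _ (mu_Y _ yY))) _.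
rewrite !addr0.
apply: etrans (congr2 (fun a b : C => a + b) (evalRD OY _ _) (evalRD OY _ _)) _.
apply: etrans (congr2 (fun a b : C => a + b) (congr2 (fun a b : C => a + b) (kerE x y) (kerE y x))
   (congr2 (fun a b : C => a + b) (adE x y) (adE y x))) _.
by rewrite -!mulrDr.
Qed.
End Part1.

(*PART Part1sl*)
Section Part1sl.
Variables (R : realType) (L : simple_algebra).
Local Notation C := (complex R).
Local Notation N := (matrix_size L).
Local Notation M := 'M[C]_N.
Local Notation lieg := (lieg R L).
Local Notation RO := (RO R L).
Local Notation X := (Xtheta R L).
Local Notation Y := (Ytheta R L).
Local Notation kc := (kill_const R L).
Local Notation i0 := (idx0 L).
Local Notation i1 := (idx1 L).
Local Notation r0 := (rev_ord i0).
Local Notation zt := (@zeta R L).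
Implicit Types (x y z Z : M) (f g : RO).

Variables (star : {poly RO} -> {poly RO} -> {poly RO}) (Lambda : M -> RO -> RO).
Hypothesis gsp : graded_star_product star.
Hypothesis eqv : star_equivariant star.
Hypothesis lam : star_lambda star Lambda.
Hypothesis slL : is_sl L.
Local Notation lowval := (lowval Lambda).

Lemma bracket_lproj_sl x w : bracket (lproj x) w = bracket x w.
Proof. by rewrite /lproj slL bracketBl [bracket _%:M _]bracketC bracket_scalar oppr0 subr0. Qed.

Lemma trace_delta_Y i j : \tr (delta_mx i j *m Y) = (((j == r0) && (i == i0)) : nat)%:R.
Proof. by rewrite mxtrace_delta_mulmx YthetaE slL mxE. Qed.

Let mid1 : ((i1 == i0) = false) * ((i0 == i1) = false) * ((i1 == r0) = false) * ((r0 == i1) = false).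
Proof. by do !split; rewrite -!val_eqE /=; have := size_gt2 L; lia. Qed.

Lemma ham2_val_sl x y p : ham2_val x y (zt r0 i0 ^+ p.+1)
   = (p.+1 * p)%:R * \tr (bracket x (delta_mx i0 r0) *m Y) * \tr (bracket y (delta_mx i0 r0) *m Y)
    + p.+1%:R * \tr (bracket x (bracket y (delta_mx i0 r0)) *m Y).
Proof.
have w1 : evalR Y (zt r0 i0) = 1 by rewrite -trace_tau_self trace_delta_Y !eqxx.
have E z w : evalR Y (ham (lproj z) (tau w)) = \tr (bracket z w *m Y).
  apply: etrans (congr1 (evalR Y) (ham_tau w (lproj_in z))) _.
  by apply: etrans (esym (trace_tau_self _)) _; rewrite bracket_lproj_sl.
apply: etrans (ham_ham_pow p (lproj_in x) (lproj_in y) w1) _.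
apply: etrans (congr2 (fun c c' : C => _ * c * c' + _) (E x _) (E y _)) _.
apply: (congr1 (fun c : C => _ + _ * c)).
apply: etrans (congr1 (fun g => evalR Y (ham (lproj x) g)) (ham_tau _ (lproj_in y))) _.
by apply: etrans (E x _) _; rewrite bracket_lproj_sl.
Qed.

Lemma star_sl : exists c0, forall p,
  kc * (lowval (delta_mx r0 i1) (zt r0 i0 ^+ p.+1 * zt r0 i1)
   + lowval (delta_mx i1 r0) (zt r0 i0 ^+ p.+1 * zt i1 r0)
   - lowval (delta_mx r0 r0) (zt r0 i0 ^+ p.+1 * zt i1 i1)
   - lowval (delta_mx i1 i1) (zt r0 i0 ^+ p.+1 * zt r0 r0)) = c0 - 4^-1 * p.+1%:R.
Proof.
have OY := Omin_Ytheta R L.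
pose c := pair_const Lambda; exists (c (delta_mx r0 i1) (delta_mx i1 r0) + c (delta_mx i1 r0) (delta_mx r0 i1)
  - (c (delta_mx r0 r0) (delta_mx i1 i1) + c (delta_mx i1 i1) (delta_mx r0 r0))) => p.
set f := zt r0 i0 ^+ p.+1.
have f1 : evalR Y f = 1.
  apply: etrans (evalRX OY _ _) _.
  apply: etrans (congr1 (fun c : C => c ^+ _) (esym (trace_tau_self _))) _.
  by rewrite trace_delta_Y !eqxx expr1n.
have P i j k l (a b : C) : i != i0 -> k != i0 ->
   ham2_val (delta_mx i j) (delta_mx k l) f = a -> ham2_val (delta_mx k l) (delta_mx i j) f = b ->
   kc * (lowval (delta_mx i j) (f * zt l k) + lowval (delta_mx k l) (f * zt j i)) + 4^-1 * (a + b)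
   = 2 * kc ^+ 2 * coef2_val star f (zt j i * zt l k)
    + (c (delta_mx i j) (delta_mx k l) + c (delta_mx k l) (delta_mx i j)).
  move=> i_ k_ <- <-; apply: (pairing gsp lam) => //; rewrite trace_delta_Y ?(negPf i_) ?(negPf k_) andbF //.
have b0 z : bracket z 0 = 0 :> M by rewrite /bracket mulmx0 mul0mx subrr.
have bN z w : bracket z (- w) = - bracket z w :> M by rewrite /bracket mulmxN mulNmx opprB opprK addrC.
have trN z : \tr (- z *m Y) = - \tr (z *m Y) by rewrite mulNmx raddfN.
have tr0 : \tr (0 *m Y) = 0 by rewrite mul0mx raddf0.
have A1 : ham2_val (delta_mx r0 i1) (delta_mx i1 r0) f = 0.
  rewrite ham2_val_sl !bracket_delta !(eqxx, mid1, ends_neq) ?(sub0r, subr0, oppr0, b0, bN, trN, tr0).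
  by rewrite !mulr0 addr0.
have A2 : ham2_val (delta_mx i1 r0) (delta_mx r0 i1) f = p.+1%:R.
  rewrite ham2_val_sl !bracket_delta !(eqxx, mid1, ends_neq) ?(sub0r, subr0, oppr0, b0, bN, trN, tr0).
  rewrite bracket_delta !(eqxx, mid1, ends_neq) sub0r trN opprK mulr0 mul0r add0r.
  by rewrite trace_delta_Y !eqxx mulr1.
have A3 : ham2_val (delta_mx r0 r0) (delta_mx i1 i1) f = 0.
  rewrite ham2_val_sl !bracket_delta !(eqxx, mid1, ends_neq) ?(sub0r, subr0, oppr0, b0, bN, trN, tr0).
  by rewrite !mulr0 addr0.
have A4 : ham2_val (delta_mx i1 i1) (delta_mx r0 r0) f = 0.
  rewrite ham2_val_sl !bracket_delta !(eqxx, mid1, ends_neq) ?(sub0r, subr0, oppr0, b0, bN, trN, tr0).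
  rewrite bracket_delta !(eqxx, mid1, ends_neq) subrr tr0 oppr0.
  by rewrite !mulr0 mul0r addr0.
have mid1' : (r0 != i0) * (i1 != i0) by rewrite mid1 ends_neq.
have P1 := P _ _ _ _ _ _ mid1'.1 mid1'.2 A1 A2.
have P2 := P _ _ _ _ _ _ mid1'.1 mid1'.2 A3 A4.
have S0 : coef2_val star f (zt i1 r0 * zt r0 i1) = coef2_val star f (zt r0 r0 * zt i1 i1).
  have E1 : zt i1 r0 * zt r0 i1 = zt i1 i1 * zt r0 r0 by exact: zeta_minor.
  have E2 : zt i1 i1 * zt r0 r0 = zt r0 r0 * zt i1 i1 by exact: mulrC.
  exact: (congr1 (coef2_val star f) (etrans E1 E2)).
have P1' := etrans P1 (congr1 (fun s : C => 2 * kc ^+ 2 * s + _) S0).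
move: {P1} P1' P2.
move: (lowval _ _) (lowval _ _) (lowval _ _) (lowval _ _) (coef2_val _ _ _) (c _ _) (c _ _) (c _ _) (c _ _) kc (p.+1%:R : C).
move=> a1 a2 a3 a4 s c1 c2 c3 c4 k q H1 H2.
have -> : k * (a4 + a3 - a2 - a1) = (k * (a4 + a3) + 4^-1 * (0 + q))
   - (k * (a2 + a1) + 4^-1 * (0 + 0)) - 4^-1 * q by ring.
by rewrite H1 H2; ring.
Qed.

Lemma not_diffop_sl : ~ diffop (Lambda X).
Proof.
move=> dX; have OY := Omin_Ytheta R L; have [c0 Hc] := star_sl.
have xi1 : evalR Y (zt r0 i0) = 1.
  by apply: etrans (esym (trace_tau_self _)) _; rewrite trace_delta_Y !eqxx.
have [P HP] := diffop_poly (zt i0 r0) (evalRD OY) (evalRM OY) xi1 dX.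
have FL := Lambda_family gsp eqv lam.
apply: (@sl_star_contradiction C N.-2 P kc c0 _ _ _ (fun n => sl_minor FL slL n.+1) Hc) => n.
by rewrite -HP -(lowval_id _ _ (Xtheta_in R L)); exact: sl_eta.
Qed.
End Part1sl.

(*PART Part1so*)
Section Part1so.
Variables (R : realType) (L : simple_algebra).
Local Notation C := (complex R).
Local Notation N := (matrix_size L).
Local Notation M := 'M[C]_N.
Local Notation lieg := (lieg R L).
Local Notation RO := (RO R L).
Local Notation X := (Xtheta R L).
Local Notation Y := (Ytheta R L).
Local Notation kc := (kill_const R L).
Local Notation "i ^!" := (rev_ord i) (at level 1, format "i ^!").
Variables (a b : 'I_N) (aE : a = (idx1 L)^!) (bE : b = (idx0 L)^!).
Local Notation ch := (@chi R L).
Local Notation dl u v := (delta_mx v^! u : M).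
Local Notation mid k := (k \notin [:: a; b; a^!; b^!]).
Implicit Types (x y z Z : M) (f g : RO).

Variables (star : {poly RO} -> {poly RO} -> {poly RO}) (Lambda : M -> RO -> RO).
Hypothesis gsp : graded_star_product star.
Hypothesis eqv : star_equivariant star.
Hypothesis lam : star_lambda star Lambda.
Hypothesis soL : is_sl L = false.
Local Notation lowval := (lowval Lambda).
Local Notation ks u v := (lowval (dl u v)).

Let dist : uniq [:: a; b; a^!; b^!].
Proof. by rewrite aE bE /= !rev_ordK !inE !negb_or !(corners_neq soL, ends_neq). Qed.

Lemma trace_dl u v : \tr (dl u v *m Y)
  = (((u == a) && (v == b)) : nat)%:R - (((u == b) && (v == a)) : nat)%:R.
Proof.
rewrite aE bE mxtrace_delta_mulmx YthetaE soL mxBE !mxE.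
by rewrite !(can2_eq rev_ordK rev_ordK).
Qed.

Lemma ham_dl (u v s t : 'I_N) : ham (lproj (dl u v)) (ch s t) = 2^-1 *:
  (((if s == u^! then ch v t else 0) - (if s == v^! then ch u t else 0))
   + ((if t == u^! then ch s v else 0) - (if t == v^! then ch s u else 0))).
Proof.
have -> : lproj (dl u v) = 2^-1 *: so_rot R u^! v :> M.
  by rewrite so_rotE // /lproj soL antitr_delta !rev_ordK.
have rg := so_rot_in R u^! v; have rg' : 2^-1 *: so_rot R u^! v \in lieg by rewrite rpredZ.
apply: etrans (ham_tau _ rg') _.
apply: etrans (_ : _ = tau (2^-1 *: bracket (so_rot R u^! v) (delta_mx (rev_ord t) s))) _.
  by congr tau; rewrite /bracket -scalemxAl -scalemxAr scalerBr.
apply: etrans (tauZ _ _) _; congr (_ *: _).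
apply: etrans (esym (ham_tau _ rg)) _.
by apply: etrans (ham_rot_chi R soL u^! v s t) _; rewrite rev_ordK.
Qed.

Lemma ev_ch s t : evalR Y (ch s t)
  = (((s == a) && (t == b)) : nat)%:R - (((s == b) && (t == a)) : nat)%:R.
Proof. by apply: etrans (esym (trace_tau_self _)) _; exact: trace_dl. Qed.

Let dE := @distE N a b dist.
Let mE := @so_midE N a b.
Let OY := Omin_Ytheta R L.

Lemma ev_xi : evalR Y (ch a b) = 1.
Proof. by apply: etrans (ev_ch a b) _; rewrite !eqxx !dE /= subr0. Qed.

Lemma mid_xi l : mid l -> ham (lproj (dl a l)) (ch a b) = 0.
Proof.
by move=> ml; apply: etrans (ham_dl _ _ _ _) _; rewrite !(mE ml, dE) !subrr addr0 scaler0.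
Qed.

Lemma mid_xi' l : mid l -> ham (lproj (dl a^! l^!)) (ch a b) = 2^-1 *: ch l^! b.
Proof.
move=> ml; apply: etrans (ham_dl _ _ _ _) _.
by rewrite !rev_ordK !(mE ml, dE) eqxx !subr0 addr0.
Qed.

Lemma mid_mid l : mid l -> ham (lproj (dl a l)) (ch l^! b) = - 2^-1 *: ch a b.
Proof.
move=> ml; apply: etrans (ham_dl _ _ _ _) _.
by rewrite !(mE ml, dE) eqxx subr0 addr0 sub0r scalerN scaleNr.
Qed.

Lemma eig_a : ham (lproj (dl a a^!)) (ch a b) = - 2^-1 *: ch a b.
Proof.
apply: etrans (ham_dl _ _ _ _) _.
by rewrite !rev_ordK !dE eqxx !subr0 addr0 sub0r scalerN scaleNr.
Qed.

Lemma eig_b : ham (lproj (dl b b^!)) (ch a b) = - 2^-1 *: ch a b.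
Proof.
apply: etrans (ham_dl _ _ _ _) _.
by rewrite !rev_ordK !dE eqxx !subr0 add0r sub0r scalerN scaleNr.
Qed.

Lemma ab'_xi : ham (lproj (dl a b^!)) (ch a b) = - 2^-1 *: ch a a.
Proof.
apply: etrans (ham_dl _ _ _ _) _.
by rewrite !rev_ordK !dE eqxx !subr0 add0r sub0r scalerN scaleNr.
Qed.

Lemma ba'_xi : ham (lproj (dl b a^!)) (ch a b) = - 2^-1 *: ch b b.
Proof.
apply: etrans (ham_dl _ _ _ _) _.
by rewrite !rev_ordK !dE eqxx !subr0 addr0 sub0r scalerN scaleNr.
Qed.

Lemma ch_diag i : ch i i = 0.
Proof. by apply: half_RO; have H : ch i i = - ch i i := chi_anti R soL i i; rewrite {1}H addNr. Qed.

Lemma ham_lprojB x y w : ham (lproj (x - y)) (tau w) = ham (lproj x) (tau w) - ham (lproj y) (tau w).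
Proof.
apply: etrans (ham_tau _ (lproj_in _)) _.
apply: etrans (_ : _ = tau (bracket (lproj x) w - bracket (lproj y) w)) _.
  by congr tau; rewrite linearB bracketBl.
apply: etrans (tauB _ _) _.
exact: (congr2 (fun u v : RO => u - v) (esym (ham_tau _ (lproj_in _))) (esym (ham_tau _ (lproj_in _)))).
Qed.

Lemma ham2_val_xi x y p u c : ham (lproj y) (ch a b) = u ->
  evalR Y (ham (lproj x) (ch a b)) * evalR Y u = 0 -> ham (lproj x) u = c *: ch a b ->
  ham2_val x y (ch a b ^+ p.+1) = p.+1%:R * c.
Proof.
move=> Hy xy Hu; apply: etrans (ham_ham_pow p (lproj_in x) (lproj_in y) ev_xi) _.
apply: etrans (congr1 (fun u => _ * evalR Y u + _ * evalR Y (ham (lproj x) u)) Hy) _.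
apply: etrans (congr1 (fun u => _ + _ * evalR Y u) Hu) _.
apply: etrans (congr1 (fun u => _ + _ * u) (evalRZ OY _ _)) _.
by rewrite -mulrA xy mulr0 add0r ev_xi mulr1.
Qed.

Lemma ham2_val_xi0 x y p : ham (lproj y) (ch a b) = 0 -> ham2_val x y (ch a b ^+ p.+1) = 0.
Proof.
move=> Hy; rewrite -[RHS](mulr0 p.+1%:R); apply: ham2_val_xi Hy _ _.
  by rewrite (evalR0 OY) mulr0.
by apply: etrans (ham0 (lproj_in x)) _; rewrite scale0r.
Qed.

Lemma ham2_val_mid l p : mid l -> ham2_val (dl a l) (dl a^! l^!) (ch a b ^+ p.+1) = p.+1%:R * - 4^-1.
Proof.
move=> ml; apply: ham2_val_xi (mid_xi' ml) _ _.
  by rewrite (mid_xi ml) (evalR0 OY) mul0r.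
apply: etrans (hamZ (lproj_in _) _ _) _.
apply: etrans (congr1 _ (mid_mid ml)) _; rewrite scalerA; congr (_ *: _).
by rewrite mulrN -invfM -natrM.
Qed.

Lemma eig_ab : ham (lproj (dl a a^! - dl b b^!)) (ch a b) = 0.
Proof.
apply: etrans (ham_lprojB _ _ _) _.
apply: etrans (congr2 (fun u v : RO => u - v) eig_a eig_b) _.
exact: subrr.
Qed.

Lemma ham2_val_aa p : ham2_val (dl a a^! - dl b b^!) (dl a a^!) (ch a b ^+ p.+1) = 0.
Proof.
rewrite -[RHS](mulr0 p.+1%:R); apply: ham2_val_xi eig_a _ _.
  by rewrite eig_ab (evalR0 OY) mul0r.
apply: etrans (hamZ (lproj_in _) _ _) _.
by apply: etrans (congr1 _ eig_ab) _; rewrite scaler0 scale0r.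
Qed.

Lemma ab'_xi0 : ham (lproj (dl a b^!)) (ch a b) = 0.
Proof. by apply: etrans ab'_xi _; rewrite ch_diag scaler0. Qed.
Lemma ba'_xi0 : ham (lproj (dl b a^!)) (ch a b) = 0.
Proof. by apply: etrans ba'_xi _; rewrite ch_diag scaler0. Qed.

Lemma quadric0 : \sum_(l | mid l) ch a l * ch a^! l^!
   - ch a a^! * (ch a a^! - ch b b^!) - (ch a b^! * ch b a^!) *+ 2 = 0.
Proof.
exact: (plucker_quadric dist (@half_RO R L) (chi_anti R soL) (chi_plucker R soL) (chi_isotropic R soL)).
Qed.

Definition quadric_sum p : C :=
  \sum_(l | mid l)
     (ks a l (ch a b ^+ p * ch a^! l^!) + ks a^! l^! (ch a b ^+ p * ch a l))
   - (ks a a^! (ch a b ^+ p * (ch a a^! - ch b b^!)) + ks a a^! (ch a b ^+ p * ch a a^!)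
      - ks b b^! (ch a b ^+ p * ch a a^!))
   - (ks a b^! (ch a b ^+ p * ch b a^!) + ks b a^! (ch a b ^+ p * ch a b^!)) *+ 2.

Let FL := Lambda_family gsp eqv lam.

Lemma star_so : exists c0, forall p, kc * quadric_sum p.+1 = c0 - (- (N - 4)%:R / 16) * p.+1%:R.
Proof.
pose c2 x y := pair_const Lambda x y + pair_const Lambda y x.
exists (\sum_(l | mid l) c2 (dl a l) (dl a^! l^!) - c2 (dl a a^!) (dl a a^! - dl b b^!)
   - c2 (dl a b^!) (dl b a^!) *+ 2) => p.
set f := ch a b ^+ p.+1; set q : C := p.+1%:R.
have f1 : evalR Y f = 1.
  apply: etrans (evalRX OY _ _) _.
  by apply: etrans (congr1 (fun c : C => c ^+ _) ev_xi) _; rewrite expr1n.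
have tr0 u v : (u == a) && (v == b) = false -> (u == b) && (v == a) = false -> \tr (dl u v *m Y) = 0.
  by rewrite trace_dl => -> ->; rewrite subrr.
have tr_aa : \tr (dl a a^! *m Y) = 0 by apply: tr0; rewrite !dE ?andbF.
have tr_bb : \tr (dl b b^! *m Y) = 0 by apply: tr0; rewrite !dE ?andbF.
have tr_ab : \tr (dl a b^! *m Y) = 0 by apply: tr0; rewrite !dE ?andbF.
have tr_ba : \tr (dl b a^! *m Y) = 0 by apply: tr0; rewrite !dE ?andbF.
have tr_d : \tr ((dl a a^! - dl b b^!) *m Y) = 0 by rewrite mulmxBl linearB /= tr_aa tr_bb subrr.
have P1 l : mid l -> kc * (ks a l (f * ch a^! l^!) + ks a^! l^! (f * ch a l)) =
   2 * kc ^+ 2 * coef2_val star f (ch a l * ch a^! l^!) + c2 (dl a l) (dl a^! l^!) + 16^-1 * q.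
  move=> ml; have tr_l : \tr (dl a l *m Y) = 0 by apply: tr0; rewrite !(mE ml, dE) ?andbF.
  have tr_l' : \tr (dl a^! l^! *m Y) = 0 by apply: tr0; rewrite !dE.
  have aux (A B : C) : A + 4^-1 * (q * - 4^-1 + 0) = B -> A = B + 16^-1 * q.
    have e16 : 4^-1 * 4^-1 = 16^-1 :> C by rewrite -invfM -natrM.
    by move=> <-; rewrite addr0 -e16; ring.
  apply: aux; have := pairing gsp lam f1 tr_l tr_l'.
  by rewrite (ham2_val_mid _ ml) (ham2_val_xi0 _ _ (mid_xi ml)).
have P2 : kc * (ks a a^! (f * (ch a a^! - ch b b^!)) + (ks a a^! (f * ch a a^!) - ks b b^! (f * ch a a^!)))
   = 2 * kc ^+ 2 * coef2_val star f (ch a a^! * (ch a a^! - ch b b^!)) + c2 (dl a a^!) (dl a a^! - dl b b^!).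
  have := pairing gsp lam f1 tr_aa tr_d.
  rewrite ham2_val_aa (ham2_val_xi0 _ _ eig_ab) addr0 mulr0 addr0 (lowvalB FL).
  have -> : tau (dl a a^! - dl b b^!) = ch a a^! - ch b b^! by exact: tauB.
  by [].
have P3 : kc * (ks a b^! (f * ch b a^!) + ks b a^! (f * ch a b^!))
   = 2 * kc ^+ 2 * coef2_val star f (ch a b^! * ch b a^!) + c2 (dl a b^!) (dl b a^!).
  have := pairing gsp lam f1 tr_ab tr_ba.
  by rewrite (ham2_val_xi0 _ _ ba'_xi0) (ham2_val_xi0 _ _ ab'_xi0) addr0 mulr0 addr0.
have Q1 : \sum_(l | mid l) coef2_val star f (ch a l * ch a^! l^!)
   - coef2_val star f (ch a a^! * (ch a a^! - ch b b^!)) - coef2_val star f (ch a b^! * ch b a^!) *+ 2 = 0.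
  have E1 := coef2_val_sum gsp f (fun l => mid l) (fun l => ch a l * ch a^! l^!).
  have E2 : coef2_val star f (ch a b^! * ch b a^!) *+ 2 = coef2_val star f ((ch a b^! * ch b a^!) *+ 2).
    by apply: esym; apply: etrans (congr1 (coef2_val star f) (mulr2n _)) _; apply: etrans (coef2_valD gsp f _ _) _; rewrite mulr2n.
  rewrite E2 -E1; apply: etrans (congr1 (fun c : C => c - _) (esym (coef2_valB gsp f _ _))) _.
  apply: etrans (esym (coef2_valB gsp f _ _)) _.
  exact: etrans (congr1 (coef2_val star f) quadric0) (coef2_val0 gsp f).
have P1s : kc * \sum_(l | mid l) (ks a l (f * ch a^! l^!) + ks a^! l^! (f * ch a l)) =
   2 * kc ^+ 2 * (\sum_(l | mid l) coef2_val star f (ch a l * ch a^! l^!)) + \sum_(l | mid l) c2 (dl a l) (dl a^! l^!) + 16^-1 * q * (N - 4)%:R.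
  rewrite !mulr_sumr -big_split /=.
  have -> : 16^-1 * q * (N - 4)%:R = \sum_(l | mid l) 16^-1 * q.
    by rewrite (so_sum_mid dist) mulr_natr.
  by rewrite -big_split; apply: eq_bigr => l ml; exact: P1.
rewrite /quadric_sum -/f; move: P1s P2 P3 Q1 {P1 f1}.
move: (\sum_(l | _) _) (\sum_(l | _) _) (\sum_(l | _) _) => s1 s2 s3.
move: (lowval _ _) (lowval _ _) (lowval _ _) (lowval _ _) (lowval _ _) => k1 k2 k3 k4 k5.
move: (coef2_val _ _ _) (coef2_val _ _ _) (c2 _ _) (c2 _ _) (N - 4)%:R q kc => g1 g2 d1 d2 r q' k.
move=> H1 H2 H3 H4.
have -> : k * (s3 - (k5 + k4 - k3) - (k2 + k1) *+ 2)
  = k * s3 - k * (k5 + (k4 - k3)) - (k * (k2 + k1)) *+ 2 by ring.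
rewrite H1 H2 H3.
have -> : 2 * k ^+ 2 * s2 + s1 + 16^-1 * q' * r - (2 * k ^+ 2 * g2 + d2) - (2 * k ^+ 2 * g1 + d1) *+ 2
  = 2 * k ^+ 2 * (s2 - g2 - g1 *+ 2) + (s1 + 16^-1 * q' * r - d2 - d1 *+ 2) by ring.
by rewrite H4; ring.
Qed.

Lemma not_diffop_so : ~ diffop (Lambda X).
Proof.
move=> dX; have [c0 Hc] := star_so.
have [P HP] := diffop_poly (ch a^! b^!) (evalRD OY) (evalRM OY) ev_xi dX.
have r1 : (1 < N - 4)%N by have := so_size soL; lia.
have c1 : - (N - 4)%:R / 16 != 0 :> C.
  by rewrite mulf_eq0 invr_eq0 oppr_eq0 !pnatr_eq0; have := so_size soL; lia.
apply: (@so_star_contradiction C (N - 4) P c0 _ kc (fun n => lowval Y (ch a b ^+ n.+2)) (fun n => quadric_sum n.+1) r1 c1 _ _ Hc) => n.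
  rewrite -HP -(lowval_id _ _ (Xtheta_in R L)) aE bE.
  exact: (so_eta FL soL).
rewrite /quadric_sum aE bE; exact: (so_quadric FL soL).
Qed.
End Part1so.

(*PART Reduce*)
Section Reduce.
Variables (R : realType) (L : simple_algebra).
Local Notation C := (complex R).
Local Notation N := (matrix_size L).
Local Notation M := 'M[C]_N.
Local Notation lieg := (lieg R L).
Local Notation RO := (RO R L).
Local Notation X := (Xtheta R L).
Implicit Types (x y z Z : M) (f g : RO).

Lemma family_scale B c x : lie_family B -> x \in lieg -> B (c *: x) = (fun f => c *: B x f : RO).
Proof.
move=> FB xg; apply/funext => f.
have B0 : B 0 f = 0.
  by have := fam_linx FB (-1) f (rpred0 lieg) (rpred0 lieg); rewrite scaler0 addr0 scaleN1r addNr.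
by have := fam_linx FB c f xg (rpred0 lieg); rewrite B0 !addr0.
Qed.

Lemma family_reduce (Q : (RO -> RO) -> Prop) B : lie_family B ->
  (forall c D, Q D -> Q (fun f => c *: D f)) ->
  (forall Z D, Z \in lieg -> Q D -> Q (fun f => ham Z (D f) - D (ham Z f))) ->
  forall x, x \in lieg -> x != 0 -> Q (B x) -> Q (B X).
Proof.
move=> FB QZ QH x xg x0 Qx.
suff [] : X \in lieg /\ Q (B X) by [].
apply: (@ideal_Xtheta R L (fun x => x \in lieg /\ Q (B x)) _ _ x xg x0); last by split.
  move=> c y [yg Qy]; split; first exact: rpredZ.
  by rewrite (family_scale c FB yg); exact: QZ.
move=> Z y Zg yg [_ Qy]; split; first exact: bracket_lieg.
suff -> : B (bracket Z y) = (fun f => ham Z (B y f) - B y (ham Z f)) by exact: QH.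
by apply/funext => f; rewrite (fam_equiv FB f Zg yg) addrK.
Qed.

Lemma ham_linear Z : Z \in lieg -> linear (ham Z : RO -> RO).
Proof.
move=> Zg c f g; apply: etrans (hamD Zg _ _) _.
exact: (congr1 (fun u => u + _) (hamZ Zg _ _)).
Qed.

Lemma diffop_reduce B : lie_family B -> forall x, x \in lieg -> x != 0 -> diffop (B x) -> diffop (B X).
Proof.
move=> FB; apply: (family_reduce FB) => [c D|Z D Zg]; first exact: diffopZ.
exact: (diffop_comm (ham_linear Zg) (hamM Zg)).
Qed.

Lemma left_divides_reduce B P : lie_family B -> linear P ->
  (forall Z f, Z \in lieg -> P (ham Z f) = ham Z (P f)) ->
  forall x, x \in lieg -> x != 0 -> left_divides P (B x) -> left_divides P (B X).
Proof.
move=> FB PL PH; have P0 : P 0 = 0.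
  by have := PL (-1) 0 0; rewrite scaler0 addr0 scaleN1r addNr.
apply: (family_reduce FB) => [c D [A dA DA]|Z D Zg [A dA DA]].
  exists (fun f => c *: A f); first exact: diffopZ.
  move=> f /=; rewrite DA /=; have := PL c (A f) 0.
  by rewrite P0 !addr0.
exists (fun f => ham Z (A f) - A (ham Z f)); first exact: (diffop_comm (ham_linear Zg) (hamM Zg)).
have PB u v : P (u - v) = P u - P v.
  by have := PL (-1) v u; rewrite !scaleN1r [_ + u]addrC [_ + P u]addrC.
move=> f; rewrite /= !DA /=; apply: esym; apply: etrans (PB _ _) _.
exact: (congr1 (fun u => u - _) (PH _ _ Zg)).
Qed.

Lemma Lambda_not_diffop star Lambda : graded_star_product star -> star_equivariant star ->
  star_lambda star Lambda ->
  forall x, x \in lieg -> x != 0 -> ~ diffop (Lambda x : RO -> RO).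
Proof.
move=> gsp eqv lam x xg x0 dx.
have := diffop_reduce (Lambda_family gsp eqv lam) xg x0 dx.
case slL: (is_sl L); first exact: (not_diffop_sl gsp eqv lam).
exact: (not_diffop_so erefl erefl gsp eqv lam).
Qed.
End Reduce.

(*PART Act*)
Section LinearHorner.
Variables (K : comNzRingType) (A : comAlgType K).

Lemma horner_linear (phi : A -> K) (P : {poly A}) :
  (forall c f g, phi (c *: f + g) = c * phi f + phi g) ->
  exists p : {poly K}, (forall s, phi P.[s%:A] = p.[s]) /\ forall i, p`_i = phi P`_i.
Proof.
move=> phiL.
have phi0 : phi 0 = 0 by have := phiL (-1) 0 0; rewrite scaler0 addr0 mulN1r addNr.
elim/poly_ind: P => [|P c [p [p1 p2]]].
  by exists 0; split=> [s|i]; rewrite ?horner0 ?coef0.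
exists (p * 'X + (phi c)%:P); split=> [s|i].
  rewrite !hornerMXaddC -p1 mulrC -scalerAl mul1r phiL.
  by rewrite mulrC.
rewrite !coefD !coefMX !coefC; case: i => [|i] /=; first by rewrite !add0r.
by rewrite !addr0 p2.
Qed.

Lemma quad_horner_alg (a b c : A) (s : K) :
  (a%:P + 'X * b%:P - 'X^2 * c%:P).[s%:A] = a + s *: b - s ^+ 2 *: c.
Proof.
by rewrite quad_horner -(rmorphXn (in_alg A)) /= -!scalerAl !mul1r.
Qed.

Lemma quad_coef0 (a b c : A) : (a%:P + 'X * b%:P - 'X^2 * c%:P)`_0 = a.
Proof. by rewrite coefB coefD coefC coefXM coefXnM /= subr0 addr0. Qed.

Lemma poly_mul_coef01 (P Q : {poly A}) : (P * Q)`_0 = P`_0 * Q`_0 /\ (P * Q)`_1 = P`_1 * Q`_0 + P`_0 * Q`_1.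
Proof.
by rewrite coef0M coefM !big_ord_recl big_ord0 addr0 /= addrC.
Qed.
End LinearHorner.

Section Act.
Variables (R : realType) (L : simple_algebra).
Local Notation C := (complex R).
Local Notation N := (matrix_size L).
Local Notation M := 'M[C]_N.
Local Notation lieg := (lieg R L).
Local Notation RO := (RO R L).
Local Notation Sg := (Sg R L).
Local Notation kc := (kill_const R L).
Local Notation d := (\dim lieg).
Implicit Types (x y z Z k : M) (f g : RO) (F : Sg).

Section Group.
Variables (k : M) (hk : in_group k).
Let Oinv z (Oz : Omin z) : Omin (Ad (invmx k) z) := Omin_Ad (group_invmx hk) Oz.

Lemma actD f g : act k (f + g) = act k f + act k g.
Proof.
apply: RO_ext => z Oz; apply: etrans (evalR_act _ hk Oz) _.
apply: etrans (evalRD (Oinv Oz) _ _) _; apply: esym; apply: etrans (evalRD Oz _ _) _.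
exact: (congr2 (fun a b : C => a + b) (evalR_act _ hk Oz) (evalR_act _ hk Oz)).
Qed.

Lemma actM f g : act k (f * g) = act k f * act k g.
Proof.
apply: RO_ext => z Oz; apply: etrans (evalR_act _ hk Oz) _.
apply: etrans (evalRM (Oinv Oz) _ _) _; apply: esym; apply: etrans (evalRM Oz _ _) _.
exact: (congr2 (fun a b : C => a * b) (evalR_act _ hk Oz) (evalR_act _ hk Oz)).
Qed.

Lemma actA c : act k c%:A = c%:A.
Proof.
apply: RO_ext => z Oz; apply: etrans (evalR_act _ hk Oz) _.
exact: etrans (evalRA (Oinv Oz) _) (esym (evalRA Oz _)).
Qed.

Lemma act_mu x : x \in lieg -> act k (mu x) = mu (Ad k x).
Proof.
move=> xg; apply: RO_ext => z Oz; apply: etrans (evalR_act _ hk Oz) _.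
apply: etrans (evalR_mu (Oinv Oz) xg) _; apply: esym; apply: etrans (evalR_mu Oz (Ad_in hk xg)) _.
by rewrite trace_Ad ?group_unit.
Qed.

Lemma actZ c f : act k (c *: f) = c *: act k f.
Proof.
have E g : c *: g = c%:A * g :> RO by rewrite -scalerAl mul1r.
rewrite (E f) (E (act k f)); apply: etrans (actM _ _) _.
exact: (congr1 (fun u => u * _) (actA c)).
Qed.

Lemma actX f n : act k (f ^+ n) = act k f ^+ n.
Proof.
elim: n => [|n IH]; first by have := actA 1; rewrite scale1r.
rewrite !exprS; apply: etrans (actM _ _) _.
exact: (congr1 (fun u => _ * u) IH).
Qed.
End Group.

Section Unipotent.
Variables (Z : M) (Zg : Z \in lieg) (ZZ : Z *m Z = 0).
Local Notation u s := (1%:M + s *: Z).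

Lemma act_unipotent f : exists P : {poly RO},
  [/\ forall s : C, act (u s) f = P.[s%:A], P`_0 = f & P`_1 = ham Z f].
Proof.
elim/RO_ind: f => [c|x xg|f g [P [P0 P1 P2]] [Q [Q0 Q1 Q2]]|f g [P [P0 P1 P2]] [Q [Q0 Q1 Q2]]].
- exists (c%:A)%:P; split=> [s||]; rewrite ?hornerC ?coefC //=.
    by rewrite actA //; exact: unipotent_group.
  by rewrite hamA.
- exists ((mu x)%:P + 'X * (mu (bracket Z x))%:P - 'X^2 * (mu (Z *m x *m Z))%:P).
  split=> [s||]; last 1 first.
  - exact: etrans (quad_coef1 _ _ _) (esym (ham_mu Zg xg)).
  - apply: etrans (act_mu (unipotent_group Zg ZZ s) xg) _.
    apply: etrans (_ : _ = mu (- s ^+ 2 *: (Z *m x *m Z) + (s *: bracket Z x + x))) _.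
      by apply: (congr1 (@mu R L)); rewrite (unipotent_Ad Zg ZZ) scaleNr [RHS]addrC (addrC x).
    apply: etrans (mu_linear _ _ _) _.
    apply: etrans (congr1 _ (mu_linear _ _ _)) _.
    apply: esym; apply: etrans (quad_horner_alg _ _ _ _) _.
    have aux (V : lmodType C) (a b c : V) t : a + b - t *: c = - t *: c + (b + a).
      by rewrite scaleNr [RHS]addrC (addrC a).
    exact: aux.
  exact: quad_coef0.
- exists (P + Q); split=> [s||].
  - apply: etrans (actD (unipotent_group Zg ZZ s) _ _) _.
    by apply: esym; apply: etrans (hornerD _ _ _) _; exact: (congr2 +%R (esym (P0 s)) (esym (Q0 s))).
  - by apply: etrans (coefD _ _ _) _; exact: (congr2 +%R P1 Q1).
  apply: etrans (coefD _ _ _) _; apply: esym; apply: etrans (hamD Zg _ _) _.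
  exact: (congr2 +%R (esym P2) (esym Q2)).
have [M0 M1] := poly_mul_coef01 P Q.
exists (P * Q); split=> [s||].
- apply: etrans (actM (unipotent_group Zg ZZ s) _ _) _.
  by apply: esym; apply: etrans (hornerM _ _ _) _; exact: (congr2 *%R (esym (P0 s)) (esym (Q0 s))).
- by apply: etrans M0 _; exact: (congr2 *%R P1 Q1).
apply: etrans M1 _; apply: esym; apply: etrans (hamM Zg _ _) _.
exact: (congr2 +%R (congr2 *%R (esym P2) (esym Q1)) (congr2 *%R (esym P1) (esym Q2))).
Qed.
End Unipotent.

Lemma ham_linearl c Z Z' f : Z \in lieg -> Z' \in lieg ->
  ham (c *: Z + Z') f = c *: ham Z f + ham Z' f.
Proof.
move=> Zg Zg'; have cZg : c *: Z + Z' \in lieg by rewrite rpredD ?rpredZ.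
have [F ->] := piRO_surj f; apply: RO_ext => z Oz; apply: etrans (evalR_ham F cZg Oz) _.
apply: esym; apply: etrans (evalRD Oz _ _) _.
apply: etrans (congr1 (fun a : C => a + _) (evalRZ Oz _ _)) _.
apply: etrans (congr2 (fun a b : C => c * a + b) (evalR_ham F Zg Oz) (evalR_ham F Zg' Oz)) _.
rewrite /vfield mulr_sumr -big_split; apply: eq_bigr => j _ /=.
have -> : bracket (c *: Z + Z') (gbasis j) = c *: bracket Z (gbasis j) + bracket Z' (gbasis j).
  exact: (bracket_linearl _ c Z Z').
by rewrite killingLl mulrDr mulrCA.
Qed.

Section Equivariant.
Variable D : M -> RO -> RO.
Hypothesis Dlinl : forall (c : C) x y f, x \in lieg -> y \in lieg ->
    D (c *: x + y) f = c *: D x f + D y f.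
Hypothesis Dlin : forall x, x \in lieg -> linear (D x).
Hypothesis Deq : forall k x f, in_group k -> x \in lieg -> D (Ad k x) (act k f) = act k (D x f).

Lemma equivariant_square_zero Z x f : Z \in lieg -> Z *m Z = 0 -> x \in lieg ->
  ham Z (D x f) = D (bracket Z x) f + D x (ham Z f).
Proof.
move=> Zg ZZ xg; have Zxg := bracket_lieg Zg xg.
pose W := Z *m x *m Z.
have AdE s : Ad (1%:M + s *: Z) x = - s ^+ 2 *: W + (s *: bracket Z x + x).
  by rewrite (unipotent_Ad Zg ZZ) scaleNr [RHS]addrC (addrC x).
have Wg : W \in lieg.
  have -> : W = bracket Z x + x - Ad (1%:M + 1 *: Z) x.
    by rewrite AdE expr1n scale1r scaleN1r opprD opprK addrC addrNK.
  apply: rpredB; first exact: rpredD.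
  by apply: Ad_in xg; exact: unipotent_group.
have [P [P0 P1 P2]] := act_unipotent Zg ZZ f.
have [Q [Q0 Q1 Q2]] := act_unipotent Zg ZZ (D x f).
apply: RO_ext => z Oz.
have phiL y (yg : y \in lieg) (c : C) (g h : RO) : evalR z (D y (c *: g + h)) = c * evalR z (D y g) + evalR z (D y h).
  apply: etrans (congr1 (evalR z) (Dlin yg _ _ _)) _.
  apply: etrans (evalRD Oz _ _) _; exact: (congr1 (fun a : C => a + _) (evalRZ Oz _ _)).
have evL (c : C) (g h : RO) : evalR z (c *: g + h) = c * evalR z g + evalR z h.
  by apply: etrans (evalRD Oz _ _) _; exact: (congr1 (fun a : C => a + _) (evalRZ Oz _ _)).
have [p1 [E1 C1]] := horner_linear P (phiL x xg).
have [p2 [E2 C2]] := horner_linear P (phiL _ Zxg).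
have [p3 [E3 C3]] := horner_linear P (phiL _ Wg).
have [q [Eq Cq]] := horner_linear Q evL.
have key s : (p1 + 'X * p2 - 'X^2 * p3).[s] = q.[s].
  apply: esym; apply: etrans (esym (Eq s)) _.
  apply: etrans (congr1 (evalR z) (esym (Q0 s))) _.
  apply: etrans (congr1 (evalR z) (esym (Deq f (unipotent_group Zg ZZ s) xg))) _.
  apply: etrans (congr1 (fun y => evalR z (D y _)) (AdE s)) _.
  apply: etrans (congr1 (evalR z) (Dlinl _ _ Wg (rpredD (rpredZ s Zxg) xg))) _.
  apply: etrans (evL _ _ _) _.
  apply: etrans (congr1 (fun g => _ + evalR z g) (Dlinl _ _ Zxg xg)) _.
  apply: etrans (congr1 (fun a : C => _ + a) (evL _ _ _)) _.
  have act_eq y (h : C) : evalR z (D y P.[s%:A]) = h -> evalR z (D y (act (1%:M + s *: Z) f)) = h.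
    by move=> <-; exact: (congr1 (fun g => evalR z (D y g)) (P0 s)).
  apply: etrans (congr2 (fun a b : C => _ * a + (s * b + _)) (act_eq _ _ (E3 s)) (act_eq _ _ (E2 s))) _.
  apply: etrans (congr1 (fun a : C => _ + (_ + a)) (act_eq _ _ (E1 s))) _.
  rewrite !(hornerD, hornerN, hornerM, hornerX, hornerXn).
  by move: (p1.[s]) (p2.[s]) (p3.[s]) => a b c; ring.
have e : p1 + 'X * p2 - 'X^2 * p3 = q.
  apply/eqP; rewrite -subr_eq0; apply/eqP/poly0_nat => n.
  by rewrite hornerD hornerN key subrr.
have c1 := congr1 (fun p : {poly C} => p`_1) e.
have c2 : (p1 + 'X * p2 - 'X^2 * p3)`_1 = p1`_1 + p2`_0.
  by rewrite coefB coefD coefXM coefXnM /= subr0.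
have c3 := etrans (esym (Cq 1%N)) (etrans (esym c1) c2).
apply: etrans (congr1 (evalR z) (esym Q2)) _.
apply: etrans c3 _.
apply: etrans (congr2 (fun a b : C => a + b) (C1 1%N) (C2 0%N)) _.
apply: etrans (congr2 (fun g h : RO => evalR z (D x g) + evalR z (D (bracket Z x) h)) P2 P1) _.
by apply: etrans (addrC _ _) _; exact: esym (evalRD Oz _ _).
Qed.

Lemma equivariant_family : lie_family D.
Proof.
split=> [|x f g xg|Z x f Zg]; first exact: Dlinl.
  by have := Dlin xg 1 f g; rewrite !scale1r.
move: x f; suff [] : Z \in lieg /\ forall x f, x \in lieg -> ham Z (D x f) = D (bracket Z x) f + D x (ham Z f) by [].
apply: (@square_zero_span R L (fun Z => Z \in lieg /\ forall x f, x \in lieg -> ham Z (D x f) = D (bracket Z x) f + D x (ham Z f))) Zg => [c Z1 Z2 [Z1g H1] [Z2g H2]|Z' Z'g ZZ].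
  split; first by rewrite rpredD ?rpredZ.
  move=> x f xg; apply: etrans (ham_linearl _ _ Z1g Z2g) _.
  apply: etrans (congr2 (fun u v : RO => c *: u + v) (H1 x f xg) (H2 x f xg)) _.
  have B : D (bracket (c *: Z1 + Z2) x) f = c *: D (bracket Z1 x) f + D (bracket Z2 x) f.
    apply: etrans (congr1 (fun y => D y f) (bracket_linearl x c Z1 Z2)) _.
    exact: Dlinl (bracket_lieg Z1g xg) (bracket_lieg Z2g xg).
  have B' : D x (ham (c *: Z1 + Z2) f) = c *: D x (ham Z1 f) + D x (ham Z2 f).
    apply: etrans (congr1 (D x) (ham_linearl _ _ Z1g Z2g)) _; exact: Dlin.
  apply: esym; apply: etrans (congr2 (fun u v : RO => u + v) B B') _.
  have aux (V : lmodType C) (a b a' b' : V) : c *: a + b + (c *: a' + b') = c *: (a + a') + (b + b').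
    by rewrite scalerDr addrACA.
  exact: aux.
by split=> // x f xg; exact: equivariant_square_zero.
Qed.
End Equivariant.
End Act.

(*PART Part2*)
Section EulerShift.
Variables (R : realType) (L : simple_algebra).
Local Notation C := (complex R).
Local Notation RO := (RO R L).
Implicit Types f g u v : RO.

Fixpoint euler_fall n u : RO := if n is n'.+1 then euler (euler_fall n' u) - n'%:R *: euler_fall n' u else u.

Lemma euler_fallD n u v : euler_fall n (u + v) = euler_fall n u + euler_fall n v.
Proof.
elim: n => //= n IH; rewrite IH; apply: etrans (congr1 (fun w => w - _) (eulerD _ _)) _.
by rewrite scalerDr opprD addrACA.
Qed.

Lemma euler_fall_eigen n u s : euler u = s *: u -> euler_fall n u = (\prod_(j < n) (s - j%:R)) *: u.
Proof.
move=> us; elim: n => [|n IH] /=; first by rewrite big_ord0 scale1r.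
rewrite IH; apply: etrans (congr1 (fun w => w - _) (eulerZ _ _)) _.
rewrite us big_ord_recr /= !scalerA -scalerBl; congr (_ *: _).
by rewrite mulrBr [n%:R * _]mulrC.
Qed.

Lemma euler_fall_leq n k u : (n <= k)%N -> euler_fall n u = 0 -> euler_fall k u = 0.
Proof.
move=> /subnK <- u0; elim: (k - n)%N => //= j IH; rewrite IH.
by apply: etrans (congr1 (fun w => w - _) (euler0 R L)) _; rewrite scaler0 subrr.
Qed.

Lemma euler_fall_ex u : exists n, euler_fall n u = 0.
Proof.
elim/degree_ind: u => [f g [n fn] [k gk]|q f fq].
  exists (maxn n k); rewrite euler_fallD (euler_fall_leq (leq_maxl n k) fn).
  by rewrite (euler_fall_leq (leq_maxr n k) gk) addr0.
exists q.+1; rewrite (euler_fall_eigen _ (euler_degree fq)) big_ord_recr /= subrr mulr0.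
exact: scale0r.
Qed.

Variables (lam : C) (lam0 : forall q : nat, q%:R + lam != 0).

Lemma euler_shift_inj u : euler u + lam *: u = 0 -> u = 0.
Proof.
move=> /eqP; rewrite addr_eq0 -scaleNr => /eqP h; have [n] := euler_fall_ex u.
move/(etrans (esym (euler_fall_eigen n h)))/(congr1 (fun w => (\prod_(j < n) (- lam - j%:R))^-1 *: w)).
rewrite scalerA mulVf ?scale1r ?scaler0 //; apply/prodf_neq0 => j _.
by rewrite -opprD oppr_eq0 addrC; exact: lam0.
Qed.

Lemma euler_shift_degree (q : nat) g v : in_degree q v -> euler g + lam *: g = v -> v = (q%:R + lam) *: g.
Proof.
move=> vq gv; have l0 := lam0 q; pose g' := (q%:R + lam)^-1 *: v.
suff -> : g = g' by rewrite scalerA mulfV // scale1r.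
apply/eqP; rewrite -subr_eq0; apply/eqP/euler_shift_inj.
have g'v : euler g' + lam *: g' = v.
  apply: etrans (congr1 (fun w => w + _) (eulerZ _ _)) _.
  apply: etrans (congr1 (fun w => _ *: w + _) (euler_degree vq)) _.
  by rewrite !scalerA -scalerDl mulrC -mulrDl mulfV // scale1r.
have E : euler (g - g') = euler g - euler g'.
  apply: etrans (eulerD _ _) _; rewrite -scaleN1r -[in RHS]scaleN1r.
  exact: (congr1 (fun w => _ + w) (eulerZ _ _)).
apply: etrans (congr1 (fun w => w + _) E) _.
by rewrite scalerBr addrACA -opprD gv g'v subrr.
Qed.
End EulerShift.

Section Division.
Variables (R : realType) (L : simple_algebra).
Local Notation C := (complex R).
Local Notation N := (matrix_size L).
Local Notation M := 'M[C]_N.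
Local Notation lieg := (lieg R L).
Local Notation RO := (RO R L).
Local Notation X := (Xtheta R L).
Local Notation Y := (Ytheta R L).
Local Notation kc := (kill_const R L).
Local Notation h := (htheta R L).
Implicit Types (x y z Z : M) (f g : RO).

Let OY := Omin_Ytheta R L.
Definition kappa : C := evalR Y (mu X).

Lemma kappa_neq0 : kappa != 0.
Proof.
rewrite /kappa; have E := evalR_mu OY (Xtheta_in R L). rewrite E.
rewrite mulf_neq0 ?kill_const_neq0 // XYE.
have tr1 i : \tr (delta_mx i i : M) = 1.
  by have := mxtrace_delta_mulmx (1%:M : M) i i; rewrite mulmx1 mxE eqxx.
by case: (is_sl L); rewrite ?mxtraceD !tr1 ?oner_eq0 // -mulr2n pnatr_eq0.
Qed.

Lemma bracket_hX : bracket h X = 2 *: X.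
Proof.
rewrite /htheta {1}/bracket; have -> : bracket X Y *m X = X.
  by rewrite /bracket mulmxBl XYX -mulmxA Xsq mulmx0 subr0.
have -> : X *m bracket X Y = - X.
  by rewrite /bracket mulmxBr !mulmxA Xsq mul0mx sub0r XYX.
by rewrite opprK scaler_nat mulr2n.
Qed.

Lemma ham_h_pow p : ham h (mu X ^+ p) = (2 * p)%:R *: mu X ^+ p.
Proof.
have hg := h_in R L.
have E : ham h (mu X) = 2 *: mu X.
  apply: etrans (ham_mu hg (Xtheta_in R L)) _.
  have := mu_linear (R := R) (L := L) 1 X X.
  by rewrite bracket_hX !scaler_nat !scale1r -mulr2n => ->; rewrite mulr2n.
apply: etrans (derX (hamM hg) _ _) _.
apply: etrans (congr1 (fun w => _ * w *+ p) E) _.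
case: p => [|p]; first by rewrite mulr0n muln0 scale0r.
rewrite /= -scalerAr -exprSr -scaler_nat scalerA; congr (_ *: _).
by rewrite natrM mulrC.
Qed.

Variables (m : nat) (X' Y' : M) (D : M -> RO -> RO).
Hypothesis OX : Omin X'.
Hypothesis Yg' : Y' \in lieg.
Hypothesis nd : normalized_D4 m X' Y' D.

Lemma D_linear x : x \in lieg -> linear (D x).
Proof. by move=> xg; case: (D4_mem nd xg) => -[]. Qed.

Lemma D_degree x p f : x \in lieg -> in_degree p.+1 f -> in_degree p (D x f).
Proof.
move=> xg fp; have [_ H] := D4_mem nd xg; have := H _ _ fp.
by have -> : p.+1%:Z - 1 = p by lia.
Qed.

Lemma D_family : lie_family D.
Proof. exact: (equivariant_family (D4_linear nd) D_linear (fun k x f hk xg => D4_equivariant nd f hk xg)). Qed.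

Lemma D_scale x c f : x \in lieg -> D x (c *: f) = c *: D x f.
Proof.
move=> xg; have DL := D_linear xg.
have D0 : D x 0 = 0 by have := DL (-1) 0 0; rewrite scaler0 addr0 scaleN1r addNr.
by have := DL c f 0; rewrite D0 !addr0.
Qed.

Lemma D_lowest p x : x \in lieg ->
  evalR Y (D x (mu X ^+ p.+1)) = ycoef x * evalR Y (D Y (mu X ^+ p.+1)).
Proof.
move: x; apply: (functional_lowest (f := fun x => evalR Y (D x (mu X ^+ p.+1)))).
  move=> c x y xg yg; apply: etrans (congr1 (evalR Y) (D4_linear nd c _ xg yg)) _.
  apply: etrans (evalRD OY _ _) _; exact: (congr1 (fun a : C => a + _) (evalRZ OY _ _)).
move=> x xg; have hg := h_in R L.
have E : D (bracket h x) (mu X ^+ p.+1) = ham h (D x (mu X ^+ p.+1)) + - (2 * p.+1)%:R *: D x (mu X ^+ p.+1).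
  rewrite (fam_equiv D_family _ hg xg) ham_h_pow (D_scale _ _ xg).
  by rewrite scaleNr addrK.
apply: etrans (congr1 (evalR Y) E) _; apply: etrans (evalRD OY _ _) _.
have dX : in_degree p (D x (mu X ^+ p.+1)).
  by apply: (D_degree xg); have := degree_exp p.+1 (degree_mu X); rewrite mul1n.
apply: etrans (congr2 (fun a b : C => a + b) (ham_h dX) (evalRZ OY _ _)) _.
by rewrite -mulrDl; congr (_ * _); rewrite !natrM; ring.
Qed.

Lemma gamma2_neq0 : gamma R L m 2 != 0.
Proof.
rewrite /gamma; set e := (epsilon L)%:R.
have [e0|e1] : e = 0 \/ e = 1 by rewrite /e /epsilon; case: is_sl; [left|right].
  have -> : 2 * (2 + (m%:R - 1) / 2) * (2 + e) * (2 - e + m%:R / 2) = ((m + 3) * 2 * (m + 4))%:R / 2 :> C.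
    by rewrite e0; field.
  by rewrite mulf_neq0 ?invr_eq0 ?pnatr_eq0 // !muln_eq0 !addn_eq0 !andbF.
have -> : 2 * (2 + (m%:R - 1) / 2) * (2 + e) * (2 - e + m%:R / 2) = ((m + 3) * 3 * (m + 2))%:R / 2 :> C.
  by rewrite e1; field.
by rewrite mulf_neq0 ?invr_eq0 ?pnatr_eq0 // !muln_eq0 !addn_eq0 !andbF.
Qed.

Lemma D_normalized_theta : exists2 nu : C, nu != 0 &
  forall p, evalR Y (D Y (mu X ^+ p.+1)) = nu * gamma R L m p.+1 * kappa ^+ p.
Proof.
have [k [c [hk c0 XE]]] := Omin_form OX; have ku := group_unit hk.
have hi := group_invmx hk; set i := invmx k in hi.
have muX' : act i (mu X') = c *: mu X.
  apply: etrans (act_mu hi (Omin_in OX)) _.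
  have -> : Ad i X' = c *: X + 0 by rewrite XE AdZ AdK // addr0.
  apply: etrans (mu_linear _ _ _) _.
  by rewrite mu0 addr0.
have Y1g := Ad_in hi Yg'; set Y1 := Ad i Y' in Y1g.
have norm p : D Y1 (c ^+ p.+1 *: mu X ^+ p.+1) = gamma R L m p.+1 *: (c ^+ p *: mu X ^+ p).
  have actP q : act i (mu X' ^+ q) = c ^+ q *: mu X ^+ q.
    by rewrite -exprZn; apply: etrans (actX hi _ _) _; rewrite muX'.
  apply: etrans (congr1 (D Y1) (esym (actP _))) _.
  apply: etrans (D4_equivariant nd _ hi Yg') _.
  apply: etrans (congr1 (act i) (D4_normalized nd p.+1)) _.
  by apply: etrans (actZ hi _ _) _; congr (_ *: _); exact: actP.
have main p : c * ycoef Y1 * evalR Y (D Y (mu X ^+ p.+1)) = gamma R L m p.+1 * kappa ^+ p.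
  have H := congr1 (evalR Y) (norm p).
  have H1 := etrans (esym H) (congr1 (evalR Y) (D_scale _ _ Y1g)).
  have H2 := etrans H1 (etrans (evalRZ OY _ _) (congr1 (fun a : C => _ * a) (D_lowest p Y1g))).
  have H3 (s t : C) := etrans (evalRZ OY s (t *: mu X ^+ p)) (congr1 (fun a : C => _ * a) (etrans (evalRZ OY t _) (congr1 (fun a : C => t * a) (evalRX OY (mu X) p)))).
  have := etrans (esym (H3 _ _)) H2.
  rewrite -/kappa exprS; have cp : c ^+ p != 0 by rewrite expf_neq0.
  move: (evalR _ _) (ycoef _) (gamma _ _ _ _) (kappa ^+ p) => a y g q E.
  apply: (mulfI cp); rewrite [RHS]mulrCA E; ring.
have y0 : c * ycoef Y1 != 0.
  apply/eqP => z; have := main 1%N; rewrite z mul0r => /esym/eqP.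
  by rewrite mulf_eq0 (negPf gamma2_neq0) expr1 (negPf kappa_neq0).
exists (c * ycoef Y1)^-1 => [|p]; first by rewrite invr_eq0.
by rewrite -mulrA -main mulKf.
Qed.

Variables (xi : RO) (muX : mu X = kappa *: xi).

Lemma D_xi : exists2 nu : C, nu != 0 & forall p, evalR Y (D Y (xi ^+ p.+1)) = nu * gamma R L m p.+1.
Proof.
have [nu nu0 H] := D_normalized_theta.
exists (nu / kappa) => [|p]; first by rewrite mulf_neq0 ?invr_eq0 ?kappa_neq0.
have kp : kappa ^+ p.+1 != 0 by rewrite expf_neq0 ?kappa_neq0.
apply: (mulfI kp); have := H p.
have E : D Y (mu X ^+ p.+1) = kappa ^+ p.+1 *: D Y (xi ^+ p.+1).
  apply: etrans (congr1 (fun w => D Y (w ^+ p.+1)) muX) _.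
  by rewrite exprZn; exact: D_scale (Y_in R L).
move/(etrans (esym (etrans (congr1 (evalR Y) E) (evalRZ OY _ _)))) => ->.
have := kappa_neq0; rewrite exprS; move: kappa (kappa ^+ p) (gamma _ _ _ _) => K q g K0.
by field.
Qed.

Variables (eta : RO) (lam : C).
Hypothesis xi1 : evalR Y xi = 1.
Hypothesis xid : in_degree 1%N xi.
Hypothesis etad : in_degree 1%N eta.
Hypothesis lam0 : forall q : nat, q%:R + lam != 0.

Lemma left_divides_poly : left_divides (fun f => euler f + lam *: f) (D X) ->
  exists A : {poly C}, forall n, evalR Y (D X (xi ^+ n.+1 * eta)) = (n.+1%:R + lam) * A.[n.+1%:R].
Proof.
case=> A dA DA; have [P HP] := diffop_poly eta (evalRD OY) (evalRM OY) xi1 dA.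
exists P => n; rewrite -HP.
have dg : in_degree n.+1 (D X (xi ^+ n.+1 * eta)).
  apply: (D_degree (Xtheta_in R L)); rewrite -[n.+2]addn1; apply: degree_mul etad.
  by have := degree_exp n.+1 xid; rewrite mul1n.
apply: etrans (congr1 (evalR Y) (euler_shift_degree lam0 dg (esym (DA _)))) _.
exact: evalRZ OY _ _.
Qed.
End Division.

(*PART Main*)
Section Final.
Variables (R : realType) (L : simple_algebra).
Local Notation C := (complex R).
Local Notation N := (matrix_size L).
Local Notation M := 'M[C]_N.
Local Notation lieg := (lieg R L).
Local Notation RO := (RO R L).
Local Notation X := (Xtheta R L).
Local Notation Y := (Ytheta R L).
Local Notation kc := (kill_const R L).
Local Notation i0 := (idx0 L).
Local Notation i1 := (idx1 L).
Local Notation r0 := (rev_ord i0).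
Local Notation r1 := (rev_ord i1).
Let OY := Omin_Ytheta R L.

Lemma kappa_scale (c : C) (xi : RO) : evalR Y xi = 1 -> mu X = c *: xi -> mu X = kappa R L *: xi.
Proof.
move=> x1 E; apply: (etrans E); congr (_ *: _).
apply: esym; apply: etrans (congr1 (evalR Y) E) _.
by apply: etrans (evalRZ OY _ _) _; rewrite x1 mulr1.
Qed.

Lemma muX_sl : is_sl L -> mu X = kc *: zeta R r0 i0.
Proof.
move=> slL; apply: etrans _ (mu_tau _).
by rewrite lproj_delta_sl ?ends_neq // /Xtheta slL.
Qed.

Lemma muX_so : is_sl L = false -> mu X = (kc * 2) *: chi R r1 r0.
Proof.
move=> soL; rewrite -scalerA; apply: esym.
apply: etrans (congr1 _ (esym (tauZ _ _))) _; apply: etrans (esym (mu_tau _)) _.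
congr mu; rewrite linearZ /= /lproj /Xtheta soL antitr_delta !rev_ordK scalerA mulfV ?pnatr_eq0 //.
by rewrite scale1r.
Qed.

Variables (m : nat) (X' Y' : M) (D : M -> RO -> RO).
Hypothesis OX : Omin X'.
Hypothesis Yg' : Y' \in lieg.
Hypothesis nd : normalized_D4 m X' Y' D.

Lemma D_Xtheta_not_divisible (lam : C) : lam = (m%:R + 1) / 2 \/ lam = (m%:R + 3) / 2 ->
  ~ left_divides (fun f => euler f + lam *: f) (D X).
Proof.
move=> lamE dv.
have lam0 (q : nat) : q%:R + lam != 0.
  case: lamE => ->.
    have -> : q%:R + (m%:R + 1) / 2 = (2 * q + m + 1)%:R / 2 :> C by field.
    by rewrite mulf_neq0 ?invr_eq0 ?pnatr_eq0 // addn1.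
  have -> : q%:R + (m%:R + 3) / 2 = (2 * q + m + 3)%:R / 2 :> C by field.
  by rewrite mulf_neq0 ?invr_eq0 ?pnatr_eq0 // addn3.
have FD := D_family nd; have kid f x (xg : x \in lieg) := esym (lowval_id D f xg).
case slL: (is_sl L).
  have xi1 : evalR Y (zeta R r0 i0) = 1.
    by apply: etrans (esym (trace_tau_self _)) _; rewrite trace_delta_Y // !eqxx.
  have muX := kappa_scale xi1 (muX_sl slL).
  have [nu nu0 Hb] := D_xi OX Yg' nd muX.
  have [A HA] := left_divides_poly Yg' nd xi1 (degree_tau _) (degree_tau (delta_mx r0 i0)) lam0 dv.
  have rr : (0 < N.-2)%N by have := size_gt2 L; lia.
  apply: (@sl_division_contradiction C N.-2 m A nu lam (fun n => evalR Y (D Y (zeta R r0 i0 ^+ n.+2))) _ rr nu0 HA lamE) => n.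
    rewrite (kid _ _ (Xtheta_in R L)) (kid _ _ (Y_in R L)); exact: sl_eta.
  by rewrite Hb /gamma /epsilon slL addr0 subr0.
have xi1 := ev_xi R erefl erefl slL.
have muX := kappa_scale xi1 (muX_so slL).
have [nu nu0 Hb] := D_xi OX Yg' nd muX.
have [A HA] := left_divides_poly Yg' nd xi1 (degree_tau _) (degree_tau (delta_mx (rev_ord (rev_ord r0)) (rev_ord r1))) lam0 dv.
have r1' : (1 < N - 4)%N by have := so_size slL; lia.
have rr := ltnW r1'.
apply: (@so_division_contradiction C (N - 4) m A nu lam (fun n => evalR Y (D Y (chi R r1 r0 ^+ n.+2))) _ rr nu0 HA lamE r1') => n.
  rewrite (kid _ _ (Xtheta_in R L)) (kid _ _ (Y_in R L)); exact: (so_eta FD slL).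
by rewrite Hb /gamma /epsilon slL.
Qed.

Lemma D_not_divisible (lam : C) : lam = (m%:R + 1) / 2 \/ lam = (m%:R + 3) / 2 ->
  forall x, x \in lieg -> x != 0 -> ~ left_divides (fun f => euler f + lam *: f) (D x).
Proof.
move=> lamE x xg x0 dv; apply: (D_Xtheta_not_divisible lamE).
apply: (left_divides_reduce (D_family nd) _ _ xg x0 dv) => [c f g|Z f Zg].
  apply: etrans (congr1 (fun w => w + _) (eulerD _ _)) _.
  apply: etrans (congr1 (fun w => w + _ + _) (eulerZ _ _)) _.
  by rewrite !scalerDr addrACA !scalerA mulrC.
apply: etrans (congr1 (fun w => w + _) (euler_ham f Zg)) _; apply: esym.
apply: etrans (hamD Zg _ _) _; exact: (congr1 (fun w => _ + w) (hamZ Zg _ _)).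
Qed.
End Final.

Theorem corollary8p2 (R : realType) (L : simple_algebra) :
  (forall (star : {poly RO R L} -> {poly RO R L} -> {poly RO R L})
          (Lambda : 'M[complex R]_(matrix_size L) -> RO R L -> RO R L),
     graded_star_product star -> star_equivariant star ->
     star_lambda star Lambda ->
     forall x, x \in lieg R L -> x != 0 -> ~ diffop (Lambda x))
  /\
  (forall (m : nat) (X h Y : 'M[complex R]_(matrix_size L))
          (D : 'M[complex R]_(matrix_size L) -> RO R L -> RO R L),
     Omin X -> h \in lieg R L -> Y \in lieg R L -> sl2_triple X h Y ->
     orbit_dim X = (2 * m + 2)%N ->
     normalized_D4 m X Y D ->
     forall x, x \in lieg R L -> x != 0 ->
       ~ left_divides (euler' m) (D x) /\
       ~ left_divides (fun f => euler' m f + f) (D x)).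
Proof.
split=> [star Lambda gsp eqv lam|m X h Y D OX _ Yg _ _ nd x xg x0].
  exact: Lambda_not_diffop gsp eqv lam.
split; first by apply: (D_not_divisible OX Yg nd) xg x0; left.
have -> : (fun f : RO R L => euler' m f + f) = (fun f => euler f + ((m%:R + 3) / 2 : complex R) *: f).
  apply/funext => f; rewrite /euler' -addrA -[X in _ + (_ + X)]scale1r -scalerDl.
  by congr (_ + _ *: _); field.
by apply: (D_not_divisible OX Yg nd) xg x0; right.
Qed.
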